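(* Assume $p>1$, $q>p-1$ and $c\in\mathbb{R}$. Let $\beta_q=\frac{p}{q+1-p}$, $\lambda_q=\beta_q(q\beta_q-2)=\beta_q\big(p-2+(p-1)\beta_q\big)$ and $c_q=\beta_q^{p-2}\lambda_q=p^{p-1}\frac{(p-2)q+2(p-1)}{(q+1-p)^p}$. Consider the $2\pi$-periodic solutions $\omega$ (functions on $S^1=\mathbb{R}/2\pi\mathbb{Z}$) of $$\frac{d}{d\sigma}\Big[\big(\beta_q^2\omega^2+\omega_\sigma^2\big)^{(p-2)/2}\omega_\sigma\Big]+\lambda_q\big(\beta_q^2\omega^2+\omega_\sigma^2\big)^{(p-2)/2}\omega+|\omega|^{q-1}\omega-c|\omega|^{p-2}\omega=0,\qquad \omega_\sigma=\frac{d\omega}{d\sigma},\tag{$*$}$$ and let $\mathcal{E}^+$ be the set of positive solutions of $( * )$ on $S^1$ and $\mathcal{E}$ the set of sign changing solutions of $( * )$ on $S^1$. Then: (i) $$\mathcal{E}=\bigcup_{k\in\mathbb{N},\,k\ge k_q}\{\omega_k(\cdot+\psi):\psi\in S^1\},$$ where $\omega_k$ is a function with least period $2\pi/k$, and where $k_q=1$ if $c\ge c_q$, while if $c<c_q$, $k_q$ is the smallest positive integer such that $k_q>M_q$, with $$M_q=\frac{\pi\beta_q^{1-p}}{2\displaystyle\int_0^{\pi/2}\frac{1+(p-1)\tan^2\theta}{\beta_q^p(p-1)\tan^2\theta+c_q-c\cos^{p-2}\theta}\,d\theta}.$$ (ii) If $c\le c_q$, $\mathcal{E}^+$ is empty.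 If $0<c-c_q\le\beta_q^{p-1}/p$, $\mathcal{E}^+$ is reduced to the constant function $(c-c_q)^{1/(q+1-p)}$. If $c-c_q>\beta_q^{p-1}/p$, $\mathcal{E}^+$ contains the constant function $(c-c_q)^{1/(q+1-p)}$ and the set $$\bigcup_{k=1}^{k_q^+}\{\omega_k^+(\cdot+\psi):\psi\in S^1\},$$ where $\omega_k^+$ is a non-constant positive function with least period $2\pi/k$, and $k_q^+$ is the largest integer (strictly) smaller than $\big(p\beta_q^{1-p}(c-c_q)\big)^{1/2}$.
   Context: A solution of $( * )$ on $S^1$ is a $2\pi$-periodic $C^1$ function $\omega$ for which $(\beta_q^2\omega^2+\omega_\sigma^2)^{(p-2)/2}\omega_\sigma$ is $C^1$ and $( * )$ holds everywhere; the expressions $(\beta_q^2\omega^2+\omega_\sigma^2)^{(p-2)/2}\omega$, $(\beta_q^2\omega^2+\omega_\sigma^2)^{(p-2)/2}\omega_\sigma$ and $|\omega|^{p-2}\omega$ are interpreted as $0$ where their arguments vanish. Such $\omega$ correspond exactly to the separable solutions $u(r,\sigma)=r^{-\beta_q}\omega(\sigma)$ in $\mathbb{R}^2\setminus\{0\}$ of $\mathrm{div}(|Du|^{p-2}Du)+|u|^{q-1}u-c|x|^{-p}|u|^{p-2}u=0$. *)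

(* Defs.v *)
From Stdlib Require Import Reals Lra.
From Coquelicot Require Import Coquelicot.
Open Scope R_scope.

Definition beta_q (p q : R) : R := p / (q + 1 - p).

Definition lambda_q (p q : R) : R := beta_q p q * (q * beta_q p q - 2).

Definition c_q (p q : R) : R := Rpower (beta_q p q) (p - 2) * lambda_q p q.

Lemma beta_q_gt0 (p q : R) : 1 < p -> p - 1 < q -> 0 < beta_q p q.
Proof. intros hp hq; apply Rdiv_lt_0_compat; lra. Qed.

Lemma lambda_qE (p q : R) : p - 1 < q ->
  lambda_q p q = beta_q p q * (p - 2 + (p - 1) * beta_q p q).
Proof. intros hq; unfold lambda_q, beta_q; field; lra. Qed.

Lemma c_qE (p q : R) : 1 < p -> p - 1 < q ->
  c_q p q = Rpower p (p - 1) *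
            (((p - 2) * q + 2 * (p - 1)) / Rpower (q + 1 - p) p).
Proof.
intros hp hq.
assert (hb : 0 < beta_q p q) by (apply beta_q_gt0; lra).
assert (hd : 0 < q + 1 - p) by lra.
assert (hbd : beta_q p q * (q + 1 - p) = p) by (unfold beta_q; field; lra).
assert (h1 : Rpower p (p - 1) =
             Rpower (beta_q p q) (p - 1) * Rpower (q + 1 - p) (p - 1))
  by (rewrite Rpower_mult_distr, hbd; trivial).
assert (h2 : Rpower (q + 1 - p) p = Rpower (q + 1 - p) (p - 1) * (q + 1 - p)).
{ rewrite <- (Rpower_1 (q + 1 - p)) at 3 by trivial.
  rewrite <- Rpower_plus; f_equal; lra. }
assert (h3 : Rpower (beta_q p q) (p - 1) =
             Rpower (beta_q p q) (p - 2) * beta_q p q).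
{ rewrite <- (Rpower_1 (beta_q p q)) at 3 by trivial.
  rewrite <- Rpower_plus; f_equal; lra. }
unfold c_q; rewrite h1, h2, h3.
assert (hpos : 0 < Rpower (q + 1 - p) (p - 1)) by apply exp_pos.
unfold lambda_q, beta_q at 2 3 5; field; lra.
Qed.

(* [Rpower x a] has the junk value 1 for [x <= 0].  In [flux] and
   [is_solution] a base can only fail to be positive by being 0, and then the
   factor multiplying the power is 0 too, so the product is 0 as intended. *)
Definition energy_pow (p q : R) (w : R -> R) (s : R) : R :=
  Rpower ((beta_q p q) ^ 2 * (w s) ^ 2 + (Derive w s) ^ 2) ((p - 2) / 2).

Definition flux (p q : R) (w : R -> R) (s : R) : R :=
  energy_pow p q w s * Derive w s.

Definition is_C1 (f : R -> R) : Prop :=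
  forall s, ex_derive f s /\ continuous (Derive f) s.

(* Functions on the circle are 2 PI-periodic functions on R. *)
Definition is_solution (p q c : R) (w : R -> R) : Prop :=
  (forall s, w (s + 2 * PI) = w s) /\
  is_C1 w /\
  is_C1 (flux p q w) /\
  forall s,
    Derive (flux p q w) s + lambda_q p q * (energy_pow p q w s * w s)
    + Rpower (Rabs (w s)) (q - 1) * w s
    - c * (Rpower (Rabs (w s)) (p - 2) * w s) = 0.

Definition is_positive (w : R -> R) : Prop := forall s, 0 < w s.

Definition sign_changing (w : R -> R) : Prop :=
  (exists s, 0 < w s) /\ (exists s, w s < 0).

Definition positive_solution (p q c : R) (w : R -> R) : Prop :=
  is_solution p q c w /\ is_positive w.

Definition sign_changing_solution (p q c : R) (w : R -> R) : Prop :=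
  is_solution p q c w /\ sign_changing w.

Definition is_least_period (f : R -> R) (T : R) : Prop :=
  0 < T /\
  (forall s, f (s + T) = f s) /\
  forall T', 0 < T' < T -> ~ (forall s, f (s + T') = f s).

Definition nonconstant (f : R -> R) : Prop := exists s t, f s <> f t.

(* For [c < c_q p q] the integrand is continuous on [0, PI / 2) and has a finite
   limit at PI / 2; its junk value at PI / 2 does not affect [RInt]. *)
Definition M_q (p q c : R) : R :=
  PI * Rpower (beta_q p q) (1 - p) /
  (2 * RInt (fun theta =>
         (1 + (p - 1) * (tan theta) ^ 2) /
         (Rpower (beta_q p q) p * (p - 1) * (tan theta) ^ 2
          + c_q p q - c * Rpower (cos theta) (p - 2)))
       0 (PI / 2)).

Definition is_k_q (p q c : R) (k : nat) : Prop :=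
  (c_q p q <= c -> k = 1%nat) /\
  (c < c_q p q ->
     (1 <= k)%nat /\ M_q p q c < INR k /\
     forall j : nat, (1 <= j)%nat -> M_q p q c < INR j -> (k <= j)%nat).

(* Only used when the square root exceeds 1, so that the largest integer below
   it is a natural number. *)
Definition is_k_q_plus (p q c : R) (k : nat) : Prop :=
  let x := sqrt (p * Rpower (beta_q p q) (1 - p) * (c - c_q p q)) in
  INR k < x /\ forall j : nat, INR j < x -> (j <= k)%nat.

Definition constant_value (p q c : R) : R :=
  Rpower (c - c_q p q) (1 / (q + 1 - p)).

(* Main.v *)
(* For f > 0 put y = f'/(beta f) and x = ln (beta^(1-p) f^(q+1-p)); the equation
   becomes the planar system x' = p y, a(y) y' = - (B(y) - C + exp x), where
   C = beta^(1-p) c, a > 0 and B >= B(0) = beta^(1-p) c_q; a and B are even, so the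
   system is reversible under (x, y, t) -> (x, - y, - t).

   Sign changing solutions.  In polar coordinates w = rho sin a, w' = beta rho cos a
   the function X = ln (beta^(1-p) rho^(q+1-p)) depends only on u = sin a and solves
   a scalar equation dX/du = F(u, X), F odd in u; it is indexed by x1 = X(0), that is
   by the slope of w at its zeros.  Orbits do not cross and a' increases with X, so
   the distance between consecutive zeros is a continuous strictly decreasing
   function of x1.  It tends to 0 as x1 -> +oo; as x1 -> -oo it tends to pi / M_q
   if c < c_q and to +oo if c >= c_q.  Closing up on the circle means that it equals
   pi / k.

   Positive solutions.  When p (C - B(0)) > k^2, shooting from (x_a, 0) below the
   centre ln (C - B(0)) gives an orbit of period 2 pi / k: the first return of y
   to 0 comes before pi / k near the centre (Sturm comparison) and after pi / k far
   from it.  When p (C - B(0)) <= 1 a positive solution is constant: on an arc of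
   length at most pi between a maximum and a minimum, U = z^(j/p) phi(y), z = exp x,
   vanishes at both ends, and for j = 0 (p >= 2) or j = 1 - p (p < 2) there is a
   function K of (x, y), vanishing with y, such that U'^2 - U^2 + K' < 0 wherever
   y <> 0; this contradicts the Wirtinger inequality. *)

Require Import Defs.
From Stdlib Require Import Reals ZArith Lra Lia ClassicalEpsilon FunctionalExtensionality.
From Coquelicot Require Import Coquelicot.
Open Scope R_scope.

(** * Derivatives and integrals on the real line *)

(** Zeros of w are the obstacle: for p < 2 the term |w|^(p-2) w is only Hölder continuous there, so
    the Cauchy problem in (w, w') is not Lipschitz. With u = sin a as independent variable such
    terms become known functions of u multiplied by constants or by V = exp X: the scalar equation
    is merely continuous in u but locally Lipschitz in X, as long as its denominator Th stays
    positive. That positivity is the second difficulty. One has Th = J(u) + V |u|^(q+1) with J(1) =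
    B(0) - C, nonpositive when c >= c_q; then only the second term can keep the angle turning. It is
    nondecreasing on [0, 1], and its growth rate is of order 1 / Th where Th is small, which
    prevents Th from reaching 0. The function K of the rigidity argument is determined by the
    requirement that every term containing z cancel in U'^2 - U^2 + K', so that a function of y
    alone remains. Existence theorems are applied to bounded, globally Lipschitz fields: each field
    is cut off, and a priori bounds then show that the cut-off is inactive on the orbit obtained. *)

Lemma derive_mvt (f df : R -> R) (a b : R) : a < b ->
  (forall x, a < x < b -> is_derive f x (df x)) ->
  (forall x, a <= x <= b -> continuous f x) ->
  exists x, a < x < b /\ f b - f a = df x * (b - a).
Proof.
intros hab hd hc.
assert (pr : forall x, a < x < b -> derivable_pt f x).
{ intros x hx; exists (df x); apply is_derive_Reals; auto. }
destruct (MVT f id a b pr (fun x _ => derivable_pt_id x)) as [x [hx e]].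
- lra.
- intros y hy; apply continuity_pt_filterlim; apply hc; lra.
- intros y hy; apply derivable_continuous_pt, derivable_pt_id.
- exists x; split; [trivial|].
  rewrite derive_pt_id in e; unfold id in e.
  assert (derive_pt f x (pr x hx) = df x).
  { apply derive_pt_eq_0, is_derive_Reals; auto. }
  rewrite H in e; lra.
Qed.

Lemma derive_nonneg_le (f df : R -> R) (a b : R) : a <= b ->
  (forall x, a < x < b -> is_derive f x (df x)) ->
  (forall x, a <= x <= b -> continuous f x) ->
  (forall x, a < x < b -> 0 <= df x) -> f a <= f b.
Proof.
intros hab hd hc hp.
destruct (Req_dec a b) as [->|hne]; [lra|].
destruct (derive_mvt f df a b) as [x [hx e]]; auto; try lra.
specialize (hp x hx); nra.
Qed.

Lemma derive_pos_lt (f df : R -> R) (a b : R) : a < b ->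
  (forall x, a < x < b -> is_derive f x (df x)) ->
  (forall x, a <= x <= b -> continuous f x) ->
  (forall x, a < x < b -> 0 < df x) -> f a < f b.
Proof.
intros hab hd hc hp.
destruct (derive_mvt f df a b) as [x [hx e]]; auto; try lra.
specialize (hp x hx); nra.
Qed.

Lemma derive_zero_eq (f df : R -> R) (a b : R) : a <= b ->
  (forall x, a < x < b -> is_derive f x (df x)) ->
  (forall x, a <= x <= b -> continuous f x) ->
  (forall x, a < x < b -> df x = 0) -> f a = f b.
Proof.
intros hab hd hc hp.
destruct (Req_dec a b) as [->|hne]; [lra|].
destruct (derive_mvt f df a b) as [x [hx e]]; auto; try lra.
rewrite (hp x hx) in e; lra.
Qed.

Lemma is_derive_continuous (f : R -> R) (x d : R) : is_derive f x d -> continuous f x.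
Proof. intros h; apply (ex_derive_continuous (V := R_NormedModule)); exists d; trivial. Qed.

(** [N] times exp (- K x) is nonincreasing and [N] times exp (K x) is nondecreasing. The second half
    is the one that keeps a quantity nonzero: if [N a] is positive, so is [N b]. *)
Lemma gronwall (N dN : R -> R) (K a b : R) : a <= b ->
  (forall x, a < x < b -> is_derive N x (dN x)) ->
  (forall x, a <= x <= b -> continuous N x) ->
  (forall x, a < x < b -> Rabs (dN x) <= K * N x) ->
  N b <= N a * exp (K * (b - a)) /\ N a <= N b * exp (K * (b - a)).
Proof.
intros hab hd hc hb.
assert (e1 : forall k x, is_derive (fun x => exp (k * x)) x (k * exp (k * x))).
{ intros k x; auto_derive; trivial; ring. }
assert (cont : forall k x, a <= x <= b -> continuous (fun x => N x * exp (k * x)) x).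
{ intros k x hx; apply (continuous_mult N (fun x => exp (k * x))); auto.
  eapply is_derive_continuous; apply e1. }
assert (der : forall k x, a < x < b ->
   is_derive (fun x => N x * exp (k * x)) x ((dN x + k * N x) * exp (k * x))).
{ intros k x hx.
  replace ((dN x + k * N x) * exp (k * x)) with
   (dN x * exp (k * x) + N x * (k * exp (k * x))) by ring.
  apply (is_derive_mult N (fun x => exp (k * x))); auto using Rmult_comm. }
split.
- assert (h : - (N a * exp (- K * a)) <= - (N b * exp (- K * b))).
  { apply (derive_nonneg_le (fun x => - (N x * exp (- K * x)))
           (fun x => - ((dN x + - K * N x) * exp (- K * x)))); trivial.
    - intros x hx; apply (is_derive_opp (fun x => N x * exp (- K * x))); auto.
    - intros x hx; apply (continuous_opp (fun x => N x * exp (- K * x))); auto.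
    - intros x hx; specialize (hb x hx); apply Rabs_le_between in hb.
      pose proof (exp_pos (- K * x)); nra. }
  apply (Rmult_le_reg_r (exp (- K * b))); [apply exp_pos|].
  rewrite Rmult_assoc, <- exp_plus.
  replace (K * (b - a) + - K * b) with (- K * a) by ring; lra.
- assert (h : N a * exp (K * a) <= N b * exp (K * b)).
  { apply (derive_nonneg_le (fun x => N x * exp (K * x))
           (fun x => (dN x + K * N x) * exp (K * x))); auto.
    intros x hx; specialize (hb x hx); apply Rabs_le_between in hb.
    pose proof (exp_pos (K * x)); nra. }
  apply (Rmult_le_reg_r (exp (K * a))); [apply exp_pos|].
  rewrite Rmult_assoc, <- exp_plus.
  replace (K * (b - a) + K * a) with (K * b) by ring; lra.
Qed.

Lemma continuous_abs_bound (f : R -> R) (x : R) :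
  (forall eps, 0 < eps -> exists d, 0 < d /\ forall t : R, Rabs (t - x) < d -> Rabs (f t - f x) < eps) ->
  continuous f x.
Proof.
intros h P [eps hP].
destruct (h eps (cond_pos eps)) as [d [hd hd2]].
exists (mkposreal d hd); intros t ht; apply hP.
apply hd2; exact ht.
Qed.

Lemma continuous_eps (f : R -> R) (x eps : R) : continuous f x -> 0 < eps ->
  exists d, 0 < d /\ forall t : R, Rabs (t - x) < d -> Rabs (f t - f x) < eps.
Proof.
intros h he.
destruct (h (ball (f x) eps)) as [d hd].
- exists (mkposreal eps he); intros t ht; exact ht.
- exists d; split; [apply cond_pos|]; intros t ht; apply (hd t ht).
Qed.

Lemma RInt_exp_bound (h : R -> R) (K l t : R) : 0 < l -> 0 <= K ->
  (forall s, continuous h s) ->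
  (forall s, Rabs (h s) <= K * exp (l * Rabs s)) ->
  Rabs (RInt h 0 t) <= K / l * exp (l * Rabs t).
Proof.
assert (pos : forall (h : R -> R) (K l t : R), 0 < l -> 0 <= K -> 0 <= t ->
  (forall s, continuous h s) ->
  (forall s, 0 < s -> Rabs (h s) <= K * exp (l * s)) ->
  Rabs (RInt h 0 t) <= K / l * exp (l * t)).
{ clear; intros h K l t hl hK ht hc hb.
  assert (e1 : forall x, is_derive (fun x => K / l * exp (l * x)) x (K * exp (l * x))).
  { intros x; auto_derive; trivial; field; lra. }
  assert (e2 : forall x, is_derive (fun x => RInt h 0 x) x (h x)).
  { intros x; apply is_derive_RInt with 0; [|apply hc].
    apply filter_forall; intros u; apply (RInt_correct h 0 u).
    apply ex_RInt_continuous; auto. }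
  assert (z : RInt h 0 0 = 0) by (apply (RInt_point (V := R_CompleteNormedModule))).
  assert (kl : 0 <= K / l) by (apply Rdiv_le_0_compat; lra).
  apply Rabs_le; split.
  - assert (K / l * exp (l * 0) + RInt h 0 0 <= K / l * exp (l * t) + RInt h 0 t).
    { apply (derive_nonneg_le (fun x => K / l * exp (l * x) + RInt h 0 x)
             (fun x => K * exp (l * x) + h x)); trivial.
      - intros x hx; apply (is_derive_plus (fun x => K / l * exp (l * x))); auto.
      - intros x hx; apply (continuous_plus (fun x => K / l * exp (l * x)) (fun x => RInt h 0 x)); eapply is_derive_continuous; eauto.
      - intros x hx; specialize (hb x (proj1 hx)); apply Rabs_le_between in hb; lra. }
    rewrite z, Rmult_0_r, exp_0 in H; lra.
  - assert (K / l * exp (l * 0) - RInt h 0 0 <= K / l * exp (l * t) - RInt h 0 t).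
    { apply (derive_nonneg_le (fun x => K / l * exp (l * x) - RInt h 0 x)
             (fun x => K * exp (l * x) - h x)); trivial.
      - intros x hx; apply (is_derive_minus (fun x => K / l * exp (l * x))); auto.
      - intros x hx; apply (continuous_minus (fun x => K / l * exp (l * x)) (fun x => RInt h 0 x)); eapply is_derive_continuous; eauto.
      - intros x hx; specialize (hb x (proj1 hx)); apply Rabs_le_between in hb; lra. }
    rewrite z, Rmult_0_r, exp_0 in H; lra. }
intros hl hK hc hb.
destruct (Rle_dec 0 t) as [ht|ht].
- rewrite (Rabs_pos_eq t) by trivial; apply pos; trivial.
  intros s hs; rewrite <- (Rabs_pos_eq s) at 2 by lra; apply hb.
- assert (ch : forall s, continuous (fun s => - h (- s)) s).
  { intros s; apply (continuous_opp (fun s => h (- s))).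
    apply (continuous_comp Ropp h); [apply (continuous_opp (fun x : R => x)), continuous_id | apply hc]. }
  assert (e : RInt h 0 t = RInt (fun s => - h (- s)) 0 (- t)).
  { symmetry; apply is_RInt_unique.
    apply (is_RInt_comp_opp (V := R_NormedModule) h 0 (- t)).
    rewrite Ropp_involutive, Ropp_0.
    apply (RInt_correct (V := R_CompleteNormedModule)), ex_RInt_continuous; auto. }
  rewrite e, (Rabs_left t) by lra; apply pos; trivial; try lra.
  intros s hs; rewrite Rabs_Ropp; replace s with (Rabs (- s)) at 2; [apply hb|].
  rewrite Rabs_Ropp; apply Rabs_pos_eq; lra.
Qed.

Lemma cont_const (c x : R) : continuous (fun _ : R => c) x.
Proof. apply continuous_const. Qed.
Lemma cont_id (x : R) : continuous (fun x : R => x) x.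
Proof. apply continuous_id. Qed.
Lemma cont_plus (f g : R -> R) (x : R) : continuous f x -> continuous g x ->
  continuous (fun x => f x + g x) x.
Proof. apply (continuous_plus (V := R_NormedModule)). Qed.
Lemma cont_minus (f g : R -> R) (x : R) : continuous f x -> continuous g x ->
  continuous (fun x => f x - g x) x.
Proof. apply (continuous_minus (V := R_NormedModule)). Qed.
Lemma cont_opp (f : R -> R) (x : R) : continuous f x -> continuous (fun x => - f x) x.
Proof. apply (continuous_opp (V := R_NormedModule)). Qed.
Lemma cont_mult (f g : R -> R) (x : R) : continuous f x -> continuous g x ->
  continuous (fun x => f x * g x) x.
Proof. apply (continuous_mult (K := R_AbsRing)). Qed.
Lemma cont_comp (f g : R -> R) (x : R) : continuous f x -> continuous g (f x) ->
  continuous (fun x => g (f x)) x.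
Proof. apply continuous_comp. Qed.
Lemma cont_inv (f : R -> R) (x : R) : continuous f x -> f x <> 0 ->
  continuous (fun x => / f x) x.
Proof. intros h1 h2; apply (cont_comp f Rinv); [trivial|]; apply continuity_pt_filterlim, (continuity_pt_inv id); [apply derivable_continuous_pt, derivable_pt_id | exact h2]. Qed.
Lemma cont_div (f g : R -> R) (x : R) : continuous f x -> continuous g x -> g x <> 0 ->
  continuous (fun x => f x / g x) x.
Proof. intros; apply (cont_mult f (fun x => / g x)); trivial; apply cont_inv; trivial. Qed.
Lemma cont_abs (f : R -> R) (x : R) : continuous f x -> continuous (fun x => Rabs (f x)) x.
Proof. intros h; apply (cont_comp f Rabs); [trivial | apply continuous_Rabs]. Qed.

Lemma Rmin_abs (a b : R) : Rmin a b = (a + b - Rabs (a - b)) / 2.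
Proof. unfold Rmin, Rabs; destruct (Rle_dec a b), (Rcase_abs (a - b)); lra. Qed.
Lemma Rmax_abs (a b : R) : Rmax a b = (a + b + Rabs (a - b)) / 2.
Proof. unfold Rmax, Rabs; destruct (Rle_dec a b), (Rcase_abs (a - b)); lra. Qed.
Lemma cont_Rmin (f g : R -> R) (x : R) : continuous f x -> continuous g x ->
  continuous (fun x => Rmin (f x) (g x)) x.
Proof.
intros; apply continuous_ext with (fun x => (f x + g x - Rabs (f x - g x)) / 2).
- intros; symmetry; apply Rmin_abs.
- apply cont_div; [|apply cont_const|lra].
  apply cont_minus; [apply cont_plus; trivial | apply cont_abs, cont_minus; trivial].
Qed.
Lemma cont_Rmax (f g : R -> R) (x : R) : continuous f x -> continuous g x ->
  continuous (fun x => Rmax (f x) (g x)) x.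
Proof.
intros; apply continuous_ext with (fun x => (f x + g x + Rabs (f x - g x)) / 2).
- intros; symmetry; apply Rmax_abs.
- apply cont_div; [|apply cont_const|lra].
  apply cont_plus; [apply cont_plus; trivial | apply cont_abs, cont_minus; trivial].
Qed.

Lemma exp_le_mono (x y : R) : x <= y -> exp x <= exp y.
Proof. intros [h | ->]; [left; apply exp_increasing; trivial | right; trivial]. Qed.

(** * The Picard theorem for planar systems *)

Lemma geometric_cauchy_lim (u : nat -> R) (B : R) :
  (forall n, Rabs (u (S n) - u n) <= B * (/ 2) ^ n) ->
  forall n, Rabs (u n - real (Lim_seq u)) <= 2 * B * (/ 2) ^ n.
Proof.
intros h.
assert (hB : 0 <= B).
{ pose proof (h 0%nat); pose proof (Rabs_pos (u 1%nat - u 0%nat)); simpl in *; lra. }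
assert (h2 : forall n k, Rabs (u (n + k)%nat - u n) <= 2 * B * (/ 2) ^ n - 2 * B * (/ 2) ^ (n + k)).
{ intros n; induction k as [|k IH].
  - rewrite Nat.add_0_r; replace (u n - u n) with 0 by ring; rewrite Rabs_R0; lra.
  - rewrite Nat.add_succ_r.
    replace (u (S (n + k)) - u n) with ((u (S (n + k)) - u (n + k)%nat) + (u (n + k)%nat - u n)) by ring.
    eapply Rle_trans; [apply Rabs_triang|].
    pose proof (h (n + k)%nat); simpl; lra. }
assert (ppos : forall n, 0 < (/ 2) ^ n) by (intros n; apply pow_lt; lra).
assert (h3 : forall n k, Rabs (u (n + k)%nat - u n) <= 2 * B * (/ 2) ^ n).
{ intros n k; pose proof (h2 n k); pose proof (ppos (n + k)%nat); nra. }
assert (ex : ex_finite_lim_seq u).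
{ apply ex_lim_seq_cauchy_corr; intros eps.
  destruct (pow_lt_1_zero (/ 2)) with (y := eps / (4 * B + 1)) as [N hN].
  - rewrite Rabs_pos_eq; lra.
  - apply Rdiv_lt_0_compat; [apply cond_pos|lra].
  - exists N.
    assert (hh : forall n, (N <= n)%nat -> Rabs (u n - u N) < eps / 2).
    { intros n hn; replace n with (N + (n - N))%nat by lia.
      eapply Rle_lt_trans; [apply h3|].
      specialize (hN N (le_n _)); rewrite Rabs_pos_eq in hN by (left; apply ppos).
      pose proof (cond_pos eps); pose proof (ppos N).
      apply (Rmult_lt_compat_l (4 * B + 1)) in hN; [|lra].
      replace ((4 * B + 1) * (eps / (4 * B + 1))) with (pos eps) in hN by (field; lra).
      nra. }
    intros n m hn hm.
    replace (u n - u m) with ((u n - u N) + - (u m - u N)) by ring.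
    eapply Rle_lt_trans; [apply Rabs_triang|]; rewrite Rabs_Ropp.
    pose proof (hh n hn); pose proof (hh m hm); lra. }
intros n.
destruct ex as [l hl].
rewrite (is_lim_seq_unique _ _ hl); simpl.
assert (hl2 : is_lim_seq (fun k => Rabs (u (n + k)%nat - u n)) (Rabs (l - u n))).
{ apply (is_lim_seq_abs (fun k => u (n + k)%nat - u n) (l - u n)).
  apply (is_lim_seq_minus' (fun k => u (n + k)%nat) (fun _ => u n)).
  - apply is_lim_seq_ext with (fun k => u (k + n)%nat); [intros k; f_equal; lia|].
    apply is_lim_seq_incr_n; trivial.
  - apply is_lim_seq_const. }
rewrite Rabs_minus_sym.
exact (is_lim_seq_le _ _ _ _ (h3 n) hl2 (is_lim_seq_const _)).
Qed.

Section Picard.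

Variables (f g : R -> R -> R -> R) (L M : R) (x0 y0 : R).

(** The last clause asks for continuity along continuous curves instead of joint continuity: the
    integrals need no more, and cut-off fields satisfy it by composition. *)
Definition lipschitz_field (f : R -> R -> R -> R) : Prop :=
  (forall t x y x' y', Rabs (f t x y - f t x' y') <= L * (Rabs (x - x') + Rabs (y - y'))) /\
  (forall t x y, Rabs (f t x y) <= M) /\
  (forall x y : R -> R, (forall t, continuous x t) -> (forall t, continuous y t) ->
     forall t, continuous (fun s => f s (x s) (y s)) t).

Fixpoint picard_iter (n : nat) : (R -> R) * (R -> R) :=
  match n with
  | O => ((fun _ => x0), (fun _ => y0))
  | S n => let x := fst (picard_iter n) in let y := snd (picard_iter n) in
           ((fun t => x0 + RInt (fun s => f s (x s) (y s)) 0 t),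
            (fun t => y0 + RInt (fun s => g s (x s) (y s)) 0 t))
  end.

Hypothesis hL : 0 < L.
Hypothesis hf : lipschitz_field f.
Hypothesis hg : lipschitz_field g.

Lemma is_derive_RInt0 (h : R -> R) (a t : R) : (forall s, continuous h s) ->
  is_derive (fun t => RInt h a t) t (h t).
Proof.
intros hc; apply is_derive_RInt with a; [|apply hc].
apply filter_forall; intros u; apply (RInt_correct h a u).
apply (ex_RInt_continuous (V := R_CompleteNormedModule)); auto.
Qed.

(** Integrating the weight exp (4 L |t|) gains 1 / (4 L), and the Lipschitz bound costs 2 L: the
    Picard map halves the weighted distance on the whole line at once, so no continuation of local
    solutions is needed. *)
Lemma picard_step (h : R -> R -> R -> R) (x y x' y' : R -> R) (B : R) (t : R) :
  lipschitz_field h -> 0 <= B ->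
  (forall t, continuous x t) -> (forall t, continuous y t) ->
  (forall t, continuous x' t) -> (forall t, continuous y' t) ->
  (forall t, Rabs (x t - x' t) <= B * exp (4 * L * Rabs t)) ->
  (forall t, Rabs (y t - y' t) <= B * exp (4 * L * Rabs t)) ->
  Rabs (RInt (fun s => h s (x s) (y s)) 0 t - RInt (fun s => h s (x' s) (y' s)) 0 t)
  <= B / 2 * exp (4 * L * Rabs t).
Proof.
intros [h1 [h2 h3]] hB cx cy cx' cy' bx by'.
rewrite <- (RInt_minus (V := R_CompleteNormedModule) (fun s => h s (x s) (y s)) (fun s => h s (x' s) (y' s))).
- replace (B / 2) with (2 * L * B / (4 * L)) by (field; lra).
  apply RInt_exp_bound; try nra.
  + intros s; apply (continuous_minus (fun s => h s (x s) (y s)) (fun s => h s (x' s) (y' s))); auto.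
  + intros s; eapply Rle_trans; [apply h1|].
    specialize (bx s); specialize (by' s); nra.
- apply (ex_RInt_continuous (V := R_CompleteNormedModule)); auto.
- apply (ex_RInt_continuous (V := R_CompleteNormedModule)); auto.
Qed.

Lemma picard_iter_continuous (n : nat) :
  (forall t, continuous (fst (picard_iter n)) t) /\ (forall t, continuous (snd (picard_iter n)) t).
Proof.
induction n as [|n [IH1 IH2]]; simpl.
- split; intros t; apply continuous_const.
- split; intros t; apply cont_plus; try apply cont_const; eapply is_derive_continuous, is_derive_RInt0;
   [apply hf | apply hg]; trivial.
Qed.

Let K := M / (4 * L).

Lemma picard_M : 0 <= M.
Proof. destruct hf as [_ [h _]]; pose proof (h 0 0 0); pose proof (Rabs_pos (f 0 0 0)); lra. Qed.

Lemma picard_iter_bound (n : nat) (t : R) :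
  Rabs (fst (picard_iter (S n)) t - fst (picard_iter n) t) <= K * exp (4 * L * Rabs t) * (/ 2) ^ n /\
  Rabs (snd (picard_iter (S n)) t - snd (picard_iter n) t) <= K * exp (4 * L * Rabs t) * (/ 2) ^ n.
Proof.
assert (hK : 0 <= K) by (apply Rdiv_le_0_compat; [apply picard_M | lra]).
revert t; induction n as [|n IH]; intros t.
- assert (h0 : forall h, lipschitz_field h ->
     forall z, Rabs (z + RInt (fun s => h s x0 y0) 0 t - z) <= K * exp (4 * L * Rabs t) * (/ 2) ^ 0).
  { intros h [h1 [h2 h3]] z.
    rewrite Rplus_minus_l.
    simpl; rewrite Rmult_1_r; apply RInt_exp_bound; try lra.
    - apply picard_M.
    - apply h3; intros; apply continuous_const.
    - intros s; eapply Rle_trans; [apply h2|].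
      pose proof (exp_ineq1_le (4 * L * Rabs s)); pose proof (Rabs_pos s); pose proof picard_M.
      assert (0 <= 4 * L * Rabs s) by nra; nra. }
  split; apply h0; trivial.
- destruct (picard_iter_continuous n), (picard_iter_continuous (S n)).
  assert (hB : 0 <= K * (/ 2) ^ n) by (apply Rmult_le_pos; [|apply pow_le]; lra).
  assert (st : forall h, lipschitz_field h -> forall z,
    Rabs ((z + RInt (fun s => h s (fst (picard_iter (S n)) s) (snd (picard_iter (S n)) s)) 0 t) -
          (z + RInt (fun s => h s (fst (picard_iter n) s) (snd (picard_iter n) s)) 0 t))
     <= K * exp (4 * L * Rabs t) * (/ 2) ^ S n).
  { intros h hh z.
    replace (K * exp (4 * L * Rabs t) * (/ 2) ^ S n) with (K * (/ 2) ^ n / 2 * exp (4 * L * Rabs t)) by (simpl; field).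
    rewrite Rminus_plus_l_l.
    apply picard_step; trivial; intros s; destruct (IH s); lra. }
  split; apply st; trivial.
Qed.

(** The iterates converge with the rate 2^(-n) in the weighted distance, hence uniformly on bounded
    sets; this passes continuity and then the integral equation to the limit. *)
Lemma picard_existence : exists x y : R -> R, x 0 = x0 /\ y 0 = y0 /\
  (forall t, is_derive x t (f t (x t) (y t))) /\ (forall t, is_derive y t (g t (x t) (y t))).
Proof.
assert (hK : 0 <= K) by (apply Rdiv_le_0_compat; [apply picard_M | lra]).
pose (x := fun t => real (Lim_seq (fun n => fst (picard_iter n) t))).
pose (y := fun t => real (Lim_seq (fun n => snd (picard_iter n) t))).
assert (bx : forall n t, Rabs (fst (picard_iter n) t - x t) <= 2 * (K * exp (4 * L * Rabs t)) * (/ 2) ^ n).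
{ intros n t; apply (geometric_cauchy_lim (fun n => fst (picard_iter n) t)); intros k; apply picard_iter_bound. }
assert (by' : forall n t, Rabs (snd (picard_iter n) t - y t) <= 2 * (K * exp (4 * L * Rabs t)) * (/ 2) ^ n).
{ intros n t; apply (geometric_cauchy_lim (fun n => snd (picard_iter n) t)); intros k; apply picard_iter_bound. }
assert (small : forall B eps, 0 <= B -> 0 < eps -> exists n, B * (/ 2) ^ n < eps).
{ intros B eps hB he.
  destruct (pow_lt_1_zero (/ 2)) with (y := eps / (B + 1)) as [N hN].
  - rewrite Rabs_pos_eq; lra.
  - apply Rdiv_lt_0_compat; lra.
  - exists N; specialize (hN N (le_n _)).
    assert (0 < (/ 2) ^ N) by (apply pow_lt; lra).
    rewrite Rabs_pos_eq in hN by lra.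
    apply (Rmult_lt_compat_l (B + 1)) in hN; [|lra].
    replace ((B + 1) * (eps / (B + 1))) with eps in hN by (field; lra); nra. }
assert (cont : forall (u : nat -> R -> R) v, (forall n t, continuous (u n) t) ->
   (forall n t, Rabs (u n t - v t) <= 2 * (K * exp (4 * L * Rabs t)) * (/ 2) ^ n) ->
   forall t, continuous v t).
{ intros u v cu bu t; apply continuous_abs_bound; intros eps he.
  pose (B := 2 * (K * exp (4 * L * (Rabs t + 1)))).
  assert (hB : 0 <= B) by (unfold B; pose proof (exp_pos (4 * L * (Rabs t + 1))); nra).
  destruct (small B (eps / 3)) as [n hn]; trivial; try lra.
  destruct (continuous_eps (u n) t (eps / 3)) as [d [hd hd2]]; auto; try lra.
  assert (bb : forall s, Rabs (s - t) < 1 -> Rabs (u n s - v s) < eps / 3).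
  { intros s hs; eapply Rle_lt_trans; [apply bu|]; eapply Rle_lt_trans; [|exact hn].
    apply Rmult_le_compat_r; [apply pow_le; lra|].
    unfold B; apply Rmult_le_compat_l; [lra|]; apply Rmult_le_compat_l; trivial.
    apply exp_le_mono; apply Rmult_le_compat_l; [lra|].
    pose proof (Rabs_triang_inv s t); lra. }
  exists (Rmin d 1); split; [apply Rmin_pos; lra|].
  intros s hs.
  assert (h1 : Rabs (s - t) < d) by (pose proof (Rmin_l d 1); lra).
  assert (h2 : Rabs (s - t) < 1) by (pose proof (Rmin_r d 1); lra).
  pose proof (hd2 s h1) as e1; pose proof (bb s h2) as e2.
  assert (e3 : Rabs (u n t - v t) < eps / 3) by (apply bb; replace (t - t) with 0 by ring; rewrite Rabs_R0; lra).
  apply Rabs_lt_between in e1; apply Rabs_lt_between in e2; apply Rabs_lt_between in e3.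
  apply Rabs_lt_between; lra. }
assert (cx : forall t, continuous x t).
{ apply (cont (fun n => fst (picard_iter n))); trivial; apply picard_iter_continuous. }
assert (cy : forall t, continuous y t).
{ apply (cont (fun n => snd (picard_iter n))); trivial; apply picard_iter_continuous. }
assert (eqn : forall h, lipschitz_field h -> forall (u : nat -> R -> R) v z,
   (forall n t, u (S n) t = z + RInt (fun s => h s (fst (picard_iter n) s) (snd (picard_iter n) s)) 0 t) ->
   (forall n t, Rabs (u n t - v t) <= 2 * (K * exp (4 * L * Rabs t)) * (/ 2) ^ n) ->
   forall t, v t = z + RInt (fun s => h s (x s) (y s)) 0 t).
{ intros h hh u v z hu bu t.
  set (I := RInt (fun s => h s (x s) (y s)) 0 t).
  destruct (Req_dec (v t) (z + I)) as [e|ne]; trivial; exfalso.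
  pose (eps := Rabs (v t - (z + I))).
  assert (he : 0 < eps) by (apply Rabs_pos_lt; lra).
  pose (B := 4 * (K * exp (4 * L * Rabs t))).
  assert (hB : 0 <= B) by (unfold B; pose proof (exp_pos (4 * L * Rabs t)); nra).
  destruct (small B eps) as [n hn]; trivial.
  pose proof (bu (S n) t) as h1; rewrite hu in h1.
  destruct (picard_iter_continuous n) as [c1 c2].
  assert (h2 : Rabs (RInt (fun s => h s (fst (picard_iter n) s) (snd (picard_iter n) s)) 0 t - I) <=
     (2 * K * (/ 2) ^ n) / 2 * exp (4 * L * Rabs t)).
  { apply picard_step; trivial.
    - assert (0 < (/ 2) ^ n) by (apply pow_lt; lra); nra.
    - intros s; specialize (bx n s); lra.
    - intros s; specialize (by' n s); lra. }
  simpl in h1.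
  set (J := RInt (fun s => h s (fst (picard_iter n) s) (snd (picard_iter n) s)) 0 t) in *.
  assert (eps <= Rabs (z + J - v t) + Rabs (J - I)).
  { unfold eps; replace (v t - (z + I)) with (- (z + J - v t) + (J - I)) by ring.
    eapply Rle_trans; [apply Rabs_triang|]; rewrite Rabs_Ropp; lra. }
  assert (0 < (/ 2) ^ n) by (apply pow_lt; lra).
  pose proof (exp_pos (4 * L * Rabs t)).
  assert (0 <= K * exp (4 * L * Rabs t) * (/ 2) ^ n) by (apply Rmult_le_pos; [apply Rmult_le_pos|]; lra).
  unfold B in hn; lra. }
assert (ex : forall t, x t = x0 + RInt (fun s => f s (x s) (y s)) 0 t).
{ apply (eqn f hf (fun n => fst (picard_iter n))); trivial. }
assert (ey : forall t, y t = y0 + RInt (fun s => g s (x s) (y s)) 0 t).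
{ apply (eqn g hg (fun n => snd (picard_iter n))); trivial. }
assert (der : forall h z, lipschitz_field h -> forall t,
   is_derive (fun t => z + RInt (fun s => h s (x s) (y s)) 0 t) t (h t (x t) (y t))).
{ intros h z hh t; replace (h t (x t) (y t)) with (0 + h t (x t) (y t)) by ring.
  apply (is_derive_plus (fun _ : R => z) (fun t => RInt (fun s => h s (x s) (y s)) 0 t)); [apply @is_derive_const|].
  apply (is_derive_RInt0 (fun s => h s (x s) (y s))); intros s; apply hh; trivial. }
exists x, y; split; [|split; [|split]].
- rewrite ex, (RInt_point (V := R_CompleteNormedModule)); apply Rplus_0_r.
- rewrite ey, (RInt_point (V := R_CompleteNormedModule)); apply Rplus_0_r.
- intros t; apply is_derive_ext with (fun t => x0 + RInt (fun s => f s (x s) (y s)) 0 t); auto.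
- intros t; apply is_derive_ext with (fun t => y0 + RInt (fun s => g s (x s) (y s)) 0 t); auto.
Qed.

End Picard.

(** * Power functions *)

Lemma Rpower_gt0 (x a : R) : 0 < Rpower x a.
Proof. apply exp_pos. Qed.

Lemma is_derive_Rpower (f : R -> R) (df a x : R) : 0 < f x -> is_derive f x df ->
  is_derive (fun t => Rpower (f t) a) x (a * Rpower (f x) (a - 1) * df).
Proof.
intros hx hf.
replace (a * Rpower (f x) (a - 1) * df) with (df * (a * Rpower (f x) (a - 1))) by ring.
apply (is_derive_comp (fun y => Rpower y a) f); trivial.
apply is_derive_Reals, derivable_pt_lim_power; trivial.
Qed.

Lemma Rpower_succ (x a : R) : 0 < x -> Rpower x (a + 1) = Rpower x a * x.
Proof. intros h; rewrite Rpower_plus, Rpower_1; trivial. Qed.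

Lemma Rpower_sq (x a : R) : 0 < x -> Rpower (x ^ 2) a = Rpower x (2 * a).
Proof.
intros h; rewrite <- Rpower_mult; f_equal.
replace 2 with (INR 2) by (simpl; ring); rewrite Rpower_pow; trivial.
Qed.

Lemma Rpower_le_1 (x a : R) : 0 < x <= 1 -> 0 <= a -> Rpower x a <= 1.
Proof.
intros [h1 h2] ha; unfold Rpower; rewrite <- exp_0; apply exp_le_mono.
assert (ln x <= 0) by (rewrite <- ln_1; apply ln_le; trivial); nra.
Qed.

Lemma Rpower_ge_1 (x a : R) : 1 <= x -> 0 <= a -> 1 <= Rpower x a.
Proof.
intros h1 ha; unfold Rpower; rewrite <- exp_0 at 1; apply exp_le_mono.
assert (0 <= ln x) by (rewrite <- ln_1; apply ln_le; lra); nra.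
Qed.

Lemma Rpower_gt_1 (x a : R) : 1 < x -> 0 < a -> 1 < Rpower x a.
Proof.
intros h1 ha; unfold Rpower; rewrite <- exp_0 at 1; apply exp_increasing.
assert (0 < ln x) by (rewrite <- ln_1; apply ln_increasing; lra); nra.
Qed.

Lemma Rpower_le_1_neg (x a : R) : 1 <= x -> a <= 0 -> Rpower x a <= 1.
Proof.
intros h1 ha; unfold Rpower; rewrite <- exp_0; apply exp_le_mono.
assert (0 <= ln x) by (rewrite <- ln_1; apply ln_le; lra); nra.
Qed.

(* |u|^(a-1) u: at u = 0 the junk value of [Rpower] is multiplied by 0. *)
Definition sp (a u : R) : R := Rpower (Rabs u) (a - 1) * u.

Lemma sp_0 (a : R) : sp a 0 = 0.
Proof. unfold sp; ring. Qed.

Lemma sp_opp (a u : R) : sp a (- u) = - sp a u.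
Proof. unfold sp; rewrite Rabs_Ropp; ring. Qed.

Lemma sp_pos (a u : R) : 0 < u -> sp a u = Rpower u a.
Proof.
intros h; unfold sp; rewrite Rabs_pos_eq by lra.
rewrite <- Rpower_succ by trivial; f_equal; ring.
Qed.

Lemma sp_abs (a u : R) : Rabs (sp a u) = sp a (Rabs u).
Proof.
unfold sp; rewrite Rabs_Rabsolu, Rabs_mult; f_equal.
apply Rabs_pos_eq; left; apply Rpower_gt0.
Qed.

Lemma sp_nonneg (a u : R) : 0 <= u -> 0 <= sp a u.
Proof. intros h; apply Rmult_le_pos; trivial; left; apply Rpower_gt0. Qed.

Lemma sp_gt0 (a u : R) : 0 < u -> 0 < sp a u.
Proof. intros h; apply Rmult_lt_0_compat; trivial; apply Rpower_gt0. Qed.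

Lemma mul_sp_nonneg (a u : R) : 0 <= u * sp a u.
Proof. unfold sp; pose proof (Rpower_gt0 (Rabs u) (a - 1)); nra. Qed.

Lemma sp_scale (a r u : R) : 0 < r -> sp a (r * u) = Rpower r a * sp a u.
Proof.
intros h; destruct (Req_dec u 0) as [->|hu].
- rewrite Rmult_0_r, sp_0; ring.
- unfold sp; rewrite Rabs_mult, (Rabs_pos_eq r) by lra.
  rewrite <- Rpower_mult_distr by (try apply Rabs_pos_lt; trivial).
  replace a with (a - 1 + 1) at 3 by ring.
  rewrite (Rpower_succ r) by trivial; ring.
Qed.

Lemma sp_le_1 (a u : R) : 0 < a -> Rabs u <= 1 -> Rabs (sp a u) <= 1.
Proof.
intros ha hu; rewrite sp_abs; destruct (Req_dec u 0) as [->|h].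
- rewrite Rabs_R0, sp_0; lra.
- assert (0 < Rabs u) by (apply Rabs_pos_lt; trivial).
  rewrite sp_pos by trivial; apply Rpower_le_1; lra.
Qed.

Lemma sp_continuous (a u : R) : 0 < a -> continuous (sp a) u.
Proof.
intros ha; destruct (Req_dec u 0) as [->|h].
- apply continuous_abs_bound; intros eps he.
  exists (Rpower eps (/ a)); split; [apply Rpower_gt0|].
  intros t ht; rewrite sp_0, Rminus_0_r in *.
  rewrite sp_abs; destruct (Req_dec t 0) as [->|h0].
  + rewrite Rabs_R0, sp_0; trivial.
  + assert (0 < Rabs t) by (apply Rabs_pos_lt; trivial).
    rewrite sp_pos by trivial.
    replace eps with (Rpower (Rpower eps (/ a)) a).
    * apply Rlt_Rpower_l; lra.
    * rewrite Rpower_mult, Rinv_l, Rpower_1; lra.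
- assert (0 < Rabs u) by (apply Rabs_pos_lt; trivial).
  apply (cont_mult (fun u => Rpower (Rabs u) (a - 1)) (fun u => u)); [|apply cont_id].
  apply (cont_comp Rabs (fun x => Rpower x (a - 1))); [apply continuous_Rabs|].
  eapply is_derive_continuous, (is_derive_Rpower (fun x => x)); trivial; apply @is_derive_id.
Qed.

Definition pw (e y : R) : R := Rpower (1 + y ^ 2) e.

Lemma one_sq_pos (y : R) : 0 < 1 + y ^ 2.
Proof. nra. Qed.

Lemma pw_pos (e y : R) : 0 < pw e y.
Proof. apply Rpower_gt0. Qed.

Lemma pw_plus (e e' y : R) : pw (e + e') y = pw e y * pw e' y.
Proof. apply Rpower_plus. Qed.

Lemma pw_succ (e y : R) : pw (e + 1) y = pw e y * (1 + y ^ 2).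
Proof. apply Rpower_succ, one_sq_pos. Qed.

Lemma pw_0 (e : R) : pw e 0 = 1.
Proof.
unfold pw; replace (1 + 0 ^ 2) with 1 by ring.
unfold Rpower; rewrite ln_1, Rmult_0_r; apply exp_0.
Qed.

Lemma pw_even (e y : R) : pw e (- y) = pw e y.
Proof. unfold pw; f_equal; ring. Qed.

Lemma is_derive_pw (e y : R) : is_derive (pw e) y (2 * e * y * pw (e - 1) y).
Proof.
replace (2 * e * y * pw (e - 1) y) with (e * Rpower (1 + y ^ 2) (e - 1) * (2 * y)) by (unfold pw; ring).
apply (is_derive_Rpower (fun y => 1 + y ^ 2)); [apply one_sq_pos|].
auto_derive; trivial; ring.
Qed.

Lemma pw_continuous (e y : R) : continuous (pw e) y.
Proof. eapply is_derive_continuous, is_derive_pw. Qed.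

(** * The coefficients of the planar system as functions of the slope *)

Section Coefficients.

Variables (p b : R).
Hypotheses (hp : 1 < p) (hb : 0 < b).

(* For f > 0 and y = f'/(b f): the flux is (b f)^(p-1) phi y. *)
Definition phi (y : R) : R := y * pw ((p - 2) / 2) y.
(** The coefficient a of the planar system. *)
Definition dphi (y : R) : R := pw ((p - 4) / 2) y * (1 + (p - 1) * y ^ 2).
(** The function B of the planar system. *)
Definition bet (y : R) : R := (p - 1) * b * pw (p / 2) y + (p - 2) * pw ((p - 2) / 2) y.
(** The derivative of [bet] divided by y. The coefficient p - 2 enters as a square, so it is
    positive for p < 2 as well, and [bet] increases with |y| for every p > 1. *)
Definition dbet (y : R) : R :=
  (p - 1) * b * p * pw ((p - 2) / 2) y + (p - 2) ^ 2 * pw ((p - 4) / 2) y.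
(* b^(1-p) c_q *)
Definition gq : R := p - 2 + (p - 1) * b.

Lemma pw_half (y : R) : pw (p / 2) y = pw ((p - 2) / 2) y * (1 + y ^ 2).
Proof. rewrite <- pw_succ; f_equal; field. Qed.

Lemma pw_half2 (y : R) : pw ((p - 2) / 2) y = pw ((p - 4) / 2) y * (1 + y ^ 2).
Proof. rewrite <- pw_succ; f_equal; field. Qed.

Lemma is_derive_phi (y : R) : is_derive phi y (dphi y).
Proof.
replace (dphi y) with (1 * pw ((p - 2) / 2) y + y * (2 * ((p - 2) / 2) * y * pw ((p - 2) / 2 - 1) y)).
- apply (is_derive_mult (fun y => y) (pw ((p - 2) / 2))); auto using Rmult_comm.
  + apply @is_derive_id.
  + apply is_derive_pw.
- unfold dphi; rewrite pw_half2; replace ((p - 2) / 2 - 1) with ((p - 4) / 2) by field; field.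
Qed.

Lemma dphi_pos (y : R) : 0 < dphi y.
Proof. apply Rmult_lt_0_compat; [apply pw_pos | nra]. Qed.

Lemma dphi_0 : dphi 0 = 1.
Proof. unfold dphi; rewrite pw_0; ring. Qed.

Lemma phi_continuous (y : R) : continuous phi y.
Proof. eapply is_derive_continuous, is_derive_phi. Qed.

Lemma dphi_continuous (y : R) : continuous dphi y.
Proof.
apply cont_mult; [apply pw_continuous|].
apply cont_plus; [apply cont_const|]; apply cont_mult; [apply cont_const|].
eapply is_derive_continuous with (d := 2 * y); auto_derive; trivial; ring.
Qed.

Lemma bet_0 : bet 0 = gq.
Proof. unfold bet, gq; rewrite !pw_0; ring. Qed.

Lemma bet_even (y : R) : bet (- y) = bet y.
Proof. unfold bet; rewrite !pw_even; trivial. Qed.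

Lemma dphi_even (y : R) : dphi (- y) = dphi y.
Proof. unfold dphi; rewrite pw_even; f_equal; ring. Qed.

Lemma is_derive_bet (y : R) : is_derive bet y (y * dbet y).
Proof.
replace (y * dbet y) with
  ((p - 1) * b * (2 * (p / 2) * y * pw (p / 2 - 1) y) +
   (p - 2) * (2 * ((p - 2) / 2) * y * pw ((p - 2) / 2 - 1) y)).
- apply (is_derive_plus (fun y => (p - 1) * b * pw (p / 2) y) (fun y => (p - 2) * pw ((p - 2) / 2) y)).
  + apply (is_derive_scal (pw (p / 2))), is_derive_pw.
  + apply (is_derive_scal (pw ((p - 2) / 2))), is_derive_pw.
- unfold dbet; replace ((p - 2) / 2 - 1) with ((p - 4) / 2) by field.
  replace (p / 2 - 1) with ((p - 2) / 2) by field; field.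
Qed.

Lemma bet_continuous (y : R) : continuous bet y.
Proof. eapply is_derive_continuous, is_derive_bet. Qed.

Lemma dbet_pos (y : R) : 0 < dbet y.
Proof.
unfold dbet; pose proof (pw_pos ((p - 2) / 2) y); pose proof (pw_pos ((p - 4) / 2) y).
assert (0 < (p - 1) * b * p) by (repeat apply Rmult_lt_0_compat; lra).
apply Rplus_lt_le_0_compat; [apply Rmult_lt_0_compat; trivial | apply Rmult_le_pos; [apply pow2_ge_0 | lra]].
Qed.

Lemma dbet_continuous (y : R) : continuous dbet y.
Proof.
apply cont_plus; apply cont_mult; try apply cont_const; apply pw_continuous.
Qed.

Lemma bet_increasing (y y' : R) : 0 <= y -> y < y' -> bet y < bet y'.
Proof.
intros h h'; apply (derive_pos_lt bet (fun y => y * dbet y)); trivial.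
- intros; apply is_derive_bet.
- intros; apply bet_continuous.
- intros x hx; pose proof (dbet_pos x); nra.
Qed.

Lemma bet_ge (y : R) : gq <= bet y.
Proof.
rewrite <- bet_0; destruct (Rtotal_order 0 y) as [h|[<-|h]]; [|lra|].
- left; apply bet_increasing; lra.
- rewrite <- (bet_even y); left; apply bet_increasing; lra.
Qed.

Lemma bet_gt (y : R) : y <> 0 -> gq < bet y.
Proof.
intros hy; rewrite <- bet_0; destruct (Rtotal_order 0 y) as [h|[h|h]]; [|lra|].
- apply bet_increasing; lra.
- rewrite <- (bet_even y); apply bet_increasing; lra.
Qed.

(** [bet] is unbounded: (1 + y^2)^(p/2) >= y for y >= 0, and the other term is at least - |p - 2|,
    because for p < 2 its power is at most 1. The root found here is the height above which y
    decreases along every orbit; it fixes the cut-off in y. *)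
Lemma bet_zero_exists (c : R) : gq <= c -> exists y, 0 <= y /\ bet y = c.
Proof.
intros hc.
assert (lb : forall y, 0 <= y -> (p - 1) * b * y - Rabs (p - 2) <= bet y).
{ intros y hy; unfold bet.
  assert (h1 : y <= pw (p / 2) y).
  { apply Rle_trans with (pw (1 / 2) y).
    (* At y = 0 the value of [Rpower (y ^ 2) (1 / 2)] is 1 and not 0; the second factor corrects
       this. *)
    - unfold pw; apply Rle_trans with (Rpower (y ^ 2) (1 / 2) * (if Req_dec_T y 0 then 0 else 1)).
      + destruct (Req_dec_T y 0); [lra|]; rewrite Rpower_sq by lra.
        replace (2 * (1 / 2)) with 1 by field; rewrite Rpower_1; lra.
      + destruct (Req_dec_T y 0).
        * rewrite Rmult_0_r; left; apply Rpower_gt0.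
        * rewrite Rmult_1_r; apply Rle_Rpower_l; [lra | nra].
    - apply Rle_Rpower; [nra | lra]. }
  assert (h2 : - Rabs (p - 2) <= (p - 2) * pw ((p - 2) / 2) y).
  { pose proof (pw_pos ((p - 2) / 2) y).
    destruct (Rle_dec 2 p).
    - pose proof (Rabs_pos (p - 2)); nra.
    - rewrite Rabs_left by lra.
      assert (pw ((p - 2) / 2) y <= 1) by (apply Rpower_le_1_neg; nra); nra. }
  assert (0 < (p - 1) * b) by nra; nra. }
assert (hk : 0 < (p - 1) * b) by nra.
pose (Y := (Rabs c + Rabs (p - 2)) / ((p - 1) * b)).
assert (hY : 0 <= Y) by (apply Rdiv_le_0_compat; trivial; pose proof (Rabs_pos c); pose proof (Rabs_pos (p - 2)); lra).
destruct (IVT_gen bet 0 Y c) as [y [hy e]].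
- intros y; apply continuity_pt_filterlim, bet_continuous.
- rewrite bet_0; rewrite Rmin_left, Rmax_right; try split; trivial.
  + specialize (lb Y hY); unfold Y in lb at 1.
    replace ((p - 1) * b * ((Rabs c + Rabs (p - 2)) / ((p - 1) * b))) with (Rabs c + Rabs (p - 2)) in lb by (field; lra).
    pose proof (Rle_abs c); lra.
  + apply bet_ge.
  + apply bet_ge.
- exists y; rewrite Rmin_left in hy by lra; split; [lra|trivial].
Qed.

End Coefficients.

(** * The planar system of a positive solution *)

Lemma is_derive_slope_lim (f : R -> R) (x d : R) :
  is_derive f x d <-> is_lim (fun h => (f (x + h) - f x) / h) 0 d.
Proof.
rewrite is_derive_Reals; split.
- intros hd; apply is_lim_spec; intros eps.
  destruct (hd eps (cond_pos eps)) as [dl hdl].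
  exists dl; intros h hh hne; apply hdl; trivial.
  revert hh; unfold ball; simpl; unfold AbsRing_ball, abs, minus, plus, opp; simpl.
  rewrite Ropp_0, Rplus_0_r; trivial.
- intros hl eps he; apply is_lim_spec in hl.
  destruct (hl (mkposreal eps he)) as [dl hdl].
  exists dl; intros h hne hh; apply hdl; trivial.
  unfold ball; simpl; unfold AbsRing_ball, abs, minus, plus, opp; simpl.
  rewrite Ropp_0, Rplus_0_r; trivial.
Qed.

(** The difference quotient of F based at [y s], extended by the value [a], is continuous; dividing
    the difference quotient of F o y by it leaves that of y. This takes the place of an inverse
    function theorem, for the slope of a solution (only phi of the slope is known to be
    differentiable) and for the inverse of the clock of an orbit. *)
Lemma is_derive_of_comp (F y : R -> R) (s a d : R) : a <> 0 ->
  continuous y s -> is_derive F (y s) a -> is_derive (fun t => F (y t)) s d ->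
  is_derive y s (d / a).
Proof.
intros ha cy dF dFy.
pose (sl := fun v => if Req_dec_T v (y s) then a else (F v - F (y s)) / (v - y s)).
assert (csl : continuous sl (y s)).
{ apply continuous_abs_bound; intros eps he.
  apply is_derive_Reals in dF; destruct (dF eps he) as [dl hdl].
  exists dl; split; [apply cond_pos|]; intros t ht; unfold sl.
  destruct (Req_dec_T (y s) (y s)) as [_|n]; [|congruence].
  destruct (Req_dec_T t (y s)) as [e|ne].
  - rewrite Rminus_diag, Rabs_R0; trivial.
  - specialize (hdl (t - y s)); replace (y s + (t - y s)) with t in hdl by ring.
    apply hdl; trivial; lra. }
assert (slE : sl (y s) = a).
{ unfold sl; destruct (Req_dec_T (y s) (y s)); congruence. }
assert (c2 : continuous (fun t => sl (y t)) s) by (apply (cont_comp y sl); trivial).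
apply is_derive_slope_lim in dFy; apply is_derive_slope_lim.
assert (l2 : is_lim (fun h => sl (y (s + h))) 0 a).
{ apply is_lim_spec; intros eps.
  destruct (continuous_eps _ s eps c2 (cond_pos eps)) as [dl [hdl h]].
  exists (mkposreal dl hdl); intros t ht _; rewrite <- slE; apply h.
  revert ht; unfold ball; simpl; unfold AbsRing_ball, abs, minus, plus, opp; simpl.
  rewrite Ropp_0, Rplus_0_r; rewrite Rplus_minus_l; trivial. }
apply is_lim_ext_loc with (fun h => ((F (y (s + h)) - F (y s)) / h) / sl (y (s + h))).
- apply is_lim_spec in l2.
  destruct (l2 (mkposreal (Rabs a) (Rabs_pos_lt _ ha))) as [dl hdl].
  exists dl; intros h hh hne; specialize (hdl h hh hne); simpl in hdl.
  assert (nz : sl (y (s + h)) <> 0).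
  { intros e; rewrite e in hdl; rewrite Rminus_0_l, Rabs_Ropp in hdl; lra. }
  unfold sl in *; destruct (Req_dec_T (y (s + h)) (y s)) as [e|ne].
  + rewrite e; field; split; trivial.
  + assert (F (y (s + h)) - F (y s) <> 0).
    { intros e; rewrite e in nz; apply nz; unfold Rdiv; ring. }
    field; repeat split; trivial; lra.
- apply (is_lim_div (fun h => (F (y (s + h)) - F (y s)) / h) (fun h => sl (y (s + h))) 0 d a); trivial.
  + intros e; apply ha; injection e; trivial.
  + exact I.
Qed.

Section Correspondence.

Variables (p q c : R).
Hypotheses (hp : 1 < p) (hq : p - 1 < q).

Let b := beta_q p q.
(* b^(1-p) c and b^(1-p), with b = beta_q *)
Definition Cn : R := Rpower (beta_q p q) (1 - p) * c.
Definition kn : R := Rpower (beta_q p q) (1 - p).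

Lemma b_pos : 0 < b.
Proof. apply beta_q_gt0; trivial. Qed.

Lemma kn_pos : 0 < kn.
Proof. apply Rpower_gt0. Qed.

Lemma p_div_b : p / b = q + 1 - p.
Proof. unfold b, beta_q; field; lra. Qed.

Lemma kn_cq : kn * c_q p q = gq p b.
Proof.
pose proof b_pos.
unfold kn, c_q, gq; rewrite lambda_qE by trivial; fold b.
replace (Rpower b (1 - p) * (Rpower b (p - 2) * (b * (p - 2 + (p - 1) * b)))) with
  (Rpower b (1 - p) * Rpower b (p - 2) * b * (p - 2 + (p - 1) * b)) by ring.
rewrite <- Rpower_plus, <- Rpower_succ by trivial.
replace (1 - p + (p - 2) + 1) with 0 by ring; rewrite Rpower_O by trivial; ring.
Qed.

Lemma energy_polar (f y : R) : 0 < f ->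
  Rpower (b ^ 2 * f ^ 2 + (b * f * y) ^ 2) ((p - 2) / 2) =
  Rpower (b * f) (p - 2) * pw ((p - 2) / 2) y.
Proof.
intros hf; pose proof b_pos.
assert (0 < b * f) by (apply Rmult_lt_0_compat; trivial).
replace (b ^ 2 * f ^ 2 + (b * f * y) ^ 2) with ((b * f) ^ 2 * (1 + y ^ 2)) by ring.
rewrite <- Rpower_mult_distr; [|apply pow_lt; trivial|apply one_sq_pos].
rewrite Rpower_sq by trivial; unfold pw; do 2 f_equal; field.
Qed.

(** Homogeneity: since kn b^(p-1) = 1, extracting (b f)^(p-1) leaves a function of the slope and of
    z = kn f^(q+1-p) only. The flux carries the same factor, so the system in (x, y) is closed. *)
Lemma reaction_polar (f y : R) : 0 < f ->
  lambda_q p q * (Rpower (b * f) (p - 2) * pw ((p - 2) / 2) y * f)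
  + Rpower (Rabs f) (q - 1) * f - c * (Rpower (Rabs f) (p - 2) * f) =
  Rpower (b * f) (p - 1) *
    (gq p b * pw ((p - 2) / 2) y + kn * Rpower f (q + 1 - p) - Cn).
Proof.
intros hf; pose proof b_pos.
assert (0 < b * f) by (apply Rmult_lt_0_compat; trivial).
rewrite Rabs_pos_eq by lra.
rewrite lambda_qE by trivial; fold b; fold (gq p b).
replace (Rpower (b * f) (p - 1)) with (Rpower (b * f) (p - 2) * (b * f)) by
  (rewrite <- Rpower_succ by trivial; f_equal; ring).
rewrite <- !Rpower_mult_distr by trivial.
rewrite <- (Rpower_succ f (q - 1)) by trivial.
replace (q - 1 + 1) with (p - 2 + 1 + (q + 1 - p)) by ring.
rewrite (Rpower_plus (p - 2 + 1)), (Rpower_succ f) by trivial.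
unfold Cn, kn; fold b.
assert (e : Rpower b (1 - p) * (Rpower b (p - 2) * b) = 1).
{ rewrite <- (Rpower_succ b) by trivial; rewrite <- Rpower_plus.
  replace (1 - p + (p - 2 + 1)) with 0 by ring; apply Rpower_O; trivial. }
set (B1 := Rpower b (1 - p)) in *; set (B2 := Rpower b (p - 2)) in *.
set (F := Rpower f (p - 2)); set (G := Rpower f (q + 1 - p)); set (S := pw ((p - 2) / 2) y).
unfold gq.
transitivity (B2 * b * F * f * (p - 2 + (p - 1) * b) * S + (B1 * (B2 * b)) * (F * f * G) - (B1 * (B2 * b)) * (c * (F * f))).
- rewrite e; ring.
- ring.
Qed.

Section FromSolution.

Variable (f : R -> R).
Hypothesis hf : is_solution p q c f.

Lemma sol_is_derive (s : R) : is_derive f s (Derive f s).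
Proof. destruct hf as [_ [h _]]; apply Derive_correct, h. Qed.

Lemma sol_continuous (s : R) : continuous f s.
Proof. eapply is_derive_continuous, sol_is_derive. Qed.

Lemma sol_derive_continuous (s : R) : continuous (Derive f) s.
Proof. destruct hf as [_ [h _]]; apply h. Qed.

Definition slope (s : R) : R := Derive f s / (b * f s).

Lemma slope_continuous (s : R) : f s <> 0 -> continuous slope s.
Proof.
intros h; pose proof b_pos; apply cont_div.
- apply sol_derive_continuous.
- apply cont_mult; [apply cont_const | apply sol_continuous].
- apply Rmult_integral_contrapositive; split; lra.
Qed.

Lemma continuous_pos_near (g : R -> R) (s : R) : continuous g s -> 0 < g s -> locally s (fun t => 0 < g t).
Proof.
intros hc hs; destruct (continuous_eps g s (g s) hc hs) as [d [hd h]].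
exists (mkposreal d hd); intros t ht; specialize (h t ht).
apply Rabs_lt_between in h; lra.
Qed.

Lemma flux_slope (s : R) : 0 < f s -> flux p q f s = Rpower (b * f s) (p - 1) * phi p (slope s).
Proof.
intros hs; pose proof b_pos.
assert (0 < b * f s) by (apply Rmult_lt_0_compat; trivial).
assert (e : Derive f s = b * f s * slope s) by (unfold slope; field; lra).
unfold flux, energy_pow; fold b; rewrite e, energy_polar by trivial.
replace (p - 1) with (p - 2 + 1) by ring; rewrite Rpower_succ by trivial.
unfold phi; ring.
Qed.

Lemma flux_derive (s : R) : 0 < f s ->
  is_derive (flux p q f) s
    (- (Rpower (b * f s) (p - 1) * (gq p b * pw ((p - 2) / 2) (slope s) + kn * Rpower (f s) (q + 1 - p) - Cn))).
Proof.
intros hs; pose proof b_pos.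
assert (0 < b * f s) by (apply Rmult_lt_0_compat; trivial).
assert (e : Derive f s = b * f s * slope s) by (unfold slope; field; lra).
destruct hf as [_ [_ [h1 h2]]]; specialize (h2 s).
unfold energy_pow in h2; fold b in h2; rewrite e, energy_polar in h2 by trivial.
pose proof (reaction_polar (f s) (slope s) hs) as r.
replace (- _) with (Derive (flux p q f) s) by lra.
apply Derive_correct, h1.
Qed.

(** A second derivative of f is not given, but the flux divided by (b f)^(p-1) is phi of the slope,
    and phi' > 0. Differentiating (b f)^(1-p) contributes (p-1) b y phi y, which completes gq (1 +
    y^2)^((p-2)/2) to [bet]. *)
Lemma slope_derive (s : R) : 0 < f s ->
  is_derive slope s (- (bet p b (slope s) - Cn + kn * Rpower (f s) (q + 1 - p)) / dphi p (slope s)).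
Proof.
intros hs; pose proof b_pos.
assert (hbf : 0 < b * f s) by (apply Rmult_lt_0_compat; trivial).
assert (e : Derive f s = b * f s * slope s) by (unfold slope; field; lra).
apply (is_derive_of_comp (phi p)).
- pose proof (dphi_pos p hp (slope s)); lra.
- apply slope_continuous; lra.
- apply is_derive_phi; trivial.
- apply is_derive_ext_loc with (fun t => flux p q f t * Rpower (b * f t) (1 - p)).
  + destruct (continuous_pos_near f s (sol_continuous s) hs) as [d hd].
    exists d; intros t ht; specialize (hd t ht).
    assert (0 < b * f t) by (apply Rmult_lt_0_compat; trivial).
    rewrite flux_slope by trivial.
    replace (Rpower (b * f t) (p - 1) * phi p (slope t) * Rpower (b * f t) (1 - p)) with
      (Rpower (b * f t) (p - 1) * Rpower (b * f t) (1 - p) * phi p (slope t)) by ring.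
    rewrite <- Rpower_plus; replace (p - 1 + (1 - p)) with 0 by ring.
    rewrite Rpower_O by trivial; apply Rmult_1_l.
  + assert (dP : is_derive (fun t => Rpower (b * f t) (1 - p)) s
       ((1 - p) * Rpower (b * f s) (1 - p - 1) * (b * Derive f s))).
    { apply (is_derive_Rpower (fun t => b * f t)); trivial.
      apply (is_derive_scal f), sol_is_derive. }
    pose proof (is_derive_mult (flux p q f) (fun t => Rpower (b * f t) (1 - p)) s _ _ (flux_derive s hs) dP Rmult_comm) as d.
    match type of d with is_derive _ _ ?v => replace (- _) with v end; [exact d|].
    unfold plus, mult; simpl; rewrite flux_slope, e by trivial.
    assert (e1 : Rpower (b * f s) (p - 1) * Rpower (b * f s) (1 - p) = 1).
    { rewrite <- Rpower_plus; replace (p - 1 + (1 - p)) with 0 by ring; apply Rpower_O; trivial. }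
    assert (e2 : Rpower (b * f s) (1 - p) = Rpower (b * f s) (1 - p - 1) * (b * f s)).
    { rewrite <- Rpower_succ by trivial; f_equal; ring. }
    unfold bet; rewrite (pw_half p); unfold gq, phi.
    set (P1 := Rpower (b * f s) (p - 1)) in *; set (P2 := Rpower (b * f s) (1 - p)) in *.
    set (P3 := Rpower (b * f s) (1 - p - 1)) in *; set (y := slope s) in *.
    set (S := pw ((p - 2) / 2) y); set (z := kn * Rpower (f s) (q + 1 - p)).
    transitivity ((P1 * P2) * (- ((p - 2 + (p - 1) * b) * S + z - Cn)) + P1 * (P3 * (b * f s)) * ((1 - p) * b * y * (y * S))).
    * ring.
    * rewrite <- e2, e1; ring.
Qed.

End FromSolution.

(** The converse passage: f is recovered from kn f^(q+1-p) = exp x, and x' = p y says exactly that y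
    is its slope, because b (q + 1 - p) = p. *)
Lemma positive_solution_of_system (y x : R -> R) :
  (forall t, is_derive x t (p * y t)) ->
  (forall t, is_derive y t (- (bet p b (y t) - Cn + exp (x t)) / dphi p (y t))) ->
  (forall t, x (t + 2 * PI) = x t) ->
  positive_solution p q c (fun t => exp ((x t - ln kn) / (q + 1 - p))).
Proof.
intros dx dy per; pose proof b_pos; pose proof kn_pos.
set (f := fun t => exp ((x t - ln kn) / (q + 1 - p))).
assert (fpos : forall t, 0 < f t) by (intros; apply exp_pos).
assert (hbf : forall t, 0 < b * f t) by (intros; apply Rmult_lt_0_compat; trivial).
assert (df : forall t, is_derive f t (b * f t * y t)).
{ intros t.
  assert (d1 : is_derive (fun t => (x t - ln kn) / (q + 1 - p)) t (b * y t)).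
  { apply is_derive_ext with (fun t => / (q + 1 - p) * (x t - ln kn)); [intros u; unfold Rdiv; apply Rmult_comm|].
    replace (b * y t) with (/ (q + 1 - p) * (p * y t - 0)) by (unfold b, beta_q; field; lra).
    apply (is_derive_scal (fun t => x t - ln kn)).
    apply (is_derive_minus x (fun _ => ln kn)); [apply dx | apply @is_derive_const]. }
  replace (b * f t * y t) with (b * y t * f t) by ring.
  apply (is_derive_comp exp (fun t => (x t - ln kn) / (q + 1 - p))); trivial.
  apply is_derive_exp. }
assert (Df : forall t, Derive f t = b * f t * y t) by (intros t; apply is_derive_unique, df).
assert (cf : forall t, continuous f t) by (intros t; eapply is_derive_continuous, df).
assert (cy : forall t, continuous y t) by (intros t; eapply is_derive_continuous, dy).
assert (cx : forall t, continuous x t) by (intros t; eapply is_derive_continuous, dx).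
assert (z : forall t, kn * Rpower (f t) (q + 1 - p) = exp (x t)).
{ intros t; unfold f, Rpower; rewrite ln_exp.
  replace ((q + 1 - p) * ((x t - ln kn) / (q + 1 - p))) with (x t - ln kn) by (field; lra).
  unfold Rminus; rewrite exp_plus, exp_Ropp, exp_ln by trivial; field; lra. }
assert (fl : forall t, Rpower (b * f t) (p - 1) * phi p (y t) = flux p q f t).
{ intros t; unfold flux, energy_pow; fold b; rewrite Df, energy_polar by trivial.
  replace (p - 1) with (p - 2 + 1) by ring; rewrite Rpower_succ by trivial.
  unfold phi; ring. }
pose (dfl := fun t => - (Rpower (b * f t) (p - 1) * (gq p b * pw ((p - 2) / 2) (y t) + exp (x t) - Cn))).
assert (dflux : forall t, is_derive (flux p q f) t (dfl t)).
{ intros t; apply is_derive_ext with (fun t => Rpower (b * f t) (p - 1) * phi p (y t)); trivial.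
  assert (dP : is_derive (fun t => Rpower (b * f t) (p - 1)) t
       ((p - 1) * Rpower (b * f t) (p - 1 - 1) * (b * (b * f t * y t)))).
  { apply (is_derive_Rpower (fun t => b * f t)); trivial.
    apply (is_derive_scal f), df. }
  assert (dF : is_derive (fun t => phi p (y t)) t ((- (bet p b (y t) - Cn + exp (x t)) / dphi p (y t)) * dphi p (y t))).
  { apply (is_derive_comp (phi p) y); [apply is_derive_phi; trivial | apply dy]. }
  pose proof (is_derive_mult _ _ t _ _ dP dF Rmult_comm) as d.
  match type of d with is_derive _ _ ?v => replace (dfl t) with v end; [exact d|].
  unfold plus, mult, dfl; simpl.
  assert (e2 : Rpower (b * f t) (p - 1) = Rpower (b * f t) (p - 1 - 1) * (b * f t)).
  { rewrite <- Rpower_succ by trivial; f_equal; ring. }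
  rewrite e2; unfold bet; rewrite (pw_half p); unfold gq, phi.
  pose proof (dphi_pos p hp (y t)); field; lra. }
split; [|exact fpos].
split; [|split; [|split]].
- intros t; unfold f; rewrite per; trivial.
- intros t; split; [exists (b * f t * y t); apply df|].
  apply continuous_ext with (fun t => b * f t * y t); [intros u; symmetry; apply Df|].
  apply cont_mult; trivial; apply cont_mult; trivial; apply cont_const.
- intros t; split; [exists (dfl t); apply dflux|].
  apply continuous_ext with dfl; [intros u; symmetry; apply is_derive_unique, dflux|].
  apply cont_opp, cont_mult.
  + eapply is_derive_continuous, (is_derive_Rpower (fun t => b * f t)); trivial.
    apply (is_derive_scal f), df.
  + apply cont_minus; [|apply cont_const]; apply cont_plus.
    * apply cont_mult; [apply cont_const|]; apply (cont_comp y (pw ((p - 2) / 2))); trivial; apply pw_continuous.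
    * apply (cont_comp x exp); trivial; eapply is_derive_continuous, is_derive_exp.
- intros t.
  rewrite (is_derive_unique _ _ _ (dflux t)).
  unfold energy_pow; fold b; rewrite Df, energy_polar by trivial.
  pose proof (reaction_polar (f t) (y t) (fpos t)) as r; rewrite z in r.
  unfold dfl; lra.
Qed.

End Correspondence.

(** * Rigidity of positive solutions *)

Lemma continuous_bounded (g : R -> R) (a b : R) : a <= b ->
  (forall x, a <= x <= b -> continuous g x) ->
  exists B, 0 < B /\ forall x, a <= x <= b -> Rabs (g x) <= B.
Proof.
intros hab hc.
destruct (continuity_ab_maj (fun x => Rabs (g x)) a b hab) as [M [hM _]].
- intros x hx; apply continuity_pt_filterlim, (cont_abs g); auto.
- exists (Rabs (g M) + 1); split; [pose proof (Rabs_pos (g M)); lra|].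
  intros x hx; specialize (hM x hx); lra.
Qed.

Lemma C1_lipschitz (g dg : R -> R) (a b : R) : a <= b ->
  (forall x, a <= x <= b -> is_derive g x (dg x)) ->
  (forall x, a <= x <= b -> continuous dg x) ->
  exists L, 0 < L /\ forall x y, a <= x <= b -> a <= y <= b -> Rabs (g x - g y) <= L * Rabs (x - y).
Proof.
intros hab hd hc.
destruct (continuous_bounded dg a b hab hc) as [L [hL hL2]].
exists L; split; trivial.
assert (lt : forall x y, a <= x <= b -> a <= y <= b -> x < y -> Rabs (g x - g y) <= L * Rabs (x - y)).
{ intros x y hx hy hxy.
  destruct (derive_mvt g dg x y hxy) as [u [hu e]].
  - intros u hu; apply hd; lra.
  - intros u hu; eapply is_derive_continuous, hd; lra.
  - rewrite (Rabs_minus_sym (g x)), (Rabs_minus_sym x), e, Rabs_mult.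
    apply Rmult_le_compat_r; [apply Rabs_pos|]; apply hL2; lra. }
intros x y hx hy; destruct (Rtotal_order x y) as [h|[->|h]].
- apply lt; trivial.
- rewrite !Rminus_diag, Rabs_R0; lra.
- rewrite (Rabs_minus_sym (g x)), (Rabs_minus_sym x); apply lt; trivial.
Qed.

Lemma periodic_IZR (f : R -> R) (T : R) (k : Z) (s : R) :
  (forall s, f (s + T) = f s) -> f (s + IZR k * T) = f s.
Proof.
intros h; revert s; induction k using Z.peano_ind; intros s.
- f_equal; ring.
- rewrite succ_IZR; replace (s + (IZR k + 1) * T) with (s + IZR k * T + T) by ring.
  rewrite h; apply IHk.
- replace (IZR (Z.pred k)) with (IZR k - 1) by (unfold Z.pred; rewrite plus_IZR; ring).
  rewrite <- (h (s + (IZR k - 1) * T)).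
  replace (s + (IZR k - 1) * T + T) with (s + IZR k * T) by ring; apply IHk.
Qed.

Lemma shift_into (T t a : R) : 0 < T -> exists k : Z, a <= t + IZR k * T < a + T.
Proof.
intros hT; pose (k := up ((a - t) / T)).
destruct (archimed ((a - t) / T)) as [h1 h2]; fold k in h1, h2.
assert (e : a - t = (a - t) / T * T) by (field; lra).
(* [up] overshoots by one when the quotient is an integer. *)
destruct (Rle_dec ((a - t) / T) (IZR k - 1)) as [h|h].
- exists (k - 1)%Z; rewrite minus_IZR; nra.
- exists k; nra.
Qed.

Lemma sin_ge_half (x : R) : 0 <= x <= 1 -> x / 2 <= sin x.
Proof.
intros hx.
assert (h : 1 <= PI / 3) by (pose proof PI2_3_2; lra).
assert (sin 0 - 0 / 2 <= sin x - x / 2).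
{ apply (derive_nonneg_le (fun x => sin x - x / 2) (fun x => cos x - / 2)); [lra| | |].
  - intros u _; auto_derive; trivial; field.
  - intros u _; eapply is_derive_continuous with (d := cos u - / 2); auto_derive; trivial; field.
  - intros u hu; assert (cos (PI / 3) <= cos u) by (apply cos_decr_1; pose proof PI_RGT_0; lra).
    rewrite cos_PI3 in H; lra. }
rewrite sin_0 in H; lra.
Qed.

Lemma sin_ge_sin (d x : R) : 0 <= d -> d <= x <= PI - d -> sin d <= sin x.
Proof.
intros hd hx; pose proof PI_RGT_0.
destruct (Rle_dec x (PI / 2)).
- apply sin_incr_1; lra.
- rewrite <- (sin_PI_x x); apply sin_incr_1; lra.
Qed.

(* With c = cot (t - s0) one has c' = - 1 - c^2, so
   (U^2 c)' = U'^2 - U^2 - (U' - c U)^2.  The function U^2 c + K is therefore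
   nonincreasing; since it vanishes at both ends it is zero. *)
Lemma wirtinger_rigidity (U dU K dK : R -> R) (s0 s1 L : R) :
  s0 < s1 <= s0 + PI -> 0 < L ->
  (forall t, s0 <= t <= s1 -> is_derive U t (dU t)) ->
  (forall t, s0 <= t <= s1 -> is_derive K t (dK t)) ->
  (forall t, s0 <= t <= s1 -> Rabs (U t) <= L * (t - s0) /\ Rabs (U t) <= L * (s1 - t)) ->
  (forall t, s0 <= t <= s1 -> Rabs (K t) <= L * (t - s0) /\ Rabs (K t) <= L * (s1 - t)) ->
  (forall t, s0 < t < s1 -> dU t ^ 2 - U t ^ 2 + dK t <= 0) ->
  forall t, s0 < t < s1 -> dU t ^ 2 - U t ^ 2 + dK t = 0.
Proof.
intros [h01 h1p] hL dU' dK' bU bK neg.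
pose (co := fun t => cos (t - s0) / sin (t - s0)).
pose (M := fun t => U t ^ 2 * co t + K t).
assert (sp : forall t, s0 < t < s1 -> 0 < sin (t - s0)) by (intros t ht; apply sin_gt_0; lra).
assert (dM : forall t, s0 < t < s1 -> is_derive M t (dU t ^ 2 - U t ^ 2 + dK t - (dU t - co t * U t) ^ 2)).
{ intros t ht; specialize (sp t ht).
  assert (dco : is_derive co t (- 1 - co t ^ 2)).
  { unfold co; auto_derive; [unfold Rminus in sp; lra|].
    pose proof (sin2_cos2 (t - s0)) as e; unfold Rsqr in e.
    replace (t + - s0) with (t - s0) by ring.
    set (sn := sin (t - s0)) in *; set (cs := cos (t - s0)) in *.
    apply (Rmult_eq_reg_r (sn ^ 2)); [|apply pow_nonzero; lra].
    field_simplify; [nra|lra|lra]. }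
  assert (dU2 : is_derive (fun t => U t ^ 2) t (2 * U t * dU t)).
  { replace (2 * U t * dU t) with (INR 2 * dU t * U t ^ pred 2) by (simpl; ring).
    apply is_derive_pow, dU'; lra. }
  pose proof (is_derive_plus _ _ t _ _ (is_derive_mult _ _ t _ _ dU2 dco Rmult_comm) (dK' t (conj (Rlt_le _ _ (proj1 ht)) (Rlt_le _ _ (proj2 ht))))) as d.
  match type of d with is_derive _ _ ?v => replace (_ - _) with v end; [exact d|].
  unfold plus, mult; simpl; ring. }
assert (mono : forall t t', s0 < t -> t <= t' -> t' < s1 -> M t' <= M t).
{ intros t t' h h' h''.
  apply Ropp_le_cancel.
  apply (derive_nonneg_le (fun t => - M t) (fun t => - (dU t ^ 2 - U t ^ 2 + dK t - (dU t - co t * U t) ^ 2))); trivial.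
  - intros x hx; apply (is_derive_opp M), dM; lra.
  - intros x hx; apply (cont_opp M); eapply is_derive_continuous, dM; lra.
  - intros x hx; specialize (neg x); pose proof (pow2_ge_0 (dU x - co x * U x)); lra. }
(* At distance d from an endpoint U is O(d) and the cotangent is O(1/d), so M is O(d). The bound s1
   <= s0 + PI gives sin (t - s0) >= sin d at the right end too. *)
assert (bM : forall t d, s0 < t < s1 -> 0 < d <= 1 -> d <= t - s0 -> d <= s1 - t ->
   (t - s0 = d \/ s1 - t = d) -> Rabs (M t) <= (2 * L ^ 2 + L) * d).
{ intros t d ht hd d1 d2 hor.
  assert (hU : Rabs (U t) <= L * d).
  { destruct (bU t) as [u1 u2]; [lra|]; destruct hor as [e|e]; rewrite <- e; trivial. }
  assert (hK : Rabs (K t) <= L * d).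
  { destruct (bK t) as [u1 u2]; [lra|]; destruct hor as [e|e]; rewrite <- e; trivial. }
  assert (hs : d / 2 <= sin (t - s0)).
  { apply Rle_trans with (sin d); [apply sin_ge_half; lra|apply sin_ge_sin; lra]. }
  assert (hco : Rabs (co t) <= 2 / d).
  { unfold co, Rdiv at 1; rewrite Rabs_mult, Rabs_inv, (Rabs_pos_eq (sin _)) by lra.
    assert (Rabs (cos (t - s0)) <= 1) by (apply Rabs_le; apply COS_bound).
    assert (/ sin (t - s0) <= 2 / d).
    { replace (2 / d) with (/ (d / 2)) by (field; lra); apply Rinv_le_contravar; lra. }
    assert (0 < / sin (t - s0)) by (apply Rinv_0_lt_compat; lra).
    pose proof (Rabs_pos (cos (t - s0))); nra. }
  unfold M; eapply Rle_trans; [apply Rabs_triang|].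
  rewrite Rabs_mult, <- RPow_abs.
  assert (Rabs (U t) ^ 2 <= (L * d) ^ 2) by (apply pow_incr; split; [apply Rabs_pos|trivial]).
  assert (Rabs (U t) ^ 2 * Rabs (co t) <= (L * d) ^ 2 * (2 / d)).
  { apply Rmult_le_compat; trivial; [apply pow2_ge_0 | apply Rabs_pos]. }
  replace ((L * d) ^ 2 * (2 / d)) with (2 * L ^ 2 * d) in H0 by (field; lra); lra. }
assert (M0 : forall t, s0 < t < s1 -> M t = 0).
{ intros t ht.
  assert (pt : 0 < 2 * L ^ 2 + L) by (pose proof (pow2_ge_0 L); lra).
  assert (choose : forall eps, 0 < eps -> exists d, 0 < d <= 1 /\ d <= (t - s0) / 2 /\ d <= (s1 - t) / 2 /\ (2 * L ^ 2 + L) * d <= eps).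
  { intros eps he.
    pose (d := Rmin (Rmin 1 (eps / (2 * L ^ 2 + L))) (Rmin ((t - s0) / 2) ((s1 - t) / 2))).
    assert (0 < eps / (2 * L ^ 2 + L)) by (apply Rdiv_lt_0_compat; trivial).
    assert (d <= 1 /\ d <= eps / (2 * L ^ 2 + L) /\ d <= (t - s0) / 2 /\ d <= (s1 - t) / 2 /\ 0 < d).
    { unfold d, Rmin; repeat destruct Rle_dec; lra. }
    exists d; repeat split; try lra.
    apply Rle_trans with ((2 * L ^ 2 + L) * (eps / (2 * L ^ 2 + L))); [apply Rmult_le_compat_l; lra|].
    right; field; lra. }
  destruct (Rtotal_order (M t) 0) as [h|[h|h]]; trivial; exfalso.
  - destruct (choose (- M t / 2)) as [d [h1 [h2 [h3 h4]]]]; [lra|].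
    pose proof (mono t (s1 - d)) as m.
    pose proof (bM (s1 - d) d) as bb; destruct (Rabs_le_between (M (s1 - d)) ((2 * L ^ 2 + L) * d)) as [r _].
    assert (r2 := r (bb ltac:(lra) h1 ltac:(lra) ltac:(lra) ltac:(right; lra))).
    assert (M (s1 - d) <= M t) by (apply m; lra); lra.
  - destruct (choose (M t / 2)) as [d [h1 [h2 [h3 h4]]]]; [lra|].
    pose proof (mono (s0 + d) t) as m.
    pose proof (bM (s0 + d) d) as bb; destruct (Rabs_le_between (M (s0 + d)) ((2 * L ^ 2 + L) * d)) as [r _].
    assert (r2 := r (bb ltac:(lra) h1 ltac:(lra) ltac:(lra) ltac:(left; lra))).
    assert (M t <= M (s0 + d)) by (apply m; lra); lra. }
intros t ht.
assert (z : is_derive M t 0).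
{ apply is_derive_ext_loc with (fun _ : R => 0); [|apply @is_derive_const].
  assert (hd : 0 < Rmin (t - s0) (s1 - t)) by (apply Rmin_pos; lra).
  exists (mkposreal _ hd); intros u hu; symmetry; apply M0.
  change (Rabs (u - t) < Rmin (t - s0) (s1 - t)) in hu.
  pose proof (Rmin_l (t - s0) (s1 - t)); pose proof (Rmin_r (t - s0) (s1 - t)).
  apply Rabs_lt_between in hu; lra. }
pose proof (is_derive_unique _ _ _ z) as e; rewrite (is_derive_unique _ _ _ (dM t ht)) in e.
specialize (neg t ht); pose proof (pow2_ge_0 (dU t - co t * U t)); lra.
Qed.

(** * The test functions of the rigidity argument *)

Section Lyapunov.

Variables (p b C : R).
Hypotheses (hp : 1 < p) (hb : 0 < b).

Definition nfun (y : R) : R := bet p b y - C.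
Definition phi2_int (y : R) : R := RInt (fun t => phi p t ^ 2) 0 y.
(** The primitive of phi' (n + p y phi) vanishing at 0, with n = [nfun]. Along an orbit, k0 + z phi
    then has derivative - (n + z)^2 - p n y phi: the square cancels the square of (phi y)', and
    after weighting by z^(2k/p) every remaining term in z cancels as well. *)
Definition k0fun (y : R) : R :=
  nfun y * phi p y + (p - 1) * y * phi p y ^ 2 - (p - 1) * (p - 1 + p * b) * phi2_int y.
Definition Rfun (k y : R) : R :=
  k ^ 2 * y ^ 2 * phi p y ^ 2 - 2 * k * y * phi p y * nfun y - phi p y ^ 2
  + 2 * k * y * k0fun y - p * nfun y * y * phi p y.

Lemma phi2_continuous (y : R) : continuous (fun t => phi p t ^ 2) y.
Proof.
apply continuous_ext with (fun t => phi p t * phi p t); [intros; simpl; ring|].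
apply cont_mult; apply phi_continuous; trivial.
Qed.

Lemma is_derive_phi2_int (y : R) : is_derive phi2_int y (phi p y ^ 2).
Proof. apply (is_derive_RInt0 (fun t => phi p t ^ 2)), phi2_continuous. Qed.

Lemma is_derive_nfun (y : R) : is_derive nfun y (y * dbet p b y).
Proof.
replace (y * dbet p b y) with (y * dbet p b y - 0) by ring.
apply (is_derive_minus (bet p b) (fun _ => C)); [apply is_derive_bet; trivial | apply @is_derive_const].
Qed.

Lemma is_derive_k0fun (y : R) : is_derive k0fun y (dphi p y * (nfun y + p * y * phi p y)).
Proof.
assert (d1 := is_derive_mult nfun (phi p) y _ _ (is_derive_nfun y) (is_derive_phi p y) Rmult_comm).
assert (d2 : is_derive (fun y => (p - 1) * y * phi p y ^ 2) y
   ((p - 1) * phi p y ^ 2 + (p - 1) * y * (2 * phi p y * dphi p y))).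
{ apply (is_derive_mult (fun y => (p - 1) * y) (fun y => phi p y ^ 2)); auto using Rmult_comm.
  - auto_derive; trivial; ring.
  - replace (2 * phi p y * dphi p y) with (INR 2 * dphi p y * phi p y ^ pred 2) by (simpl; ring).
    apply is_derive_pow, is_derive_phi. }
assert (d3 : is_derive (fun y => (p - 1) * (p - 1 + p * b) * phi2_int y) y ((p - 1) * (p - 1 + p * b) * phi p y ^ 2)).
{ apply (is_derive_scal phi2_int), is_derive_phi2_int. }
pose proof (is_derive_minus _ _ y _ _ (is_derive_plus _ _ y _ _ d1 d2) d3) as d.
match type of d with is_derive _ _ ?v => replace (dphi p y * (nfun y + p * y * phi p y)) with v end; [exact d|].
unfold minus, plus, opp, mult; simpl.
unfold nfun, dbet, dphi, phi; rewrite (pw_half2 p); ring.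
Qed.

Lemma phi2_int_0 : phi2_int 0 = 0.
Proof. apply (RInt_point (V := R_CompleteNormedModule)). Qed.

Lemma phi_0 : phi p 0 = 0.
Proof. unfold phi; ring. Qed.

Lemma k0fun_0 : k0fun 0 = 0.
Proof. unfold k0fun; rewrite phi2_int_0, phi_0; ring. Qed.

Lemma pw_gt_1 (e y : R) : 0 < e -> y <> 0 -> 1 < pw e y.
Proof. intros he hy; apply Rpower_gt_1; trivial; nra. Qed.

(** The difference [G] vanishes at 0 and its derivative is phi' ((1 + y^2)^(p/2) - 1) + (2 - p)
    phi^2, positive for y <> 0 because p <= 2; hence G has the sign of y. *)
Lemma phi2_int_bound (y : R) : p <= 2 -> y <> 0 ->
  y * (2 * (p - 1) * phi2_int y - phi p y * (pw (p / 2) y - 1)) < 0.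
Proof.
intros hp2 hy.
pose (G := fun y => phi p y * (pw (p / 2) y - 1) - 2 * (p - 1) * phi2_int y).
pose (dG := fun y => dphi p y * (pw (p / 2) y - 1) + (2 - p) * phi p y ^ 2).
assert (hG : forall y, is_derive G y (dG y)).
{ clear y hy; intros y.
  assert (d1 : is_derive (fun y => pw (p / 2) y - 1) y (2 * (p / 2) * y * pw (p / 2 - 1) y)).
  { replace (2 * (p / 2) * y * pw (p / 2 - 1) y) with (2 * (p / 2) * y * pw (p / 2 - 1) y - 0) by ring.
    apply (is_derive_minus (pw (p / 2)) (fun _ => 1)); [apply is_derive_pw | apply @is_derive_const]. }
  pose proof (is_derive_minus _ _ y _ _ (is_derive_mult (phi p) _ y _ _ (is_derive_phi p y) d1 Rmult_comm)
     (is_derive_scal phi2_int y (2 * (p - 1)) _ (is_derive_phi2_int y))) as d.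
  match type of d with is_derive _ _ ?v => replace (dG y) with v end; [exact d|].
  unfold minus, plus, opp, mult, scal, dG; simpl; unfold mult; simpl.
  replace (p / 2 - 1) with ((p - 2) / 2) by field.
  unfold phi; field. }
assert (pos : forall y, y <> 0 -> 0 < dG y).
{ clear y hy; intros y hy; unfold dG.
  pose proof (dphi_pos p hp y); pose proof (pw_gt_1 (p / 2) y ltac:(lra) hy).
  assert (0 < dphi p y * (pw (p / 2) y - 1)) by (apply Rmult_lt_0_compat; lra).
  assert (0 <= (2 - p) * phi p y ^ 2) by (apply Rmult_le_pos; [lra | apply pow2_ge_0]); lra. }
assert (G0 : G 0 = 0) by (unfold G; rewrite phi_0, phi2_int_0; ring).
assert (cG : forall y, continuous G y) by (intros u; eapply is_derive_continuous, hG).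
replace (2 * (p - 1) * phi2_int y - phi p y * (pw (p / 2) y - 1)) with (- G y) by (unfold G; ring).
destruct (Rtotal_order 0 y) as [h|[h|h]]; [|lra|].
- assert (G 0 < G y) by (apply (derive_pos_lt G dG); [exact h | intros; apply hG | intros; apply cG | intros; apply pos; lra]); nra.
- assert (G y < G 0) by (apply (derive_pos_lt G dG); [exact h | intros; apply hG | intros; apply cG | intros; apply pos; lra]); nra.
Qed.

(* The k of the test function U = z^(k/p) phi y. *)
Definition kexp : R := if Rle_dec 2 p then 0 else - (p - 1).

(** Write S = (1 + y^2)^((p-2)/2). For p >= 2, k = 0 gives - y^2 S (S + p n) with S >= 1 and p n > p
    (gq - C) >= -1. For p < 2, S falls below 1 and this fails. In general the products k n cancel,
    and y^2 phi^2 has the coefficient k^2 + 2 (p-1) k, smallest at k = 1 - p; with this k the rest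
    is controlled by the bound on the integral of phi^2. *)
Lemma Rfun_neg (y : R) : p * (C - gq p b) <= 1 -> y <> 0 -> Rfun kexp y < 0.
Proof.
intros hs hy; unfold kexp; destruct (Rle_dec 2 p) as [h2|h2].
- unfold Rfun, nfun, phi.
  set (S := pw ((p - 2) / 2) y).
  assert (hS : 1 <= S) by (apply Rpower_ge_1; nra).
  pose proof (bet_gt p b hp hb y hy).
  assert (0 < y ^ 2 * S) by (apply Rmult_lt_0_compat; nra).
  replace (_ - _) with (- (y ^ 2 * S * (S + p * (bet p b y - C)))) by ring.
  assert (0 < S + p * (bet p b y - C)) by nra; nra.
- assert (e : Rfun (- (p - 1)) y = (p * (C - gq p b) - 1) * (phi p y * y)
     + (p - 1) * (p - 1 + p * b) * (y * (2 * (p - 1) * phi2_int y - phi p y * (pw (p / 2) y - 1)))).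
  { unfold Rfun, k0fun, nfun, bet, gq; rewrite (pw_half p); unfold phi; ring. }
  rewrite e.
  pose proof (phi2_int_bound y ltac:(lra) hy).
  assert (0 < (p - 1) * (p - 1 + p * b)) by (apply Rmult_lt_0_compat; nra).
  assert (0 <= phi p y * y) by (unfold phi; pose proof (pw_pos ((p - 2) / 2) y); nra).
  nra.
Qed.

(* With K = z^(2k/p) (k0fun y + z phi y) one has U'^2 - U^2 + K' = z^(2k/p) Rfun k y. *)
Lemma arc_rigidity (x y : R -> R) (s0 s1 : R) :
  p * (C - gq p b) <= 1 -> s0 < s1 <= s0 + PI ->
  (forall t, is_derive x t (p * y t)) ->
  (forall t, is_derive y t (- (nfun (y t) + exp (x t)) / dphi p (y t))) ->
  y s0 = 0 -> y s1 = 0 -> forall t, s0 < t < s1 -> y t = 0.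
Proof.
intros hs hint dx dy y0 y1 t ht.
set (k := kexp).
pose (Z := fun t => exp (k / p * x t)).
pose (U := fun t => Z t * phi p (y t)).
pose (dU := fun t => Z t * (k * y t * phi p (y t) - (nfun (y t) + exp (x t)))).
pose (W := fun t => k0fun (y t) + exp (x t) * phi p (y t)).
pose (dW := fun t => - (nfun (y t) + exp (x t)) * (nfun (y t) + p * y t * phi p (y t))
    + (p * y t * exp (x t) * phi p (y t) - exp (x t) * (nfun (y t) + exp (x t)))).
pose (K := fun t => Z t ^ 2 * W t).
pose (dK := fun t => Z t ^ 2 * (2 * k * y t * W t + dW t)).
assert (ap : forall t, dphi p (y t) <> 0) by (intros u; pose proof (dphi_pos p hp (y u)); lra).
assert (hZ : forall t, is_derive Z t (k * y t * Z t)).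
{ intros u; replace (k * y u * Z u) with (k / p * (p * y u) * Z u) by (field; lra).
  apply (is_derive_comp exp (fun t => k / p * x t)); [apply is_derive_exp|].
  apply (is_derive_scal x), dx. }
assert (hphi : forall t, is_derive (fun t => phi p (y t)) t (- (nfun (y t) + exp (x t)))).
{ intros u; replace (- (nfun (y u) + exp (x u))) with
   ((- (nfun (y u) + exp (x u)) / dphi p (y u)) * dphi p (y u)) by (field; apply ap).
  apply (is_derive_comp (phi p) y); [apply is_derive_phi; trivial | apply dy]. }
assert (hex : forall t, is_derive (fun t => exp (x t)) t (p * y t * exp (x t))).
{ intros u; apply (is_derive_comp exp x); [apply is_derive_exp | apply dx]. }
assert (hU : forall t, is_derive U t (dU t)).
{ intros u; pose proof (is_derive_mult _ _ u _ _ (hZ u) (hphi u) Rmult_comm) as d.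
  match type of d with is_derive _ _ ?v => replace (dU u) with v end; [exact d|].
  unfold plus, mult, dU; simpl; ring. }
assert (hW : forall t, is_derive W t (dW t)).
{ intros u.
  assert (d1 : is_derive (fun t => k0fun (y t)) u ((- (nfun (y u) + exp (x u)) / dphi p (y u)) * (dphi p (y u) * (nfun (y u) + p * y u * phi p (y u))))).
  { apply (is_derive_comp k0fun y); [apply is_derive_k0fun | apply dy]. }
  pose proof (is_derive_plus _ _ u _ _ d1 (is_derive_mult _ _ u _ _ (hex u) (hphi u) Rmult_comm)) as d.
  match type of d with is_derive _ _ ?v => replace (dW u) with v end; [exact d|].
  unfold plus, mult, dW; simpl; field; apply ap. }
assert (hK : forall t, is_derive K t (dK t)).
{ intros u.
  assert (d1 : is_derive (fun t => Z t ^ 2) u (INR 2 * (k * y u * Z u) * Z u ^ pred 2)) by (apply is_derive_pow, hZ).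
  pose proof (is_derive_mult _ _ u _ _ d1 (hW u) Rmult_comm) as d.
  match type of d with is_derive _ _ ?v => replace (dK u) with v end; [exact d|].
  unfold plus, mult, dK; simpl; ring. }
assert (cx : forall t, continuous x t) by (intros u; eapply is_derive_continuous, dx).
assert (cy : forall t, continuous y t) by (intros u; eapply is_derive_continuous, dy).
assert (cphi : forall t, continuous (fun t => phi p (y t)) t) by (intros u; eapply is_derive_continuous, hphi).
assert (cex : forall t, continuous (fun t => exp (x t)) t) by (intros u; eapply is_derive_continuous, hex).
assert (cn : forall t, continuous (fun t => nfun (y t)) t).
{ intros u; apply (cont_comp y nfun); trivial; eapply is_derive_continuous, is_derive_nfun. }
assert (cZ : forall t, continuous Z t) by (intros u; eapply is_derive_continuous, hZ).
assert (cW : forall t, continuous W t) by (intros u; eapply is_derive_continuous, hW).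
assert (cdU : forall t, continuous dU t).
{ intros u; apply cont_mult; trivial; apply cont_minus.
  - apply cont_mult; trivial; apply cont_mult; trivial; apply cont_const.
  - apply cont_plus; trivial. }
assert (cdK : forall t, continuous dK t).
{ intros u; apply cont_mult.
  - apply continuous_ext with (fun t => Z t * Z t); [intros; simpl; ring|]; apply cont_mult; trivial.
  - apply cont_plus.
    + apply cont_mult; trivial; apply cont_mult; trivial; apply cont_const.
    + apply cont_plus.
      * apply cont_mult; [apply cont_opp, cont_plus; trivial | apply cont_plus; trivial].
        apply cont_mult; trivial; apply cont_mult; trivial; apply cont_const.
      * apply cont_minus; apply cont_mult; trivial; [|apply cont_plus; trivial].
        apply cont_mult; trivial; apply cont_mult; trivial; apply cont_const. }
destruct (C1_lipschitz U dU s0 s1) as [L1 [hL1 lU]]; auto; try lra.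
destruct (C1_lipschitz K dK s0 s1) as [L2 [hL2 lK]]; auto; try lra.
assert (zU : forall s, y s = 0 -> U s = 0) by (intros s e; unfold U; rewrite e, phi_0; ring).
assert (zK : forall s, y s = 0 -> K s = 0) by (intros s e; unfold K, W; rewrite e, k0fun_0, phi_0; ring).
assert (neg : forall t, dU t ^ 2 - U t ^ 2 + dK t = Z t ^ 2 * Rfun k (y t)).
{ intros u; unfold dU, U, dK, dW, W, Rfun; ring. }
assert (Zp : forall t, 0 < Z t ^ 2) by (intros u; apply pow_lt, exp_pos).
assert (r : dU t ^ 2 - U t ^ 2 + dK t = 0).
{ apply (wirtinger_rigidity U dU K dK s0 s1 (L1 + L2)); auto; try lra.
  - intros u hu; split.
    + pose proof (lU u s0 ltac:(lra) ltac:(lra)) as h; rewrite (zU s0 y0), Rminus_0_r, (Rabs_pos_eq (u - s0)) in h by lra.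
      nra.
    + pose proof (lU u s1 ltac:(lra) ltac:(lra)) as h; rewrite (zU s1 y1), Rminus_0_r, (Rabs_minus_sym u), (Rabs_pos_eq (s1 - u)) in h by lra.
      nra.
  - intros u hu; split.
    + pose proof (lK u s0 ltac:(lra) ltac:(lra)) as h; rewrite (zK s0 y0), Rminus_0_r, (Rabs_pos_eq (u - s0)) in h by lra.
      nra.
    + pose proof (lK u s1 ltac:(lra) ltac:(lra)) as h; rewrite (zK s1 y1), Rminus_0_r, (Rabs_minus_sym u), (Rabs_pos_eq (s1 - u)) in h by lra.
      nra.
  - intros u hu; rewrite neg; specialize (Zp u).
    destruct (Req_dec (y u) 0) as [e|ne].
    + rewrite e; unfold Rfun; rewrite phi_0; nra.
    + pose proof (Rfun_neg (y u) hs ne) as h; fold k in h; nra. }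
rewrite neg in r.
destruct (Req_dec (y t) 0) as [e|ne]; trivial.
pose proof (Rfun_neg (y t) hs ne) as h; fold k in h; specialize (Zp t); nra.
Qed.

End Lyapunov.

(** * Constant solutions, nonexistence and rigidity *)

Section PositiveSolutions.

Variables (p q c : R).
Hypotheses (hp : 1 < p) (hq : p - 1 < q).

Let b := beta_q p q.

Lemma threshold_kn : c - c_q p q <= Rpower (beta_q p q) (p - 1) / p <-> p * (Cn p q c - gq p b) <= 1.
Proof.
pose proof (b_pos p q hp hq) as hb; fold b in hb; pose proof (kn_pos p q) as hk.
assert (e : Cn p q c - gq p b = kn p q * (c - c_q p q)).
{ unfold b; rewrite <- (kn_cq p q hp hq); unfold Cn, kn; ring. }
assert (e2 : kn p q * Rpower b (p - 1) = 1).
{ unfold kn; fold b; rewrite <- Rpower_plus; replace (1 - p + (p - 1)) with 0 by ring; apply Rpower_O; trivial. }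
fold b; rewrite e; split; intros h.
- apply (Rmult_le_compat_l (p * kn p q)) in h; [|nra].
  replace (p * kn p q * (Rpower b (p - 1) / p)) with (kn p q * Rpower b (p - 1)) in h by (field; lra); lra.
- apply (Rmult_le_reg_l (p * kn p q)); [nra|].
  replace (p * kn p q * (Rpower b (p - 1) / p)) with (kn p q * Rpower b (p - 1)) by (field; lra); lra.
Qed.

Lemma Cn_gq : Cn p q c - gq p b = kn p q * (c - c_q p q).
Proof. unfold b; rewrite <- (kn_cq p q hp hq); unfold Cn, kn; ring. Qed.

(** It is the rest point x = ln (C - gq), y = 0 of the planar system. *)
Lemma constant_solution : 0 < c - c_q p q -> positive_solution p q c (fun _ => constant_value p q c).
Proof.
intros h; pose proof (kn_pos p q) as hk; pose proof Cn_gq as e; fold b in e.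
assert (hz : 0 < Cn p q c - gq p b) by (rewrite e; apply Rmult_lt_0_compat; trivial).
assert (eq : (fun _ : R => constant_value p q c) =
  (fun t => exp (((fun _ => ln (Cn p q c - gq p b)) t - ln (kn p q)) / (q + 1 - p)))).
{ apply functional_extensionality; intros _; unfold constant_value, Rpower.
  rewrite e, ln_mult by trivial; f_equal; field; lra. }
rewrite eq.
apply (positive_solution_of_system p q c hp hq (fun _ => 0)).
- intros t; rewrite Rmult_0_r; apply @is_derive_const.
- intros t; rewrite exp_ln by trivial; fold b; rewrite bet_0.
  replace (- (gq p b - Cn p q c + (Cn p q c - gq p b)) / dphi p 0) with 0 by (unfold Rdiv; ring).
  apply @is_derive_const.
- trivial.
Qed.

Section One.

Variable (f : R -> R).
Hypothesis hf : positive_solution p q c f.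

Let y := slope p q f.
Let x t := ln (kn p q * Rpower (f t) (q + 1 - p)).

Lemma pos_exp_x (t : R) : exp (x t) = kn p q * Rpower (f t) (q + 1 - p).
Proof. unfold x; rewrite exp_ln; trivial; apply Rmult_lt_0_compat; [apply kn_pos | apply Rpower_gt0]. Qed.

Lemma pos_dy (t : R) : is_derive y t (- (bet p b (y t) - Cn p q c + exp (x t)) / dphi p (y t)).
Proof. rewrite pos_exp_x; destruct hf as [h1 h2]; apply (slope_derive p q c); trivial. Qed.

Lemma pos_dx (t : R) : is_derive x t (p * y t).
Proof.
destruct hf as [h1 h2]; specialize (h2 t).
pose proof (b_pos p q hp hq) as hb; fold b in hb.
pose proof (Rpower_gt0 (f t) (q + 1 - p)) as hr; pose proof (kn_pos p q) as hk.
assert (d : is_derive (fun t => kn p q * Rpower (f t) (q + 1 - p)) t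
   (kn p q * ((q + 1 - p) * Rpower (f t) (q + 1 - p - 1) * Derive f t))).
{ apply (is_derive_scal (fun t => Rpower (f t) (q + 1 - p))), (is_derive_Rpower f); trivial.
  apply (sol_is_derive p q c); trivial. }
assert (e : Rpower (f t) (q + 1 - p) = Rpower (f t) (q + 1 - p - 1) * f t).
{ rewrite <- Rpower_succ by trivial; f_equal; ring. }
replace (p * y t) with ((kn p q * ((q + 1 - p) * Rpower (f t) (q + 1 - p - 1) * Derive f t)) * / (kn p q * Rpower (f t) (q + 1 - p))).
- apply (is_derive_comp ln); trivial.
  apply is_derive_Reals, derivable_pt_lim_ln; apply Rmult_lt_0_compat; trivial.
- pose proof (Rpower_gt0 (f t) (q + 1 - p - 1)) as hr2; rewrite e; set (r := Rpower (f t) (q + 1 - p - 1)) in *.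
  unfold y, slope; fold b; rewrite <- (p_div_b p q hp hq); fold b.
  field; repeat split; lra.
Qed.

Lemma pos_slope_periodic (t : R) : y (t + 2 * PI) = y t.
Proof.
destruct hf as [[per _] _]; unfold y, slope; rewrite per; f_equal.
unfold Derive; f_equal; apply Lim_ext; intros h.
replace (t + 2 * PI + h) with (t + h + 2 * PI) by ring; rewrite !per; trivial.
Qed.

(** Here C <= gq <= bet, so y' < 0 everywhere, which contradicts the periodicity of the slope. *)
Lemma no_positive : ~ c <= c_q p q.
Proof.
intros hc; pose proof PI_RGT_0.
pose proof (b_pos p q hp hq) as hb; fold b in hb.
pose proof Cn_gq as e; fold b in e; pose proof (kn_pos p q) as hk.
assert (l : - y 0 < - y (2 * PI)).
{ apply (derive_pos_lt (fun t => - y t) (fun t => - (- (bet p b (y t) - Cn p q c + exp (x t)) / dphi p (y t)))); [lra| | |].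
  - intros t _; apply (is_derive_opp y), pos_dy.
  - intros t _; apply cont_opp; eapply is_derive_continuous, pos_dy.
  - intros t _; pose proof (dphi_pos p hp (y t)); pose proof (exp_pos (x t)).
    pose proof (bet_ge p b hp hb (y t)).
    replace (- (- (bet p b (y t) - Cn p q c + exp (x t)) / dphi p (y t))) with
      ((bet p b (y t) - Cn p q c + exp (x t)) / dphi p (y t)) by (field; lra).
    apply Rdiv_lt_0_compat; trivial; nra. }
pose proof (pos_slope_periodic 0) as e2; rewrite Rplus_0_l in e2; lra.
Qed.

Lemma pos_derive (t : R) : Derive f t = b * f t * y t.
Proof.
pose proof (b_pos p q hp hq) as hb; fold b in hb.
destruct hf as [h1 h2]; specialize (h2 t); unfold y, slope; fold b; field; lra.
Qed.

Lemma extremum_slope (s : R) : ((forall t, f t <= f s) \/ (forall t, f s <= f t)) -> y s = 0.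
Proof.
intros h; destruct hf as [h1 h2].
pose proof (sol_is_derive p q c f h1 s) as d.
apply is_derive_Reals in d.
assert (pr : derivable_pt f s) by (exists (Derive f s); trivial).
assert (e : Derive f s = 0).
{ rewrite <- (derive_pt_eq_0 f s (Derive f s) pr d).
  destruct h as [h|h].
  - apply (deriv_maximum f (s - 1) (s + 1)); try lra; intros; apply h.
  - apply (deriv_minimum f (s - 1) (s + 1)); try lra; intros; apply h. }
unfold y, slope; rewrite e; unfold Rdiv; ring.
Qed.

(** A maximum and a minimum split one period into two arcs, one of length at most PI. The slope
    vanishes on that arc, so the maximum equals the minimum. *)
Lemma rigidity : p * (Cn p q c - gq p b) <= 1 -> forall s t, f s = f t.
Proof.
intros hs.
pose proof (b_pos p q hp hq) as hb; fold b in hb; pose proof PI_RGT_0 as hpi.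
assert (hpi2 : 0 < 2 * PI) by lra.
assert (per : forall s, f (s + 2 * PI) = f s) by apply hf.
assert (cf : forall s, continuous f s) by (apply (sol_continuous p q c), hf).
assert (red : forall a t, exists u, a <= u <= a + 2 * PI /\ f u = f t).
{ intros a t; destruct (shift_into (2 * PI) t a hpi2) as [k hk].
  exists (t + IZR k * (2 * PI)); split; [lra | apply periodic_IZR; trivial]. }
destruct (continuity_ab_maj f 0 (2 * PI)) as [sM [hM _]]; [lra|intros; apply continuity_pt_filterlim, cf|].
destruct (continuity_ab_min f sM (sM + 2 * PI)) as [sm [hm bm]]; [lra|intros; apply continuity_pt_filterlim, cf|].
assert (gM : forall t, f t <= f sM).
{ intros t; destruct (red 0 t) as [u [hu <-]]; apply hM; lra. }
assert (gm : forall t, f sm <= f t).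
{ intros t; destruct (red sM t) as [u [hu <-]]; apply hm; lra. }
assert (yM : y sM = 0) by (apply extremum_slope; left; trivial).
assert (ym : y sm = 0) by (apply extremum_slope; right; trivial).
assert (yM2 : y (sM + 2 * PI) = 0) by (rewrite pos_slope_periodic; trivial).
assert (arc : forall s0 s1, s0 < s1 <= s0 + PI -> y s0 = 0 -> y s1 = 0 -> f s0 = f s1).
{ intros s0 s1 h h0 h1.
  apply (derive_zero_eq f (Derive f)); [lra| | |].
  - intros; apply (sol_is_derive p q c); apply hf.
  - auto.
  - intros t ht; rewrite pos_derive.
    rewrite (arc_rigidity p b (Cn p q c) hp hb x y s0 s1); trivial.
    + ring.
    + exact pos_dx.
    + exact pos_dy. }
assert (e : f sM = f sm).
{ destruct (Req_dec sM sm) as [->|n1]; trivial.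
  destruct (Req_dec sm (sM + 2 * PI)) as [->|n2]; [symmetry; apply per|].
  destruct (Rle_dec (sm - sM) PI).
  - apply arc; trivial; lra.
  - rewrite <- (per sM); symmetry; apply arc; trivial; lra. }
intros s t; pose proof (gM s); pose proof (gM t); pose proof (gm s); pose proof (gm t); lra.
Qed.

Lemma rigidity_value : p * (Cn p q c - gq p b) <= 1 -> forall s, f s = constant_value p q c.
Proof.
intros hs s; pose proof (rigidity hs) as hc.
pose proof (b_pos p q hp hq) as hb; fold b in hb; pose proof (kn_pos p q) as hk.
destruct hf as [h1 h2].
assert (y0 : forall t, y t = 0).
{ intros t; apply extremum_slope; left; intros u; rewrite (hc u t); lra. }
pose proof (pos_dy s) as d.
assert (d0 : is_derive y s 0).
{ apply is_derive_ext with (fun _ : R => 0); [intros; symmetry; apply y0 | apply @is_derive_const]. }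
pose proof (is_derive_unique _ _ _ d) as e; rewrite (is_derive_unique _ _ _ d0) in e.
rewrite y0, bet_0, dphi_0, pos_exp_x in e.
pose proof Cn_gq as e1; fold b in e1.
assert (e2 : kn p q * (c - c_q p q) = kn p q * Rpower (f s) (q + 1 - p)) by lra.
apply Rmult_eq_reg_l in e2; [|lra].
unfold constant_value; rewrite e2, Rpower_mult.
replace ((q + 1 - p) * (1 / (q + 1 - p))) with 1 by (field; lra).
symmetry; apply Rpower_1, h2.
Qed.

End One.

End PositiveSolutions.

(** * Non-constant positive solutions *)

Lemma first_zero (g : R -> R) (a t : R) : a < t -> (forall s, a <= s <= t -> continuous g s) ->
  0 < g a -> g t <= 0 ->
  exists t1, a < t1 <= t /\ g t1 = 0 /\ forall s, a <= s < t1 -> 0 < g s.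
Proof.
intros hat hc ha ht.
pose (E := fun s => a <= s <= t /\ forall r, a <= r <= s -> 0 < g r).
destruct (completeness E) as [m [hm1 hm2]].
- exists t; intros s [h _]; lra.
- exists a; split; [lra|]; intros r hr; replace r with a by lra; trivial.
- assert (am : a <= m) by (apply hm1; split; [lra|]; intros r hr; replace r with a by lra; trivial).
  assert (mt : m <= t) by (apply hm2; intros s [h _]; lra).
  assert (pos : forall s, a <= s < m -> 0 < g s).
  { intros s hs.
    destruct (classic (exists r, E r /\ s < r)) as [[r [[_ hr] hsr]]|h]; [apply hr; lra|].
    exfalso; apply (Rlt_not_le m s (proj2 hs)), hm2; intros r hr.
    destruct (Rle_dec r s); trivial; exfalso; apply h; exists r; split; trivial; lra. }
  assert (gm : g m = 0).
  { destruct (Rtotal_order (g m) 0) as [h|[h|h]]; trivial; exfalso.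
    - assert (a < m) by (destruct (Req_dec a m); [subst; lra|lra]).
      destruct (continuous_eps g m (- g m) (hc m (conj am mt)) ltac:(lra)) as [d [hd1 hd2]].
      pose (s := Rmax a (m - d / 2)).
      assert (a <= s < m /\ m - d / 2 <= s) by (unfold s, Rmax; destruct Rle_dec; lra).
      specialize (pos s ltac:(lra)); specialize (hd2 s ltac:(apply Rabs_lt_between; lra)).
      apply Rabs_lt_between in hd2; lra.
    - assert (m < t) by (destruct (Req_dec t m); [subst; lra|lra]).
      destruct (continuous_eps g m (g m) (hc m (conj am mt)) h) as [d [hd1 hd2]].
      pose (s := Rmin t (m + d / 2)).
      assert (m < s <= t /\ s <= m + d / 2) by (unfold s, Rmin; destruct Rle_dec; lra).
      assert (E s).
      { split; [lra|]; intros r hr; destruct (Rlt_dec r m); [apply pos; lra|].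
        specialize (hd2 r ltac:(apply Rabs_lt_between; lra)); apply Rabs_lt_between in hd2; lra. }
      specialize (hm1 s H1); lra. }
  exists m; repeat split; trivial.
  destruct (Req_dec a m); [subst; lra|lra].
Qed.

Lemma derive_pos_local (g : R -> R) (s d : R) : is_derive g s d -> 0 < d ->
  exists e, 0 < e /\ (forall t, s < t < s + e -> g s < g t) /\ (forall t, s - e < t < s -> g t < g s).
Proof.
intros hd hp; apply is_derive_Reals in hd.
destruct (hd d hp) as [e he]; exists e; split; [apply cond_pos|split]; intros t ht.
- specialize (he (t - s) ltac:(lra) ltac:(apply Rabs_lt_between; lra)).
  replace (s + (t - s)) with t in he by ring; apply Rabs_lt_between in he.
  assert (0 < (g t - g s) / (t - s)) by lra.
  assert (g t - g s = (g t - g s) / (t - s) * (t - s)) by (field; lra); nra.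
- specialize (he (t - s) ltac:(lra) ltac:(apply Rabs_lt_between; lra)).
  replace (s + (t - s)) with t in he by ring; apply Rabs_lt_between in he.
  assert (0 < (g t - g s) / (t - s)) by lra.
  assert (g t - g s = (g t - g s) / (t - s) * (t - s)) by (field; lra); nra.
Qed.

Definition clamp (m y : R) : R := Rmax (- m) (Rmin y m).

Lemma clamp_range (m y : R) : 0 <= m -> - m <= clamp m y <= m.
Proof. intros h; unfold clamp, Rmax, Rmin; repeat destruct Rle_dec; lra. Qed.
Lemma clamp_id (m y : R) : - m <= y <= m -> clamp m y = y.
Proof. intros h; unfold clamp, Rmax, Rmin; repeat destruct Rle_dec; lra. Qed.
Lemma clamp_opp (m y : R) : 0 <= m -> clamp m (- y) = - clamp m y.
Proof. intros h; unfold clamp, Rmax, Rmin; repeat destruct Rle_dec; lra. Qed.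
Lemma clamp_lip (m y y' : R) : 0 <= m -> Rabs (clamp m y - clamp m y') <= Rabs (y - y').
Proof.
intros h; unfold clamp, Rmax, Rmin, Rabs; repeat destruct Rle_dec; repeat destruct Rcase_abs; lra.
Qed.
Lemma clamp_continuous (m : R) (f : R -> R) (x : R) : continuous f x -> continuous (fun x => clamp m (f x)) x.
Proof.
intros h; apply (cont_Rmax (fun _ => - m)); [apply cont_const|].
apply cont_Rmin; trivial; apply cont_const.
Qed.

Lemma exp_min_lip (M x x' : R) : Rabs (exp (Rmin x M) - exp (Rmin x' M)) <= exp M * Rabs (x - x').
Proof.
assert (h : forall u v, u <= v -> v <= M -> exp v - exp u <= exp M * (v - u)).
{ intros u v huv hv.
  assert (e : exp u = exp v * exp (u - v)) by (rewrite <- exp_plus; f_equal; ring).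
  pose proof (exp_ineq1_le (u - v)); pose proof (exp_pos v).
  assert (exp v <= exp M) by (apply exp_le_mono; trivial).
  rewrite e; assert (exp v * (1 - exp (u - v)) <= exp v * (v - u)) by (apply Rmult_le_compat_l; lra).
  nra. }
assert (l : Rabs (Rmin x M - Rmin x' M) <= Rabs (x - x')).
{ unfold Rmin, Rabs; repeat destruct Rle_dec; repeat destruct Rcase_abs; lra. }
pose proof (exp_pos M); pose proof (Rmin_r x M); pose proof (Rmin_r x' M).
apply Rle_trans with (exp M * Rabs (Rmin x M - Rmin x' M)); [|apply Rmult_le_compat_l; lra].
destruct (Rle_dec (Rmin x M) (Rmin x' M)) as [k|k].
- rewrite Rabs_minus_sym, (Rabs_minus_sym (Rmin x M)), !Rabs_pos_eq; try lra.
  + apply h; trivial.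
  + pose proof (exp_le_mono _ _ k); lra.
- assert (k' : Rmin x' M <= Rmin x M) by lra.
  rewrite !Rabs_pos_eq; try lra.
  + apply h; trivial.
  + pose proof (exp_le_mono _ _ k'); lra.
Qed.

Lemma exp_min_continuous (M : R) (f : R -> R) (x : R) : continuous f x -> continuous (fun x => exp (Rmin (f x) M)) x.
Proof.
intros h; apply (cont_comp (fun x => Rmin (f x) M) exp).
- apply cont_Rmin; trivial; apply cont_const.
- eapply is_derive_continuous, is_derive_exp.
Qed.

(** * Shooting for an orbit with prescribed half period *)

Section Shooting.

Variables (p b C eta : R).
Hypotheses (hp : 1 < p) (hb : 0 < b) (heta : 0 < eta) (hfreq : eta ^ 2 < p * (C - gq p b)).

Let l := PI / eta.
Let z0 := C - gq p b.

Lemma shoot_l : 0 < l.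
Proof. apply Rdiv_lt_0_compat; trivial; apply PI_RGT_0. Qed.
Lemma shoot_z0 : 0 < z0.
Proof. unfold z0; pose proof (pow2_ge_0 eta); nra. Qed.

Definition d2phi (y : R) : R :=
  2 * ((p - 4) / 2) * y * pw ((p - 4) / 2 - 1) y * (1 + (p - 1) * y ^ 2) + pw ((p - 4) / 2) y * (2 * (p - 1) * y).

Lemma is_derive_dphi (y : R) : is_derive (dphi p) y (d2phi y).
Proof.
apply (is_derive_mult (pw ((p - 4) / 2)) (fun y => 1 + (p - 1) * y ^ 2)); auto using Rmult_comm.
- apply is_derive_pw.
- auto_derive; trivial; ring.
Qed.

Lemma cont_sq (y : R) : continuous (fun y : R => y ^ 2) y.
Proof. eapply is_derive_continuous with (d := 2 * y); auto_derive; trivial; ring. Qed.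

Lemma d2phi_continuous (y : R) : continuous d2phi y.
Proof.
unfold d2phi; apply cont_plus; apply cont_mult.
- apply cont_mult; [|apply pw_continuous]; apply cont_mult; [apply cont_const | apply cont_id].
- apply cont_plus; [apply cont_const | apply cont_mult; [apply cont_const | apply cont_sq]].
- apply pw_continuous.
- apply cont_mult; [apply cont_const | apply cont_id].
Qed.

Definition inv_dphi (y : R) : R := / dphi p y.
Definition drift (y : R) : R := (C - bet p b y) * inv_dphi y.

Lemma dphi_ne (y : R) : dphi p y <> 0.
Proof. pose proof (dphi_pos p hp y); lra. Qed.

Lemma is_derive_inv_dphi (y : R) : is_derive inv_dphi y (- d2phi y / dphi p y ^ 2).
Proof. apply (is_derive_inv (dphi p)); [apply is_derive_dphi | apply dphi_ne]. Qed.

Lemma inv_dphi_continuous (y : R) : continuous inv_dphi y.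
Proof. eapply is_derive_continuous, is_derive_inv_dphi. Qed.

Lemma inv_dphi_lipschitz (m : R) : 0 <= m -> exists L, 0 < L /\ forall x y, - m <= x <= m -> - m <= y <= m ->
  Rabs (inv_dphi x - inv_dphi y) <= L * Rabs (x - y).
Proof.
intros hm; apply (C1_lipschitz inv_dphi (fun y => - d2phi y / dphi p y ^ 2)); [lra| |].
- intros; apply is_derive_inv_dphi.
- intros x _; apply cont_div; [apply cont_opp, d2phi_continuous| |apply pow_nonzero, dphi_ne].
  apply continuous_ext with (fun y => dphi p y * dphi p y); [intros; simpl; ring|].
  apply cont_mult; apply dphi_continuous; trivial.
Qed.

Lemma drift_lipschitz (m : R) : 0 <= m -> exists L, 0 < L /\ forall x y, - m <= x <= m -> - m <= y <= m ->
  Rabs (drift x - drift y) <= L * Rabs (x - y).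
Proof.
intros hm; apply (C1_lipschitz drift (fun y => (0 - y * dbet p b y) * inv_dphi y + (C - bet p b y) * (- d2phi y / dphi p y ^ 2))); [lra| |].
- intros y _; apply (is_derive_mult (fun y => C - bet p b y) inv_dphi); auto using Rmult_comm.
  + apply (is_derive_minus (fun _ => C) (bet p b)); [apply @is_derive_const | apply is_derive_bet; trivial].
  + apply is_derive_inv_dphi.
- intros x _; apply cont_plus; apply cont_mult.
  + apply cont_minus; [apply cont_const|]; apply cont_mult; [apply cont_id | apply dbet_continuous; trivial].
  + apply inv_dphi_continuous.
  + apply cont_minus; [apply cont_const | apply bet_continuous; trivial].
  + apply cont_div; [apply cont_opp, d2phi_continuous| |apply pow_nonzero, dphi_ne].
    apply continuous_ext with (fun y => dphi p y * dphi p y); [intros; simpl; ring|].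
    apply cont_mult; apply dphi_continuous; trivial.
Qed.

Lemma drift_continuous (y : R) : continuous drift y.
Proof.
apply cont_mult; [|apply inv_dphi_continuous].
apply cont_minus; [apply cont_const | apply bet_continuous; trivial].
Qed.

Section Truncated.

Variables (ys : R).
Hypothesis hys : 0 <= ys.

(** The height [ys] is later taken with bet ys = C. Above it y decreases, so an orbit leaving the
    axis never gets past [ys], and [Ym] leaves a margin of 1. An orbit starting with x <= ln z0
    stays below [Mx] during the time [l], since x' <= p Ym for the cut-off field. *)
Let Ym := ys + 1.
Let Mx := ln z0 + p * Ym * l.

(* The vector field of the (x, y) system, made bounded and globally Lipschitz. *)
Definition fx (t x y : R) : R := p * clamp Ym y.
Definition fy (t x y : R) : R := drift (clamp Ym y) - exp (Rmin x Mx) * inv_dphi (clamp Ym y).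

Lemma Ym_pos : 0 < Ym.
Proof. unfold Ym; lra. Qed.

Lemma truncated_lipschitz : exists L M, 0 < L /\ lipschitz_field L M fx /\ lipschitz_field L M fy.
Proof.
pose proof Ym_pos as hY.
assert (cr : forall y, - Ym <= clamp Ym y <= Ym) by (intros; apply clamp_range; lra).
destruct (inv_dphi_lipschitz Ym) as [L1 [hL1 l1]]; [lra|].
destruct (drift_lipschitz Ym) as [L2 [hL2 l2]]; [lra|].
destruct (continuous_bounded inv_dphi (- Ym) Ym) as [B1 [hB1 b1]]; [lra|intros; apply inv_dphi_continuous|].
destruct (continuous_bounded drift (- Ym) Ym) as [B2 [hB2 b2]]; [lra|intros; apply drift_continuous|].
pose proof (exp_pos Mx) as hM.
assert (em : forall x, 0 < exp (Rmin x Mx) <= exp Mx).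
{ intros x; split; [apply exp_pos | apply exp_le_mono, Rmin_r]. }
assert (hML1 : 0 < exp Mx * L1) by (apply Rmult_lt_0_compat; trivial).
assert (hMB1 : 0 < exp Mx * B1) by (apply Rmult_lt_0_compat; trivial).
exists (p + L2 + exp Mx * L1 + exp Mx * B1), (p * Ym + B2 + exp Mx * B1).
split; [lra|]; split; (split; [|split]).
- intros t x y x' y'; unfold fx.
  replace (p * clamp Ym y - p * clamp Ym y') with (p * (clamp Ym y - clamp Ym y')) by ring.
  rewrite Rabs_mult, (Rabs_pos_eq p) by lra.
  pose proof (clamp_lip Ym y y' ltac:(lra)); pose proof (Rabs_pos (x - x')); pose proof (Rabs_pos (y - y')).
  apply Rle_trans with (p * Rabs (y - y')); [apply Rmult_le_compat_l; lra|].
  apply Rmult_le_compat; lra.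
- intros t x y; unfold fx; rewrite Rabs_mult, (Rabs_pos_eq p) by lra.
  assert (Rabs (clamp Ym y) <= Ym) by (apply Rabs_le, cr).
  assert (p * Rabs (clamp Ym y) <= p * Ym) by (apply Rmult_le_compat_l; lra); lra.
- intros x y cx cy t; unfold fx; apply cont_mult; [apply cont_const | apply clamp_continuous; trivial].
- intros t x y x' y'; unfold fy.
  specialize (l1 (clamp Ym y) (clamp Ym y') (cr y) (cr y')).
  specialize (l2 (clamp Ym y) (clamp Ym y') (cr y) (cr y')).
  specialize (b1 (clamp Ym y) (cr y)).
  pose proof (clamp_lip Ym y y' ltac:(lra)) as lc.
  pose proof (exp_min_lip Mx x x') as le.
  destruct (em x') as [e1 e2].
  set (u := clamp Ym y) in *; set (u' := clamp Ym y') in *.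
  replace (drift u - exp (Rmin x Mx) * inv_dphi u - (drift u' - exp (Rmin x' Mx) * inv_dphi u')) with
    ((drift u - drift u') + (- ((exp (Rmin x Mx) - exp (Rmin x' Mx)) * inv_dphi u) + - (exp (Rmin x' Mx) * (inv_dphi u - inv_dphi u')))) by ring.
  eapply Rle_trans; [apply Rabs_triang|].
  eapply Rle_trans; [apply Rplus_le_compat_l, Rabs_triang|].
  rewrite !Rabs_Ropp, !Rabs_mult, (Rabs_pos_eq (exp (Rmin x' Mx))) by lra.
  pose proof (Rabs_pos (x - x')); pose proof (Rabs_pos (y - y')); pose proof (Rabs_pos (u - u')).
  assert (t1 : Rabs (drift u - drift u') <= L2 * Rabs (y - y')).
  { eapply Rle_trans; [exact l2|]; apply Rmult_le_compat_l; lra. }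
  assert (t2 : Rabs (exp (Rmin x Mx) - exp (Rmin x' Mx)) * Rabs (inv_dphi u) <= (exp Mx * Rabs (x - x')) * B1).
  { apply Rmult_le_compat; trivial; apply Rabs_pos. }
  assert (t3 : exp (Rmin x' Mx) * Rabs (inv_dphi u - inv_dphi u') <= exp Mx * (L1 * Rabs (y - y'))).
  { apply Rmult_le_compat; try lra; [apply Rabs_pos|].
    eapply Rle_trans; [exact l1|]; apply Rmult_le_compat_l; lra. }
  assert (0 <= p * (Rabs (x - x') + Rabs (y - y'))) by (apply Rmult_le_pos; lra).
  assert (0 <= L2 * Rabs (x - x')) by (apply Rmult_le_pos; lra).
  assert (0 <= exp Mx * L1 * Rabs (x - x')) by (apply Rmult_le_pos; lra).
  assert (0 <= exp Mx * B1 * Rabs (y - y')) by (apply Rmult_le_pos; lra).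
  lra.
- intros t x y; unfold fy.
  specialize (b1 (clamp Ym y) (cr y)); specialize (b2 (clamp Ym y) (cr y)).
  destruct (em x) as [e1 e2].
  eapply Rle_trans; [apply Rabs_triang|]; rewrite Rabs_Ropp, Rabs_mult, (Rabs_pos_eq (exp _)) by lra.
  assert (exp (Rmin x Mx) * Rabs (inv_dphi (clamp Ym y)) <= exp Mx * B1).
  { apply Rmult_le_compat; try lra; apply Rabs_pos. }
  assert (0 <= p * Ym) by (apply Rmult_le_pos; lra); lra.
- intros x y cx cy t; unfold fy; apply cont_minus.
  + apply (cont_comp (fun t => clamp Ym (y t)) drift); [apply clamp_continuous; trivial | apply drift_continuous].
  + apply cont_mult; [apply exp_min_continuous; trivial|].
    apply (cont_comp (fun t => clamp Ym (y t)) inv_dphi); [apply clamp_continuous; trivial | apply inv_dphi_continuous].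
Qed.

Definition traj (x y : R -> R) : Prop :=
  (forall t, is_derive x t (fx t (x t) (y t))) /\ (forall t, is_derive y t (fy t (x t) (y t))).

Lemma traj_exists (a : R) : exists x y, traj x y /\ x 0 = a /\ y 0 = 0.
Proof.
destruct truncated_lipschitz as [L [M [hL [h1 h2]]]].
destruct (picard_existence fx fy L M a 0 hL h1 h2) as [x [y [e1 [e2 [d1 d2]]]]].
exists x, y; split; [split; trivial | split; trivial].
Qed.

(** Gronwall for the squared distance, which is differentiable, in both directions of time: 2 L (|u|
    + |v|)^2 <= 4 L (u^2 + v^2). *)
Lemma traj_dependence : exists L, 0 < L /\ forall x y x' y' s t, traj x y -> traj x' y' ->
  (x t - x' t) ^ 2 + (y t - y' t) ^ 2 <= ((x s - x' s) ^ 2 + (y s - y' s) ^ 2) * exp (L * Rabs (t - s)).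
Proof.
destruct truncated_lipschitz as [L [M [hL [[h1 _] [h2 _]]]]].
exists (4 * L); split; [lra|].
intros x y x' y' s t [dx dy] [dx' dy'].
pose (N := fun t => (x t - x' t) ^ 2 + (y t - y' t) ^ 2).
pose (dN := fun t => 2 * (x t - x' t) * (fx t (x t) (y t) - fx t (x' t) (y' t)) +
   2 * (y t - y' t) * (fy t (x t) (y t) - fy t (x' t) (y' t))).
assert (hN : forall t, is_derive N t (dN t)).
{ clear s t; intros t.
  assert (sq : forall (u v : R -> R) du dv, is_derive u t du -> is_derive v t dv ->
    is_derive (fun t => (u t - v t) ^ 2) t (2 * (u t - v t) * (du - dv))).
  { intros u v du dv hu hv.
    replace (2 * (u t - v t) * (du - dv)) with (INR 2 * (du - dv) * (u t - v t) ^ pred 2) by (simpl; ring).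
    apply (is_derive_pow (fun t => u t - v t)), (is_derive_minus u v); trivial. }
  apply (is_derive_plus (fun t => (x t - x' t) ^ 2) (fun t => (y t - y' t) ^ 2)); apply sq; trivial. }
assert (bN : forall t, Rabs (dN t) <= 4 * L * N t).
{ clear s t; intros t; unfold dN, N.
  specialize (h1 t (x t) (y t) (x' t) (y' t)); specialize (h2 t (x t) (y t) (x' t) (y' t)).
  set (A1 := fx _ _ _ - _) in *; set (A2 := fy _ _ _ - _) in *.
  set (u := x t - x' t) in *; set (v := y t - y' t) in *.
  eapply Rle_trans; [apply Rabs_triang|].
  rewrite !Rabs_mult, (Rabs_pos_eq 2) by lra.
  rewrite <- (pow2_abs u), <- (pow2_abs v).
  pose proof (Rabs_pos u); pose proof (Rabs_pos v).
  assert (2 * Rabs u * Rabs A1 <= 2 * Rabs u * (L * (Rabs u + Rabs v))) by (apply Rmult_le_compat_l; lra).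
  assert (2 * Rabs v * Rabs A2 <= 2 * Rabs v * (L * (Rabs u + Rabs v))) by (apply Rmult_le_compat_l; lra).
  assert (0 <= L * (Rabs u - Rabs v) ^ 2) by (apply Rmult_le_pos; [lra | apply pow2_ge_0]); nra. }
assert (cN : forall t, continuous N t) by (intros r; eapply is_derive_continuous, hN).
fold (N t); fold (N s).
destruct (Rle_dec s t).
- rewrite Rabs_pos_eq by lra; apply (gronwall N dN (4 * L) s t); auto.
- rewrite Rabs_minus_sym, Rabs_pos_eq by lra; apply (gronwall N dN (4 * L) t s); auto; lra.
Qed.

Lemma traj_unique (x y x' y' : R -> R) (s : R) : traj x y -> traj x' y' -> x s = x' s -> y s = y' s ->
  forall t, x t = x' t /\ y t = y' t.
Proof.
intros h h' e1 e2 t; destruct traj_dependence as [L [hL d]].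
specialize (d x y x' y' s t h h'); rewrite e1, e2, !Rminus_diag in d.
replace ((0 ^ 2 + 0 ^ 2) * exp (L * Rabs (t - s))) with 0 in d by ring.
pose proof (pow2_ge_0 (x t - x' t)); pose proof (pow2_ge_0 (y t - y' t)).
split; apply Rminus_diag_uniq, Rsqr_0_uniq; unfold Rsqr; nra.
Qed.

Lemma traj_reflect (x y : R -> R) (r : R) : traj x y -> traj (fun t => x (r - t)) (fun t => - y (r - t)).
Proof.
pose proof Ym_pos as hY.
intros [dx dy]; split; intros t.
- replace (fx t (x (r - t)) (- y (r - t))) with (-1 * fx (r - t) (x (r - t)) (y (r - t))) by
    (unfold fx; rewrite clamp_opp by lra; ring).
  apply (is_derive_comp x (fun t => r - t)); [apply dx | auto_derive; trivial; ring].
- replace (fy t (x (r - t)) (- y (r - t))) with (- (-1 * fy (r - t) (x (r - t)) (y (r - t)))).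
  + apply (is_derive_opp (fun t => y (r - t))).
    apply (is_derive_comp y (fun t => r - t)); [apply dy | auto_derive; trivial; ring].
  + unfold fy, drift, inv_dphi; rewrite clamp_opp, bet_even, dphi_even by lra; ring.
Qed.

Lemma ln_z0_Mx : ln z0 <= Mx.
Proof.
unfold Mx; pose proof shoot_l; pose proof Ym_pos.
assert (0 <= p * Ym * l) by (apply Rmult_le_pos; [apply Rmult_le_pos|]; lra); lra.
Qed.

Lemma fy_axis (t x : R) : x <= Mx -> fy t x 0 = z0 - exp x.
Proof.
pose proof Ym_pos; intros hx; unfold fy, drift, inv_dphi.
rewrite clamp_id, Rmin_left, bet_0, dphi_0 by (try lra; trivial); unfold z0; field.
Qed.

Lemma traj_equilibrium : traj (fun _ => ln z0) (fun _ => 0).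
Proof.
pose proof Ym_pos; pose proof shoot_z0; split; intros t.
- replace (fx t (ln z0) 0) with 0 by (unfold fx; rewrite clamp_id by lra; ring).
  apply @is_derive_const.
- rewrite fy_axis, exp_ln by (trivial; apply ln_z0_Mx); rewrite Rminus_diag; apply @is_derive_const.
Qed.

Lemma traj_x_bound (x y : R -> R) (t : R) : traj x y -> 0 <= t -> x t <= x 0 + p * Ym * t.
Proof.
intros [dx dy] ht; pose proof Ym_pos.
assert (x t - p * Ym * t <= x 0 - p * Ym * 0); [|lra].
apply Ropp_le_cancel.
apply (derive_nonneg_le (fun t => - (x t - p * Ym * t)) (fun t => - (fx t (x t) (y t) - p * Ym))); trivial.
- intros u _; apply (is_derive_opp (fun t => x t - p * Ym * t)).
  apply (is_derive_minus x (fun t => p * Ym * t)); [apply dx | auto_derive; trivial; ring].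
- intros u _; apply cont_opp, cont_minus; [eapply is_derive_continuous, dx|].
  apply cont_mult; [apply cont_const | apply cont_id].
- intros u _; unfold fx; pose proof (clamp_range Ym (y u) ltac:(lra)); nra.
Qed.

Lemma traj_y_continuous (x y : R -> R) (t : R) : traj x y -> continuous y t.
Proof. intros [_ dy]; eapply is_derive_continuous, dy. Qed.

Lemma traj_start_pos (x y : R -> R) : traj x y -> x 0 < ln z0 -> y 0 = 0 ->
  exists e, 0 < e /\ forall t, 0 < t < e -> 0 < y t.
Proof.
intros [dx dy] hx hy; pose proof ln_z0_Mx.
assert (h := dy 0); rewrite hy, fy_axis in h by lra.
destruct (derive_pos_local y 0 _ h) as [e [he [h1 _]]].
- pose proof (exp_increasing _ _ hx); rewrite exp_ln in H0 by apply shoot_z0; lra.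
- exists e; split; trivial; intros t ht; rewrite <- hy; apply h1; lra.
Qed.

Lemma traj_first_zero (x y : R -> R) (t : R) : traj x y -> x 0 < ln z0 -> y 0 = 0 -> 0 < t -> y t <= 0 ->
  exists t1, 0 < t1 <= t /\ y t1 = 0 /\ forall s, 0 < s < t1 -> 0 < y s.
Proof.
intros h hx hy ht hyt; destruct (traj_start_pos x y h hx hy) as [e [he pe]].
pose (a := Rmin e t / 2).
assert (0 < a < e /\ a < t) by (unfold a, Rmin; destruct Rle_dec; lra).
destruct (first_zero y a t) as [t1 [h1 [h2 h3]]]; try lra.
- intros; apply (traj_y_continuous x); trivial.
- apply pe; lra.
- exists t1; repeat split; trivial; try lra.
  intros s hs; destruct (Rlt_dec s e); [apply pe; lra | apply h3; lra].
Qed.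

(** The starting points whose orbit is back on the axis y = 0 by time [l]. The orbit sought starts
    at the infimum of this set, so no continuity of the first return time has to be studied. *)
Definition hits (a : R) : Prop :=
  a < ln z0 /\ exists x y t, traj x y /\ x 0 = a /\ y 0 = 0 /\ 0 < t <= l /\ y t = 0.

(** From a lower start x remains below ln z0 up to time [l]. At a first return one would have y' =
    z0 - exp x > 0, although y arrives there from positive values. *)
Lemma hits_lower (a : R) : hits a -> ln z0 - p * Ym * l <= a.
Proof.
intros [ha [x [y [t [h [hx [hy [ht hyt]]]]]]]].
destruct (Rle_dec (ln z0 - p * Ym * l) a) as [|n]; trivial; exfalso.
pose proof Ym_pos; pose proof shoot_l.
destruct (traj_first_zero x y t h) as [t1 [h1 [h2 h3]]]; try lra.
assert (xt : x t1 < ln z0).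
{ pose proof (traj_x_bound x y t1 h ltac:(lra)).
  assert (p * Ym * t1 <= p * Ym * l) by (apply Rmult_le_compat_l; [apply Rmult_le_pos|]; lra); lra. }
pose proof ln_z0_Mx.
assert (d := proj2 h t1); rewrite h2, fy_axis in d by lra.
destruct (derive_pos_local y t1 _ d) as [e [he [_ h4]]].
- pose proof (exp_increasing _ _ xt); rewrite exp_ln in H2 by apply shoot_z0; lra.
- pose (s := Rmax (t1 / 2) (t1 - e / 2)).
  assert (0 < s < t1 /\ t1 - e < s) by (unfold s, Rmax; destruct Rle_dec; lra).
  specialize (h3 s ltac:(lra)); specialize (h4 s ltac:(lra)); lra.
Qed.

(* Sturm comparison of P = phi y with sin (eta t): the frequency of the
   linearization at the centre exceeds eta. *)
Lemma hits_near : exists a, hits a.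
Proof.
pose proof Ym_pos as hY; pose proof shoot_l as hl; pose proof shoot_z0 as hz; pose proof ln_z0_Mx as hM.
destruct traj_dependence as [L [hL dep]].
destruct truncated_lipschitz as [L' [M' [hL' [_ [lfy _]]]]].
(* A quarter of the gap between the squared frequencies: each of the three errors in the sign of
   [dW] uses up one quarter. *)
pose (tau := (p * z0 - eta ^ 2) / 4).
assert (htau : 0 < tau) by (unfold tau, z0; lra).
destruct (continuous_eps (fun y => eta ^ 2 * pw ((p - 2) / 2) y) 0 tau) as [d1 [hd1 k1]]; trivial.
{ apply cont_mult; [apply cont_const | apply pw_continuous]. }
destruct (continuous_eps (fun x => p * exp x) (ln z0) tau) as [d2 [hd2 k2]]; trivial.
{ apply cont_mult; [apply cont_const | eapply is_derive_continuous, is_derive_exp]. }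
destruct (continuous_bounded (dbet p b) (- Ym) Ym) as [D [hD bD]]; [lra|intros; apply dbet_continuous; trivial|].
pose (e := Rmin (Rmin d1 d2) (Rmin Ym (tau / (2 * D * L')))).
assert (hDL : 0 < 2 * D * L') by (apply Rmult_lt_0_compat; lra).
assert (he0 : 0 < tau / (2 * D * L')) by (apply Rdiv_lt_0_compat; trivial).
assert (he : 0 < e /\ e <= d1 /\ e <= d2 /\ e <= Ym /\ e <= tau / (2 * D * L')).
{ unfold e, Rmin; repeat destruct Rle_dec; lra. }
(* The squared distance to the equilibrium is multiplied by at most exp (L l) on [0, l], so from
   [dl] it stays below (e / 2)^2. *)
pose (dl := e / 2 * exp (- (L * l / 2))).
assert (hdl : 0 < dl) by (apply Rmult_lt_0_compat; [lra | apply exp_pos]).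
exists (ln z0 - dl); split; [lra|].
destruct (traj_exists (ln z0 - dl)) as [x [y [h [hx hy]]]]; exists x, y.
assert (small : forall t, 0 <= t <= l -> Rabs (x t - ln z0) < e /\ Rabs (y t - 0) < e).
{ intros t ht.
  pose proof (dep x y _ _ 0 t h traj_equilibrium) as d; rewrite hx, hy in d.
  assert (b2 : ((ln z0 - dl - ln z0) ^ 2 + (0 - 0) ^ 2) * exp (L * Rabs (t - 0)) <= (e / 2) ^ 2).
  { replace ((ln z0 - dl - ln z0) ^ 2 + (0 - 0) ^ 2) with (dl ^ 2) by ring.
    rewrite Rminus_0_r, Rabs_pos_eq by lra.
    apply Rle_trans with (dl ^ 2 * exp (L * l)).
    - apply Rmult_le_compat_l; [apply pow2_ge_0|]; apply exp_le_mono, Rmult_le_compat_l; lra.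
    - unfold dl; replace ((e / 2 * exp (- (L * l / 2))) ^ 2 * exp (L * l)) with
        ((e / 2) ^ 2 * (exp (- (L * l / 2)) * exp (- (L * l / 2)) * exp (L * l))) by ring.
      rewrite <- !exp_plus; replace (- (L * l / 2) + - (L * l / 2) + L * l) with 0 by field.
      rewrite exp_0; lra. }
  pose proof (pow2_ge_0 (x t - ln z0)); pose proof (pow2_ge_0 (y t - 0)).
  split; apply Rabs_lt_between; nra. }
destruct (classic (exists t, 0 < t <= l /\ y t = 0)) as [[t [ht hyt]]|no].
{ exists t; repeat split; trivial; try apply h; lra. }
exfalso.
assert (ypos : forall t, 0 < t <= l -> 0 < y t).
{ intros t ht; destruct (Rlt_dec 0 (y t)) as [|n]; trivial; exfalso.
  destruct (traj_first_zero x y t h) as [t1 [h1 [h2 h3]]]; try lra.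
  apply no; exists t1; split; trivial; lra. }
pose (P := fun t => phi p (y t)).
pose (dP := fun t => C - bet p b (y t) - exp (x t)).
(* The Wronskian of P and sin (eta t). If y had no zero up to [l], it would decrease from W 0 = 0,
   whereas W l = eta P l > 0. *)
pose (W := fun t => dP t * sin (eta * t) - P t * (eta * cos (eta * t))).
pose (dW := fun t => sin (eta * t) * y t * (eta ^ 2 * pw ((p - 2) / 2) (y t) - p * exp (x t) - dbet p b (y t) * fy t (x t) (y t))).
assert (inr : forall t, 0 <= t <= l -> - Ym <= y t <= Ym /\ x t <= Mx).
{ intros t ht; destruct (small t ht) as [s1 s2].
  apply Rabs_lt_between in s2; split; [lra|].
  pose proof (traj_x_bound x y t h ltac:(lra)).
  assert (p * Ym * t <= p * Ym * l) by (apply Rmult_le_compat_l; [apply Rmult_le_pos|]; lra).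
  unfold Mx; lra. }
assert (fyE : forall t, 0 <= t <= l -> fy t (x t) (y t) = dP t / dphi p (y t)).
{ intros t ht; destruct (inr t ht); unfold fy, dP, drift, inv_dphi; rewrite clamp_id, Rmin_left by trivial.
  field; apply dphi_ne. }
assert (hP : forall t, 0 <= t <= l -> is_derive P t (dP t)).
{ intros t ht; replace (dP t) with (fy t (x t) (y t) * dphi p (y t)) by (rewrite fyE by trivial; field; apply dphi_ne).
  apply (is_derive_comp (phi p) y); [apply is_derive_phi; trivial | apply h]. }
assert (hdP : forall t, 0 <= t <= l -> is_derive dP t (0 - fy t (x t) (y t) * (y t * dbet p b (y t)) - p * y t * exp (x t))).
{ intros t ht.
  apply (is_derive_minus (fun t => C - bet p b (y t)) (fun t => exp (x t))).
  - apply (is_derive_minus (fun _ => C) (fun t => bet p b (y t))); [apply @is_derive_const|].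
    apply (is_derive_comp (bet p b) y); [apply is_derive_bet; trivial | apply h].
  - apply (is_derive_comp exp x); [apply is_derive_exp|].
    replace (p * y t) with (fx t (x t) (y t)); [apply h|].
    unfold fx; rewrite clamp_id; trivial; apply inr; trivial. }
assert (hW : forall t, 0 <= t <= l -> is_derive W t (dW t)).
{ intros t ht.
  assert (ds : is_derive (fun t => sin (eta * t)) t (eta * cos (eta * t))) by (auto_derive; trivial; ring).
  assert (dc : is_derive (fun t => eta * cos (eta * t)) t (- eta ^ 2 * sin (eta * t))) by (auto_derive; trivial; ring).
  pose proof (is_derive_minus _ _ t _ _ (is_derive_mult dP _ t _ _ (hdP t ht) ds Rmult_comm)
    (is_derive_mult P _ t _ _ (hP t ht) dc Rmult_comm)) as d.
  match type of d with is_derive _ _ ?v => replace (dW t) with v end; [exact d|].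
  unfold minus, plus, opp, mult, dW, P, phi; simpl; ring. }
assert (neg : - W 0 < - W l).
{ apply (derive_pos_lt (fun t => - W t) (fun t => - dW t)); trivial.
  - intros t ht; apply (is_derive_opp W), hW; lra.
  - intros t ht; apply (cont_opp W); eapply is_derive_continuous, hW; lra.
  - intros t ht; unfold dW.
    destruct (small t ltac:(lra)) as [s1 s2].
    specialize (k1 (y t) ltac:(lra)); specialize (k2 (x t) ltac:(lra)).
    rewrite pw_0 in k1; rewrite exp_ln in k2 by trivial.
    apply Rabs_lt_between in k1; apply Rabs_lt_between in k2.
    destruct (inr t ltac:(lra)) as [i1 i2].
    specialize (bD (y t) i1); specialize (lfy t (x t) (y t) (ln z0) 0).
    rewrite fy_axis, exp_ln, Rminus_diag, (Rminus_0_r (fy _ _ _)) in lfy by trivial.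
    assert (bb : Rabs (dbet p b (y t) * fy t (x t) (y t)) <= tau).
    { rewrite Rabs_mult.
      apply Rle_trans with (D * (L' * (2 * e))).
      - apply Rmult_le_compat; trivial; try apply Rabs_pos.
        eapply Rle_trans; [exact lfy|]; apply Rmult_le_compat_l; lra.
      - replace (D * (L' * (2 * e))) with ((2 * D * L') * e) by ring.
        apply Rle_trans with ((2 * D * L') * (tau / (2 * D * L'))); [apply Rmult_le_compat_l; lra|].
        right; field; lra. }
    apply Rabs_le_between in bb.
    assert (0 < sin (eta * t)).
    { apply sin_gt_0; [apply Rmult_lt_0_compat; lra|].
      replace PI with (eta * l) by (unfold l; field; lra); apply Rmult_lt_compat_l; lra. }
    specialize (ypos t ltac:(lra)).
    assert (0 < sin (eta * t) * y t) by (apply Rmult_lt_0_compat; trivial).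
    assert (eta ^ 2 * pw ((p - 2) / 2) (y t) - p * exp (x t) - dbet p b (y t) * fy t (x t) (y t) < 0) by (unfold tau in *; lra).
    nra. }
assert (W0 : W 0 = 0).
{ unfold W, P; rewrite hy, Rmult_0_r, sin_0; unfold phi; ring. }
assert (Wl : W l = eta * P l).
{ unfold W; replace (eta * l) with PI by (unfold l; field; lra); rewrite sin_PI, cos_PI; ring. }
assert (0 < P l).
{ apply Rmult_lt_0_compat; [apply ypos; lra | apply pw_pos]. }
nra.
Qed.

(** Let s be the infimum of the starting points that hit. Points close to s have return times that
    do not collapse to 0, because y' is bounded below near the start; hence s itself hits. A return
    strictly before [l] would cross the axis transversally, and slightly lower points would still
    hit. *)
Lemma critical_traj : exists x y, traj x y /\ y 0 = 0 /\ y l = 0 /\ x 0 < ln z0 /\ forall t, 0 < t < l -> 0 < y t.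
Proof.
pose proof Ym_pos as hY; pose proof shoot_l as hl; pose proof shoot_z0 as hz; pose proof ln_z0_Mx as hM.
destruct (completeness (fun a => hits (- a))) as [m [hm1 hm2]].
- exists (- (ln z0 - p * Ym * l)); intros a ha; pose proof (hits_lower _ ha); lra.
- destruct hits_near as [a ha]; exists (- a); rewrite Ropp_involutive; trivial.
- pose (s := - m).
  assert (lows : forall a, hits a -> s <= a).
  { intros a ha; specialize (hm1 (- a)); cbv beta in hm1; rewrite Ropp_involutive in hm1; specialize (hm1 ha); unfold s; lra. }
  assert (near : forall d, 0 < d -> exists a, hits a /\ a < s + d).
  { intros d hd; destruct (classic (exists a, hits a /\ a < s + d)) as [|n]; trivial; exfalso.
    assert (m <= m - d); [|lra]. apply hm2; intros a ha.
    destruct (Rle_dec a (m - d)); trivial; exfalso; apply n; exists (- a); split; trivial; unfold s; lra. }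
  assert (hs : s < ln z0).
  { destruct hits_near as [a ha]; pose proof (lows a ha); destruct ha as [ha _]; lra. }
  destruct (traj_exists s) as [x [y [h [hx hy]]]].
  destruct traj_dependence as [L [hL dep]].
  assert (close : forall a x' y' t, 0 <= t <= l -> traj x' y' -> x' 0 = a -> y' 0 = 0 -> Rabs (a - s) < 1 ->
     Rabs (x' t - x t) <= Rabs (a - s) * exp (L * l) /\ Rabs (y' t - y t) <= Rabs (a - s) * exp (L * l)).
  { intros a x' y' t ht h' hx' hy' ha.
    pose proof (dep x' y' x y 0 t h' h) as d; rewrite hx, hx', hy, hy' in d.
    rewrite (Rminus_0_r t), (Rabs_pos_eq t) in d by lra.
    assert (e1 : exp (L * t) <= exp (L * l) ^ 2).
    { replace (exp (L * l) ^ 2) with (exp (L * l + L * l)) by (rewrite exp_plus; ring).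
      apply exp_le_mono; nra. }
    rewrite <- (pow2_abs (a - s)) in d.
    assert (d2 : (x' t - x t) ^ 2 + (y' t - y t) ^ 2 <= (Rabs (a - s) * exp (L * l)) ^ 2).
    { eapply Rle_trans; [exact d|].
      replace ((Rabs (a - s) * exp (L * l)) ^ 2) with (Rabs (a - s) ^ 2 * exp (L * l) ^ 2) by ring.
      replace (0 - 0) with 0 by ring; replace (Rabs (a - s) ^ 2 + 0 ^ 2) with (Rabs (a - s) ^ 2) by ring.
      apply Rmult_le_compat_l; trivial; apply pow2_ge_0. }
    assert (0 <= Rabs (a - s) * exp (L * l)) by (apply Rmult_le_pos; [apply Rabs_pos | left; apply exp_pos]).
    pose proof (pow2_ge_0 (x' t - x t)); pose proof (pow2_ge_0 (y' t - y t)).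
    split; apply Rabs_le_between; split; nra. }
  pose proof (exp_pos (L * l)) as hE.
  assert (zero : exists t, 0 < t <= l /\ y t = 0).
  { destruct (classic (exists t, 0 < t <= l /\ y t = 0)) as [|no]; trivial; exfalso.
    assert (ypos : forall t, 0 < t <= l -> 0 < y t).
    { intros t ht; destruct (Rlt_dec 0 (y t)) as [|n]; trivial; exfalso.
      destruct (traj_first_zero x y t h) as [t1 [h1 [h2 h3]]]; try lra.
      apply no; exists t1; split; trivial; lra. }
    (* near t = 0 a uniform lower bound on y', away from 0 a lower bound on y *)
    pose (g := (z0 - exp s) / 2).
    assert (hg : 0 < g).
    { unfold g; pose proof (exp_increasing _ _ hs) as i; rewrite exp_ln in i by trivial; lra. }
    destruct truncated_lipschitz as [L' [M' [hL' [_ [lfy _]]]]].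
    assert (cx : continuous x 0) by (eapply is_derive_continuous, h).
    assert (cy : continuous y 0) by (eapply is_derive_continuous, h).
    destruct (continuous_eps x 0 (g / (4 * L'))) as [d1 [hd1 k1]]; trivial; [apply Rdiv_lt_0_compat; lra|].
    destruct (continuous_eps y 0 (g / (4 * L'))) as [d2 [hd2 k2]]; trivial; [apply Rdiv_lt_0_compat; lra|].
    pose (t0 := Rmin l (Rmin d1 d2) / 2).
    assert (ht0 : 0 < t0 /\ t0 < l /\ t0 < d1 /\ t0 < d2) by (unfold t0, Rmin; repeat destruct Rle_dec; lra).
    destruct (continuity_ab_min y t0 l) as [tm [hm hm']]; [lra|intros; apply continuity_pt_filterlim, (traj_y_continuous x); trivial|].
    assert (hym : 0 < y tm) by (apply ypos; lra).
    pose (d := Rmin (ln z0 - s) (Rmin 1 (Rmin (g / (4 * L') / exp (L * l)) (y tm / exp (L * l)))) / 2).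
    assert (0 < g / (4 * L') / exp (L * l)) by (apply Rdiv_lt_0_compat; [apply Rdiv_lt_0_compat; lra | trivial]).
    assert (0 < y tm / exp (L * l)) by (apply Rdiv_lt_0_compat; trivial).
    assert (hd : 0 < d /\ d < ln z0 - s /\ d < 1 /\ d < g / (4 * L') / exp (L * l) /\ d < y tm / exp (L * l)).
    { unfold d, Rmin; repeat destruct Rle_dec; lra. }
    destruct (near d) as [a [ha had]]; [lra|].
    pose proof (lows a ha) as hsa.
    destruct ha as [ha [x' [y' [t [h' [hx' [hy' [ht hyt]]]]]]]].
    assert (habs : Rabs (a - s) < d) by (rewrite Rabs_pos_eq; lra).
    assert (m1 : Rabs (a - s) * exp (L * l) < g / (4 * L')).
    { apply Rlt_le_trans with (g / (4 * L') / exp (L * l) * exp (L * l)); [apply Rmult_lt_compat_r; lra|right; field; lra]. }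
    assert (m2 : Rabs (a - s) * exp (L * l) < y tm).
    { apply Rlt_le_trans with (y tm / exp (L * l) * exp (L * l)); [apply Rmult_lt_compat_r; lra|right; field; lra]. }
    destruct (Rle_dec t0 t) as [c1|c1].
    - destruct (close a x' y' t ltac:(lra) h' hx' hy' ltac:(lra)) as [_ q2].
      specialize (hm t ltac:(lra)); rewrite hyt in q2; apply Rabs_le_between in q2; lra.
    - assert (i : y' 0 < y' t).
      { apply (derive_pos_lt y' (fun t => fy t (x' t) (y' t))); try lra.
        - intros u _; apply h'.
        - intros u _; apply (traj_y_continuous x'); trivial.
        - intros u hu.
          destruct (close a x' y' u ltac:(lra) h' hx' hy' ltac:(lra)) as [q1 q2].
          specialize (k1 u ltac:(apply Rabs_lt_between; lra)); specialize (k2 u ltac:(apply Rabs_lt_between; lra)).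
          rewrite hx in k1; rewrite hy in k2.
          specialize (lfy u (x' u) (y' u) s 0); rewrite fy_axis in lfy by lra.
          apply Rabs_lt_between in k1; apply Rabs_lt_between in k2.
          apply Rabs_le_between in q1; apply Rabs_le_between in q2.
          assert (n1 : Rabs (x' u - s) <= 2 * (g / (4 * L'))) by (apply Rabs_le_between; lra).
          assert (n2 : Rabs (y' u - 0) <= 2 * (g / (4 * L'))) by (apply Rabs_le_between; lra).
          assert (n3 : L' * (Rabs (x' u - s) + Rabs (y' u - 0)) <= g).
          { apply Rle_trans with (L' * (4 * (g / (4 * L')))); [apply Rmult_le_compat_l; lra|right; field; lra]. }
          assert (n4 : Rabs (fy u (x' u) (y' u) - (z0 - exp s)) <= g) by lra.
          apply Rabs_le_between in n4; unfold g in *; lra. }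
      lra. }
  destruct zero as [t [ht hyt]].
  destruct (traj_first_zero x y t h) as [t1 [h1 [h2 h3]]]; try lra.
  exists x, y; split; trivial; split; trivial.
  assert (t1l : t1 = l).
  { destruct (Req_dec t1 l) as [|ne]; trivial; exfalso.
    assert (xM : forall t, 0 <= t <= l -> x t <= Mx).
    { intros r hr; pose proof (traj_x_bound x y r h ltac:(lra)).
      assert (p * Ym * r <= p * Ym * l) by (apply Rmult_le_compat_l; [apply Rmult_le_pos|]; lra).
      unfold Mx; lra. }
    assert (d := proj2 h t1); rewrite h2, fy_axis in d by (apply xM; lra).
    (* Transversality: y' = 0 on the axis would make the orbit the equilibrium by uniqueness, and y'
       > 0 contradicts y > 0 just before [t1]. *)
    assert (sg : z0 - exp (x t1) < 0).
    { destruct (Rtotal_order (z0 - exp (x t1)) 0) as [|[e|e]]; trivial; exfalso.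
      - assert (ex : x t1 = ln z0) by (rewrite <- (ln_exp (x t1)); f_equal; lra).
        destruct (traj_unique x y _ _ t1 h traj_equilibrium ex h2 0); lra.
      - destruct (derive_pos_local y t1 _ d e) as [e' [he' [_ h4]]].
        pose (r := Rmax (t1 / 2) (t1 - e' / 2)).
        assert (0 < r < t1 /\ t1 - e' < r) by (unfold r, Rmax; destruct Rle_dec; lra).
        specialize (h3 r ltac:(lra)); specialize (h4 r ltac:(lra)); lra. }
    assert (d' : is_derive (fun t => - y t) t1 (- (z0 - exp (x t1)))) by (apply (is_derive_opp y); trivial).
    destruct (derive_pos_local _ t1 _ d' ltac:(lra)) as [e [he [h4 _]]].
    pose (t2 := Rmin l (t1 + e / 2)).
    assert (ht2 : t1 < t2 <= l /\ t2 < t1 + e) by (unfold t2, Rmin; destruct Rle_dec; lra).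
    assert (yt2 : y t2 < 0) by (specialize (h4 t2 ltac:(lra)); cbv beta in h4; lra).
    pose (dd := Rmin (1 / 2) (- y t2 / exp (L * l) / 2)).
    assert (0 < - y t2 / exp (L * l)) by (apply Rdiv_lt_0_compat; lra).
    assert (hdd : 0 < dd /\ dd < 1 /\ dd < - y t2 / exp (L * l)) by (unfold dd, Rmin; destruct Rle_dec; lra).
    destruct (traj_exists (s - dd)) as [x' [y' [h' [hx' hy']]]].
    assert (ab : Rabs (s - dd - s) = dd) by (replace (s - dd - s) with (- dd) by ring; rewrite Rabs_Ropp, Rabs_pos_eq; lra).
    destruct (close (s - dd) x' y' t2 ltac:(lra) h' hx' hy' ltac:(lra)) as [_ q2].
    assert (m2 : dd * exp (L * l) < - y t2).
    { apply Rlt_le_trans with (- y t2 / exp (L * l) * exp (L * l)); [apply Rmult_lt_compat_r; lra|right; field; lra]. }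
    rewrite ab in q2; apply Rabs_le_between in q2.
    destruct (traj_first_zero x' y' t2 h') as [t3 [h5 [h6 h7]]]; try lra.
    assert (s <= s - dd); [|lra].
    apply lows; split; [lra|]; exists x', y', t3; repeat split; trivial; try apply h'; lra. }
  subst t1; repeat split; trivial; lra.
Qed.

End Truncated.

(** The critical orbit meets the axis at 0 and at [l]; the reflections in these two times compose to
    the translation by 2 l. By the same symmetry it suffices to check on [0, l] that the cut-offs do
    not act, and there y cannot exceed [Ym] because it decreases above [ys]. *)
Lemma positive_orbit : exists x y : R -> R,
  (forall t, is_derive x t (p * y t)) /\
  (forall t, is_derive y t (- (bet p b (y t) - C + exp (x t)) / dphi p (y t))) /\
  (forall t, x (t + 2 * l) = x t) /\ (forall t, y (t + 2 * l) = y t) /\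
  y 0 = 0 /\ (forall t, 0 < t < l -> 0 < y t) /\ (forall t, l < t < 2 * l -> y t < 0).
Proof.
pose proof shoot_l as hl; pose proof shoot_z0 as hz.
destruct (bet_zero_exists p b hp hb C) as [ys [hys hbys]]; [unfold z0 in hz; lra|].
destruct (critical_traj ys hys) as [x [y [h [hy [hyl [hx pos]]]]]].
pose proof (Ym_pos ys hys) as hY; pose proof (ln_z0_Mx ys hys) as hM.
set (Ym := ys + 1) in *; set (Mx := ln z0 + p * Ym * l) in *.
assert (r0 : forall t, x t = x (- t) /\ y t = - y (- t)).
{ intros t.
  destruct (traj_unique ys hys x y _ _ 0 h (traj_reflect ys hys x y 0 h)) with (t := t) as [e1 e2].
  - f_equal; ring.
  - rewrite Rminus_0_r, hy; ring.
  - rewrite Rminus_0_l in e1, e2; split; trivial. }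
assert (rl : forall t, x t = x (2 * l - t) /\ y t = - y (2 * l - t)).
{ apply (traj_unique ys hys x y _ _ l h (traj_reflect ys hys x y (2 * l) h)).
  - f_equal; ring.
  - replace (2 * l - l) with l by ring; rewrite hyl; ring. }
assert (px : forall t, x (t + 2 * l) = x t).
{ intros t; rewrite (proj1 (r0 t)), (proj1 (rl (t + 2 * l))); f_equal; ring. }
assert (py : forall t, y (t + 2 * l) = y t).
{ intros t; rewrite (proj2 (r0 t)), (proj2 (rl (t + 2 * l))); do 2 f_equal; ring. }
assert (bound0 : forall t, 0 <= t <= l -> 0 <= y t <= Ym /\ x t <= Mx).
{ intros t ht; repeat split.
  - destruct (Req_dec t 0) as [->|]; [lra|]; destruct (Req_dec t l) as [->|]; [lra|].
    left; apply pos; lra.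
  - destruct (Rle_dec (y t) Ym) as [|n]; trivial; exfalso.
    assert (ht' : 0 < t) by (destruct (Req_dec t 0) as [->|]; lra).
    (* last time before t at which y = ys *)
    destruct (first_zero (fun s => y (t - s) - ys) 0 t) as [s1 [h1 [h2 h3]]]; trivial.
    + intros s _; apply cont_minus; [|apply cont_const].
      apply (cont_comp (fun s => t - s) y); [apply cont_minus; [apply cont_const | apply cont_id]|].
      apply (traj_y_continuous ys x); trivial.
    + rewrite Rminus_0_r; unfold Ym in n; lra.
    + rewrite Rminus_diag, hy; lra.
    + assert (i : - y (t - s1) < - y t).
      { apply (derive_pos_lt (fun t => - y t) (fun t => - fy ys t (x t) (y t))); try lra.
        - intros u _; apply (is_derive_opp y), h.
        - intros u _; apply cont_opp, (traj_y_continuous ys x); trivial.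
        - intros u hu; specialize (h3 (t - u) ltac:(lra)); cbv beta in h3.
          replace (t - (t - u)) with u in h3 by ring.
          unfold fy; fold Ym.
          set (v := clamp Ym (y u)).
          assert (hv : ys < v) by (unfold v, clamp, Ym, Rmax, Rmin; repeat destruct Rle_dec; lra).
          pose proof (bet_increasing p b hp hb ys v hys hv).
          pose proof (dphi_pos p hp v).
          assert (0 < inv_dphi v) by (apply Rinv_0_lt_compat; trivial).
          pose proof (exp_pos (Rmin (x u) Mx)).
          unfold drift; fold Mx; nra. }
      cbv beta in h2; unfold Ym in n; lra.
  - pose proof (traj_x_bound ys hys x y t h ltac:(lra)) as i; fold Ym in i.
    assert (p * Ym * t <= p * Ym * l) by (apply Rmult_le_compat_l; [apply Rmult_le_pos|]; lra).
    unfold Mx; lra. }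
assert (bound : forall t, - Ym <= y t <= Ym /\ x t <= Mx).
{ intros t; destruct (shift_into (2 * l) t (- l)) as [k hk]; [lra|].
  rewrite <- (periodic_IZR y (2 * l) k t py), <- (periodic_IZR x (2 * l) k t px).
  set (u := t + IZR k * (2 * l)) in *.
  destruct (Rle_dec 0 u).
  - destruct (bound0 u); [lra|]; split; lra.
  - destruct (bound0 (- u)); [lra|]; destruct (r0 u) as [e1 e2]; rewrite e1, e2; split; lra. }
exists x, y; split; [|split; [|split; [|split; [|split; [|split]]]]]; trivial.
- intros t; replace (p * y t) with (fx ys t (x t) (y t)); [apply h|].
  unfold fx; fold Ym; rewrite clamp_id; trivial; apply bound.
- intros t; replace (- (bet p b (y t) - C + exp (x t)) / dphi p (y t)) with (fy ys t (x t) (y t)); [apply h|].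
  destruct (bound t) as [i1 i2].
  unfold fy, drift, inv_dphi; fold Ym; fold Mx; rewrite clamp_id, Rmin_left by trivial.
  field; apply dphi_ne.
- intros t ht; rewrite (proj2 (rl t)); specialize (pos (2 * l - t) ltac:(lra)); lra.
Qed.

End Shooting.

(** * Polar orbits and their half period *)

Section Polar.

Variables (p b C : R).
Hypotheses (hp : 1 < p) (hb : 0 < b).

(* q + 1 - p and q in terms of b = beta_q *)
Definition mn : R := p / b.
Definition qn : R := p / b + p - 1.
Definition Gam (u : R) : R := u ^ 2 + (p - 1) * (1 - u ^ 2).
Definition Q0 (u : R) : R := (gq p b - b) * u - C * sp (p - 1) u.
(* In w = rho sin a, w' = b rho cos a, with u = sin a and V = b^(1-p) rho^m:
   a' = Th / Gam and (ln rho)' = - cos a Qf / Gam. *)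
Definition Qf (u V : R) : R := Q0 u + V * sp qn u.
Definition Th (u V : R) : R := b * Gam u + u * Qf u V.
(** The part of [Th] that comes from the homogeneous terms, without |w|^(q-1) w; it governs orbits
    of small amplitude. For u in [0, 1] it equals (p-1) b + (p-2) u^2 - C u^p. *)
Definition Jf (u : R) : R := Th u 0.

Definition gam_min : R := Rmin 1 (p - 1).
Definition gam_max : R := p.
Definition cQ : R := Rabs (gq p b - b) + Rabs C + 1.
Definition cJ : R := 2 * b * p + 2 * Rabs (gq p b - b) + Rabs C * p + 1.

Lemma mn_pos : 0 < mn.
Proof. apply Rdiv_lt_0_compat; lra. Qed.
Lemma qn_mn : qn + 1 - mn = p.
Proof. unfold qn, mn; ring. Qed.
Lemma mn_b : mn * b = p.
Proof. unfold mn; field; lra. Qed.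
Lemma qn_pos : 0 < qn.
Proof. pose proof mn_pos; unfold qn, mn in *; lra. Qed.
Lemma gam_min_pos : 0 < gam_min.
Proof. apply Rmin_pos; lra. Qed.

Lemma abs_le_1_sq (u : R) : Rabs u <= 1 -> 0 <= u ^ 2 <= 1.
Proof. intros h; apply Rabs_le_between in h; split; nra. Qed.

Lemma Gam_ge (u : R) : Rabs u <= 1 -> gam_min <= Gam u.
Proof.
intros h; apply abs_le_1_sq in h; unfold Gam, gam_min.
pose proof (Rmin_l 1 (p - 1)); pose proof (Rmin_r 1 (p - 1)); nra.
Qed.
Lemma Gam_le (u : R) : Rabs u <= 1 -> Gam u <= gam_max.
Proof. intros h; apply abs_le_1_sq in h; unfold Gam, gam_max; nra. Qed.
Lemma Gam_pos (u : R) : Rabs u <= 1 -> 0 < Gam u.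
Proof. intros h; pose proof (Gam_ge u h); pose proof gam_min_pos; lra. Qed.

Lemma Gam_opp (u : R) : Gam (- u) = Gam u.
Proof. unfold Gam; ring. Qed.
Lemma Qf_opp (u V : R) : Qf (- u) V = - Qf u V.
Proof. unfold Qf, Q0; rewrite !sp_opp; ring. Qed.
Lemma Th_opp (u V : R) : Th (- u) V = Th u V.
Proof. unfold Th; rewrite Gam_opp, Qf_opp; ring. Qed.
Lemma Th_Jf (u V : R) : Th u V = Jf u + V * (u * sp qn u).
Proof. unfold Jf, Th, Qf; ring. Qed.
Lemma Jf_0 : Jf 0 = b * (p - 1).
Proof. unfold Jf, Th, Gam; ring. Qed.
Lemma Jf_1 : Jf 1 = gq p b - C.
Proof.
unfold Jf, Th, Gam, Qf, Q0; rewrite sp_pos by lra.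
unfold Rpower; rewrite ln_1, Rmult_0_r, exp_0; ring.
Qed.

Lemma Gam_continuous (u : R) : continuous Gam u.
Proof.
apply cont_plus; [apply cont_sq|]; apply cont_mult; [apply cont_const|].
apply cont_minus; [apply cont_const | apply cont_sq].
Qed.
Lemma Q0_continuous (u : R) : continuous Q0 u.
Proof.
apply cont_minus; (apply cont_mult; [apply cont_const|]); [apply cont_id | apply sp_continuous; lra].
Qed.
Lemma Qf_continuous (V : R -> R) (f : R -> R) (u : R) : continuous f u -> continuous V u -> continuous (fun u => Qf (f u) (V u)) u.
Proof.
intros hf hV; apply cont_plus.
- apply (cont_comp f Q0); trivial; apply Q0_continuous.
- apply cont_mult; trivial; apply (cont_comp f (sp qn)); trivial; apply sp_continuous, qn_pos.
Qed.
Lemma Th_continuous (V : R -> R) (f : R -> R) (u : R) : continuous f u -> continuous V u -> continuous (fun u => Th (f u) (V u)) u.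
Proof.
intros hf hV; apply cont_plus.
- apply cont_mult; [apply cont_const | apply (cont_comp f Gam); trivial; apply Gam_continuous].
- apply cont_mult; trivial; apply Qf_continuous; trivial.
Qed.
Lemma Jf_continuous (u : R) : continuous Jf u.
Proof. apply (Th_continuous (fun _ => 0) (fun u => u)); [apply cont_id | apply cont_const]. Qed.

Lemma cQ_pos : 0 < cQ.
Proof. unfold cQ; pose proof (Rabs_pos (gq p b - b)); pose proof (Rabs_pos C); lra. Qed.

Lemma Q0_bound (u : R) : Rabs u <= 1 -> Rabs (Q0 u) <= cQ.
Proof.
intros h; unfold Q0, cQ; eapply Rle_trans; [apply Rabs_triang|].
rewrite Rabs_Ropp, !Rabs_mult.
pose proof (sp_le_1 (p - 1) u ltac:(lra) h).
pose proof (Rabs_pos (gq p b - b)); pose proof (Rabs_pos C); pose proof (Rabs_pos u); pose proof (Rabs_pos (sp (p - 1) u)).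
nra.
Qed.

Lemma Qf_lower (u V : R) : 0 <= u <= 1 -> 0 <= V -> - cQ <= Qf u V.
Proof.
intros hu hV; pose proof (Q0_bound u ltac:(rewrite Rabs_pos_eq; lra)) as h.
apply Rabs_le_between in h; pose proof (sp_nonneg qn u ltac:(lra)); unfold Qf; nra.
Qed.

Lemma Th_ge_Jf (u V : R) : 0 <= V -> Jf u <= Th u V.
Proof. intros h; rewrite Th_Jf; pose proof (mul_sp_nonneg qn u); nra. Qed.

Lemma cJ_pos : 0 < cJ.
Proof.
unfold cJ; pose proof (Rabs_pos (gq p b - b)); pose proof (Rabs_pos C).
assert (0 < 2 * b * p) by nra; assert (0 <= Rabs C * p) by nra; lra.
Qed.

Definition dJ (u : R) : R :=
  b * (2 * u - (p - 1) * (2 * u)) + 2 * (gq p b - b) * u - C * (p * Rpower u (p - 1)).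

Lemma is_derive_Jf (u : R) : 0 < u -> is_derive Jf u (dJ u).
Proof.
intros hu.
apply is_derive_ext_loc with (fun u => b * Gam u + (gq p b - b) * u ^ 2 - C * Rpower u p).
- exists (mkposreal u hu); intros t ht; apply Rabs_lt_between in ht; simpl in ht.
  change (t - u) with (t - u) in ht.
  assert (0 < t) by (unfold minus, plus, opp in ht; simpl in ht; lra).
  unfold Jf, Th, Qf, Q0; rewrite sp_pos by trivial.
  replace (Rpower t p) with (Rpower t (p - 1) * t) by (rewrite <- Rpower_succ by trivial; f_equal; ring).
  simpl; ring.
- assert (d1 : is_derive (fun u => b * Gam u + (gq p b - b) * u ^ 2) u (b * (2 * u - (p - 1) * (2 * u)) + 2 * (gq p b - b) * u)).
  { unfold Gam; auto_derive; trivial; ring. }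
  assert (d2 : is_derive (fun u => C * Rpower u p) u (C * (p * Rpower u (p - 1)))).
  { apply (is_derive_scal (fun u => Rpower u p)).
    apply is_derive_Reals, derivable_pt_lim_power; trivial. }
  exact (is_derive_minus _ _ u _ _ d1 d2).
Qed.

Lemma dJ_bound (u : R) : 0 < u <= 1 -> Rabs (dJ u) <= cJ.
Proof.
intros hu; unfold dJ, cJ.
assert (h1 : Rabs (b * (2 * u - (p - 1) * (2 * u))) <= 2 * b * p).
{ rewrite Rabs_mult, (Rabs_pos_eq b) by lra.
  assert (Rabs (2 * u - (p - 1) * (2 * u)) <= 2 * p) by (apply Rabs_le_between; split; nra).
  replace (2 * b * p) with (b * (2 * p)) by ring; apply Rmult_le_compat_l; lra. }
assert (h2 : Rabs (2 * (gq p b - b) * u) <= 2 * Rabs (gq p b - b)).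
{ rewrite !Rabs_mult, (Rabs_pos_eq 2), (Rabs_pos_eq u) by lra; pose proof (Rabs_pos (gq p b - b)); nra. }
assert (h3 : Rabs (C * (p * Rpower u (p - 1))) <= Rabs C * p).
{ pose proof (Rpower_le_1 u (p - 1) hu ltac:(lra)); pose proof (Rpower_gt0 u (p - 1)).
  rewrite Rabs_mult, (Rabs_pos_eq (p * _)) by nra; apply Rmult_le_compat_l; [apply Rabs_pos|nra]. }
unfold Rminus at 1; eapply Rle_trans; [apply Rabs_triang|]; rewrite Rabs_Ropp.
pose proof (Rabs_triang (b * (2 * u - (p - 1) * (2 * u))) (2 * (gq p b - b) * u)); lra.
Qed.

Lemma Jf_near_0 : exists u0, 0 < u0 <= 1 /\ forall u, 0 <= u <= u0 -> b * (p - 1) / 2 <= Jf u.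
Proof.
assert (0 < b * (p - 1)) by nra.
destruct (continuous_eps Jf 0 (b * (p - 1) / 2) (Jf_continuous 0)) as [d [hd h]]; [lra|].
exists (Rmin 1 (d / 2)); split; [unfold Rmin; destruct Rle_dec; lra|].
intros u hu; assert (u <= d / 2) by (pose proof (Rmin_r 1 (d / 2)); lra).
specialize (h u ltac:(apply Rabs_lt_between; lra)); rewrite Jf_0 in h; apply Rabs_lt_between in h; lra.
Qed.

(** With y = sqrt (1 - u^2) / u, the cotangent of the angle, 1 + y^2 = u^(-2) and Jf u = u^p (bet y
    - C). The claim is then the minimality of [bet] at 0. *)
Lemma Jf_ge (u : R) : C < gq p b -> 0 <= u <= 1 -> (gq p b - C) * (u * sp (p - 1) u) <= Jf u.
Proof.
intros hC hu; destruct (Req_dec u 0) as [->|hu0].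
- rewrite Jf_0; assert (0 < b * (p - 1)) by nra; nra.
- assert (up : 0 < u) by lra.
  pose (y := sqrt (1 - u ^ 2) / u).
  assert (hy : 1 + y ^ 2 = / u ^ 2).
  { unfold y; unfold Rdiv; rewrite Rpow_mult_distr, pow2_sqrt by nra; field; lra. }
  assert (pwE : forall e, pw e y = Rpower u (- (2 * e))).
  { intros e; unfold pw; rewrite hy.
    rewrite <- (Rpower_pow 2) by trivial; rewrite <- Rpower_Ropp, Rpower_mult; f_equal; simpl; ring. }
  pose proof (bet_ge p b hp hb y) as hg; unfold bet in hg; rewrite !pwE in hg.
  replace (- (2 * (p / 2))) with (- p) in hg by field.
  replace (- (2 * ((p - 2) / 2))) with (- p + 2) in hg by field.
  rewrite (Rpower_plus (- p)) in hg.
  replace (Rpower u 2) with (u ^ 2) in hg by (rewrite <- Rpower_pow by trivial; f_equal).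
  apply (Rmult_le_compat_l (Rpower u p)) in hg; [|left; apply Rpower_gt0].
  assert (e : Rpower u p * Rpower u (- p) = 1).
  { rewrite <- Rpower_plus, Rplus_opp_r; apply Rpower_O; trivial. }
  replace (Rpower u p * ((p - 1) * b * Rpower u (- p) + (p - 2) * (Rpower u (- p) * u ^ 2))) with
    (Rpower u p * Rpower u (- p) * ((p - 1) * b + (p - 2) * u ^ 2)) in hg by ring.
  rewrite e in hg.
  unfold Jf, Th, Qf, Q0, Gam; rewrite sp_pos by trivial.
  assert (e2 : Rpower u p = Rpower u (p - 1) * u) by (rewrite <- Rpower_succ by trivial; f_equal; ring).
  rewrite e2 in hg; unfold gq in *; nra.
Qed.

Lemma Jf_min : C < gq p b -> exists e, 0 < e /\ forall u, 0 <= u <= 1 -> e <= Jf u.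
Proof.
intros hC.
destruct (continuity_ab_min Jf 0 1) as [um [h1 h2]]; [lra|intros; apply continuity_pt_filterlim, Jf_continuous|].
exists (Jf um); split; trivial.
destruct (Req_dec um 0) as [->|n].
- rewrite Jf_0; nra.
- pose proof (Jf_ge um hC h2).
  assert (0 < um * sp (p - 1) um) by (apply Rmult_lt_0_compat; [lra | apply sp_gt0; lra]); nra.
Qed.

(** Positivity of [Th] says that the angle increases with time, so the angle can serve as a
    parameter. Evenness makes X (sin a) a function of period PI in the angle. *)
Definition orbit (x1 : R) (X : R -> R) : Prop :=
  X 0 = x1 /\ (forall u, Rabs u <= 1 -> X (- u) = X u) /\
  (forall u, Rabs u <= 1 -> is_derive X u (- mn * Qf u (exp (X u)) / Th u (exp (X u)))) /\
  (forall u, Rabs u <= 1 -> 0 < Th u (exp (X u))).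

(** * Existence of orbits on the whole of [-1, 1] *)

Section Existence.

Variables (x1 eps : R).
Hypothesis heps : 0 < eps.

Let Mx := x1 + mn * cQ / eps.

(* The orbit equation with Th bounded away from 0 and V bounded above. *)
Definition FX (u X : R) : R :=
  - mn * Qf (clamp 1 u) (exp (Rmin X Mx)) / Rmax (Th (clamp 1 u) (exp (Rmin X Mx))) eps.

Lemma clamp_abs (u : R) : Rabs (clamp 1 u) <= 1.
Proof. apply Rabs_le, clamp_range; lra. Qed.

Lemma Rmax_lip (a a' e : R) : Rabs (Rmax a e - Rmax a' e) <= Rabs (a - a').
Proof. unfold Rmax, Rabs; repeat destruct Rle_dec; repeat destruct Rcase_abs; lra. Qed.

Lemma FX_lipschitz : exists L M, 0 < L /\ lipschitz_field L M (fun t x y => FX t x).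
Proof.
pose proof mn_pos as hm; pose proof cQ_pos as hq; pose proof (exp_pos Mx) as hM.
set (E := exp Mx) in *; set (B := cQ + E).
assert (hB : 0 < B) by (unfold B; lra).
assert (QB : forall u X, Rabs (Qf (clamp 1 u) (exp (Rmin X Mx))) <= B).
{ intros u X; unfold Qf; eapply Rle_trans; [apply Rabs_triang|].
  pose proof (Q0_bound _ (clamp_abs u)); unfold B; apply Rplus_le_compat; trivial.
  rewrite Rabs_mult, (Rabs_pos_eq (exp _)) by (left; apply exp_pos).
  pose proof (sp_le_1 qn _ qn_pos (clamp_abs u)); pose proof (exp_le_mono _ _ (Rmin_r X Mx)).
  pose proof (exp_pos (Rmin X Mx)); pose proof (Rabs_pos (sp qn (clamp 1 u))); fold E in H1; nra. }
assert (mx : forall a, eps <= Rmax a eps) by (intros; apply Rmax_r).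
pose (L := mn * (E / eps + B * E / eps ^ 2)).
assert (h1 : 0 < E / eps) by (apply Rdiv_lt_0_compat; trivial).
assert (h2 : 0 < B * E / eps ^ 2) by (apply Rdiv_lt_0_compat; [apply Rmult_lt_0_compat; trivial | apply pow_lt; trivial]).
exists L, (mn * B / eps); split; [apply Rmult_lt_0_compat; lra|].
split; [|split].
- intros u X y0 X' y0'; cbv beta; unfold FX.
  set (V := exp (Rmin X Mx)); set (V' := exp (Rmin X' Mx)); set (w := clamp 1 u).
  assert (hV : Rabs (V - V') <= E * Rabs (X - X')) by apply exp_min_lip.
  assert (dQ : Rabs (Qf w V - Qf w V') <= Rabs (V - V')).
  { unfold Qf; replace (Q0 w + V * sp qn w - (Q0 w + V' * sp qn w)) with ((V - V') * sp qn w) by ring.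
    rewrite Rabs_mult; pose proof (sp_le_1 qn w qn_pos (clamp_abs u)); pose proof (Rabs_pos (V - V')); nra. }
  assert (dT : Rabs (Th w V - Th w V') <= Rabs (V - V')).
  { rewrite !Th_Jf; replace (Jf w + V * (w * sp qn w) - (Jf w + V' * (w * sp qn w))) with ((V - V') * (w * sp qn w)) by ring.
    rewrite !Rabs_mult; pose proof (sp_le_1 qn w qn_pos (clamp_abs u)); pose proof (clamp_abs u) as hw; fold w in hw.
    pose proof (Rabs_pos (V - V')); pose proof (Rabs_pos w); pose proof (Rabs_pos (sp qn w)).
    assert (Rabs w * Rabs (sp qn w) <= 1) by nra; nra. }
  pose proof (Rmax_lip (Th w V) (Th w V') eps) as dm.
  pose proof (mx (Th w V)) as m1; pose proof (mx (Th w V')) as m2.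
  set (D := Rmax (Th w V) eps) in *; set (D' := Rmax (Th w V') eps) in *.
  assert (b' : Rabs (Qf w V') <= B) by apply QB.
  replace (- mn * Qf w V / D - - mn * Qf w V' / D') with
    (- (mn * ((Qf w V - Qf w V') * / D + Qf w V' * ((D' - D) * / (D * D'))))) by (field; lra).
  rewrite Rabs_Ropp, Rabs_mult, (Rabs_pos_eq mn) by lra.
  apply Rle_trans with (mn * (E / eps + B * E / eps ^ 2) * Rabs (X - X')).
  + rewrite Rmult_assoc; apply Rmult_le_compat_l; [lra|].
    eapply Rle_trans; [apply Rabs_triang|]; rewrite !Rabs_mult.
    assert (i1 : Rabs (/ D) <= / eps).
    { rewrite Rabs_inv, Rabs_pos_eq by lra; apply Rinv_le_contravar; lra. }
    assert (i2 : Rabs (/ (D * D')) <= / eps ^ 2).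
    { rewrite Rabs_inv, Rabs_pos_eq by nra; apply Rinv_le_contravar; [apply pow_lt; trivial | nra]. }
    rewrite (Rabs_minus_sym D' D).
    pose proof (Rabs_pos (X - X')).
    assert (s1 : Rabs (Qf w V - Qf w V') * Rabs (/ D) <= (E * Rabs (X - X')) * / eps).
    { apply Rmult_le_compat; trivial; try apply Rabs_pos; lra. }
    assert (s2 : Rabs (Qf w V') * (Rabs (D - D') * Rabs (/ (D * D'))) <= B * ((E * Rabs (X - X')) * / eps ^ 2)).
    { apply Rmult_le_compat; trivial; try apply Rabs_pos.
      - apply Rmult_le_pos; apply Rabs_pos.
      - apply Rmult_le_compat; trivial; try apply Rabs_pos; lra. }
    unfold Rdiv; lra.
  + fold L; apply Rmult_le_compat_l; [left; apply Rmult_lt_0_compat; lra|].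
    match goal with |- _ <= _ + Rabs ?z => pose proof (Rabs_pos z) end; lra.
- intros u X y0; cbv beta; unfold FX, Rdiv; rewrite !Rabs_mult, Rabs_Ropp, (Rabs_pos_eq mn) by lra.
  apply Rmult_le_compat.
  + apply Rmult_le_pos; [lra | apply Rabs_pos].
  + apply Rabs_pos.
  + apply Rmult_le_compat_l; [lra | apply QB].
  + rewrite Rabs_inv, Rabs_pos_eq by (pose proof (mx (Th (clamp 1 u) (exp (Rmin X Mx)))); lra).
    apply Rinv_le_contravar; trivial.
- intros X Y cX cY t; unfold FX.
  assert (c1 : continuous (fun s => clamp 1 s) t) by (apply clamp_continuous, cont_id).
  assert (c2 : continuous (fun s => exp (Rmin (X s) Mx)) t) by (apply exp_min_continuous; trivial).
  apply cont_div.
  + apply cont_mult; [apply cont_const|].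
    apply (Qf_continuous (fun s => exp (Rmin (X s) Mx)) (clamp 1)); trivial.
  + apply (cont_Rmax (fun s => Th (clamp 1 s) (exp (Rmin (X s) Mx))) (fun _ => eps)); [|apply cont_const].
    apply (Th_continuous (fun s => exp (Rmin (X s) Mx)) (clamp 1)); trivial.
  + pose proof (mx (Th (clamp 1 t) (exp (Rmin (X t) Mx)))); lra.
Qed.

(** [FX] is odd in u, so X (- u) solves the same equation with the same value at 0, and Gronwall
    identifies it with X u. *)
Lemma FX_solution : exists X : R -> R, X 0 = x1 /\ (forall u, is_derive X u (FX u (X u))) /\ forall u, X (- u) = X u.
Proof.
destruct FX_lipschitz as [L [M [hL hF]]].
(* The scalar equation is entered as two identical uncoupled components. *)
destruct (picard_existence (fun t x y => FX t x) (fun t x y => FX t x) L M x1 x1 hL hF hF) as [X [_ [e [_ [d _]]]]].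
exists X; split; [trivial|split; [trivial|]].
assert (odd : forall u x, FX (- u) x = - FX u x).
{ intros u x; unfold FX; rewrite clamp_opp, Qf_opp, Th_opp by lra; unfold Rdiv; ring. }
assert (pos : forall u, 0 <= u -> X (- u) = X u).
{ intros u hu.
  pose (N := fun t => (X (- t) - X t) ^ 2).
  assert (dr : forall t, is_derive (fun t => X (- t)) t (FX t (X (- t)))).
  { intros t; replace (FX t (X (- t))) with (-1 * FX (- t) (X (- t))) by (rewrite odd; ring).
    apply (is_derive_comp X Ropp); [apply d|].
    apply is_derive_ext with (fun t => -1 * t); [intros; simpl; ring|]; auto_derive; trivial; ring. }
  pose (dN := fun t => 2 * (X (- t) - X t) * (FX t (X (- t)) - FX t (X t))).
  assert (hN : forall t, is_derive N t (dN t)).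
  { intros t; replace (dN t) with (INR 2 * (FX t (X (- t)) - FX t (X t)) * (X (- t) - X t) ^ pred 2) by (unfold dN; simpl; ring).
    apply (is_derive_pow (fun t => X (- t) - X t)), (is_derive_minus (fun t => X (- t)) X); trivial. }
  destruct (gronwall N dN (2 * L) 0 u hu) as [g _].
  - intros; apply hN.
  - intros; eapply is_derive_continuous, hN.
  - intros t _; unfold dN, N; destruct hF as [hF _]; specialize (hF t (X (- t)) 0 (X t) 0).
    rewrite Rminus_diag, Rabs_R0, Rplus_0_r in hF.
    rewrite !Rabs_mult, (Rabs_pos_eq 2), <- (pow2_abs (X (- t) - X t)) by lra.
    pose proof (Rabs_pos (X (- t) - X t)); nra.
  - unfold N in g; rewrite Ropp_0, Rminus_diag in g.
    replace (0 ^ 2 * exp (2 * L * (u - 0))) with 0 in g by ring.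
    apply Rminus_diag_uniq, Rsqr_0_uniq; unfold Rsqr; pose proof (pow2_ge_0 (X (- u) - X u)); nra. }
intros u; destruct (Rle_dec 0 u); [apply pos; trivial|].
symmetry; rewrite <- (Ropp_involutive u) at 1; apply pos; lra.
Qed.

End Existence.

Lemma barrier_d0 : 0 < b * (p - 1) / 2.
Proof. assert (0 < b * (p - 1)) by nra; lra. Qed.

Section Barrier.

Variables (x1 eps u0 : R) (X : R -> R).
(** On [0, u0] the number [d0] bounds Th from below, [c1] bounds the rise of X and [c2] its fall;
    [w0] is the resulting lower bound for V u^(q+1) at u0, which persists up to 1. None of them
    involves [eps], which can therefore be chosen afterwards. *)
Let d0 := b * (p - 1) / 2.
Let c1 := mn * cQ / d0.
Let c2 := mn * (cQ + exp (x1 + c1)) / d0.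
Let w0 := exp (x1 - c2) * (u0 * sp qn u0).
Hypotheses (hu0 : 0 < u0 <= 1) (hJ : forall u, 0 <= u <= u0 -> d0 <= Jf u).
Hypotheses (heps : 0 < eps) (hepsd : eps < d0) (hepsw : eps * cJ < w0 * (p * gam_min)).
Hypotheses (hX0 : X 0 = x1) (hX : forall u, is_derive X u (FX x1 eps u (X u))).

Let Mx := x1 + mn * cQ / eps.

Lemma X_cont (u : R) : continuous X u.
Proof. eapply is_derive_continuous, hX. Qed.

Lemma mono_bound (a u d : R) : a <= u -> (forall t, a < t < u -> FX x1 eps t (X t) <= d) ->
  X u <= X a + d * (u - a).
Proof.
intros hau h.
assert (- (X a - d * a) <= - (X u - d * u)); [|lra].
apply (derive_nonneg_le (fun t => - (X t - d * t)) (fun t => - (FX x1 eps t (X t) - d))); trivial.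
- intros t _; apply (is_derive_opp (fun t => X t - d * t)), (is_derive_minus X (fun t => d * t)); [apply hX|].
  auto_derive; trivial; ring.
- intros t _; apply cont_opp, cont_minus; [apply X_cont | apply cont_mult; [apply cont_const | apply cont_id]].
- intros t ht; specialize (h t ht); lra.
Qed.

Lemma mono_bound_lower (a u d : R) : a <= u -> (forall t, a < t < u -> - d <= FX x1 eps t (X t)) ->
  X a - d * (u - a) <= X u.
Proof.
intros hau h.
assert (X a + d * a <= X u + d * u); [|lra].
apply (derive_nonneg_le (fun t => X t + d * t) (fun t => FX x1 eps t (X t) + d)); trivial.
- intros t _; apply (is_derive_plus X (fun t => d * t)); [apply hX|].
  auto_derive; trivial; ring.
- intros t _; apply cont_plus; [apply X_cont | apply cont_mult; [apply cont_const | apply cont_id]].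
- intros t ht; specialize (h t ht); lra.
Qed.

Lemma frac_bound (a B D e : R) : 0 <= B -> - B <= a -> 0 < e <= D -> - mn * a / D <= mn * B / e.
Proof.
intros hB ha hD; pose proof mn_pos.
replace (- mn * a / D) with (mn * (- a * / D)) by (field; lra).
unfold Rdiv; rewrite Rmult_assoc; apply Rmult_le_compat_l; [lra|].
assert (0 < / D) by (apply Rinv_0_lt_compat; lra).
assert (/ D <= / e) by (apply Rinv_le_contravar; lra).
apply Rle_trans with (B * / D); [apply Rmult_le_compat_r; lra | apply Rmult_le_compat_l; lra].
Qed.

Lemma frac_bound_lower (a B D e : R) : 0 <= B -> a <= B -> 0 < e <= D -> - (mn * B / e) <= - mn * a / D.
Proof.
intros hB ha hD; pose proof (frac_bound (- a) B D e hB ltac:(lra) hD).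
replace (- mn * a / D) with (- (- mn * - a / D)) by (field; lra); lra.
Qed.

Lemma X_le_Mx (u : R) : 0 <= u <= 1 -> X u <= Mx.
Proof.
intros hu; pose proof (mono_bound 0 u (mn * cQ / eps) (proj1 hu)) as h; rewrite hX0 in h.
pose proof mn_pos; pose proof cQ_pos.
assert (0 <= mn * cQ / eps) by (apply Rdiv_le_0_compat; nra).
unfold Mx; apply Rle_trans with (x1 + mn * cQ / eps * (u - 0)); [apply h|nra].
intros t ht; unfold FX; rewrite clamp_id by lra; apply frac_bound; try lra.
- apply Qf_lower; [lra | left; apply exp_pos].
- split; [trivial | apply Rmax_r].
Qed.

Lemma FX_eq (u : R) : 0 <= u <= 1 -> FX x1 eps u (X u) = - mn * Qf u (exp (X u)) / Rmax (Th u (exp (X u))) eps.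
Proof. intros hu; unfold FX; fold Mx; rewrite clamp_id, Rmin_left; trivial; [apply X_le_Mx; trivial | lra]. Qed.

Lemma X_u0 : x1 - c2 <= X u0.
Proof.
pose proof barrier_d0 as hd0; fold d0 in hd0; pose proof mn_pos; pose proof cQ_pos.
assert (hT : forall u, 0 <= u <= u0 -> d0 <= Rmax (Th u (exp (X u))) eps).
{ intros u hu; apply Rle_trans with (Jf u); [apply hJ; trivial|].
  apply Rle_trans with (Th u (exp (X u))); [apply Th_ge_Jf; left; apply exp_pos | apply Rmax_l]. }
assert (up : forall u, 0 <= u <= u0 -> X u <= x1 + c1).
{ intros u hu; pose proof (mono_bound 0 u c1 (proj1 hu)) as h; rewrite hX0 in h.
  assert (0 <= c1) by (apply Rdiv_le_0_compat; nra).
  apply Rle_trans with (x1 + c1 * (u - 0)); [apply h|nra].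
  intros t ht; rewrite FX_eq by lra; apply frac_bound; try lra.
  - apply Qf_lower; [lra | left; apply exp_pos].
  - split; [trivial | apply hT; lra]. }
pose proof (exp_pos (x1 + c1)) as he.
assert (0 <= c2) by (apply Rdiv_le_0_compat; nra).
rewrite <- hX0; apply Rle_trans with (X 0 - c2 * (u0 - 0)); [nra|].
apply mono_bound_lower; [lra|].
intros t ht; rewrite FX_eq by lra; apply frac_bound_lower; try lra.
- unfold Qf; pose proof (Q0_bound t ltac:(rewrite Rabs_pos_eq; lra)) as hq; apply Rabs_le_between in hq.
  pose proof (sp_le_1 qn t qn_pos ltac:(rewrite Rabs_pos_eq; lra)) as hs; apply Rabs_le_between in hs.
  pose proof (sp_nonneg qn t ltac:(lra)).
  pose proof (exp_le_mono _ _ (up t ltac:(lra))); pose proof (exp_pos (X t)); nra.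
- split; [trivial | apply hT; lra].
Qed.

Let Z u := exp (X u) * Rpower u (qn + 1).

Lemma Z_derive (u : R) : 0 < u <= 1 ->
  is_derive Z u (Z u * ((qn + 1) / u - mn * Qf u (exp (X u)) / Rmax (Th u (exp (X u))) eps)).
Proof.
intros hu.
assert (d1 : is_derive (fun u => exp (X u)) u (FX x1 eps u (X u) * exp (X u))).
{ apply (is_derive_comp exp X); [apply is_derive_exp | apply hX]. }
assert (d2 : is_derive (fun u => Rpower u (qn + 1)) u ((qn + 1) * Rpower u (qn + 1 - 1))).
{ apply is_derive_Reals, derivable_pt_lim_power; lra. }
pose proof (is_derive_mult _ _ u _ _ d1 d2 Rmult_comm) as d.
match type of d with is_derive _ _ ?v => replace (Z u * _) with v end; [exact d|].
unfold plus, mult, Z; simpl; rewrite FX_eq by lra.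
assert (e : Rpower u (qn + 1) = Rpower u (qn + 1 - 1) * u) by (rewrite <- Rpower_succ by lra; f_equal; ring).
pose proof (Rmax_r (Th u (exp (X u))) eps).
rewrite e; field; lra.
Qed.

Lemma Z_Th (u : R) : 0 < u <= 1 -> Th u (exp (X u)) = Jf u + Z u.
Proof.
intros hu; rewrite Th_Jf, sp_pos, (Rmult_comm u), <- Rpower_succ by lra; trivial.
Qed.

(** The logarithmic derivative of Z is p / u + m (1 / u - Qf / D) with D = max (Th, eps). It is
    positive since u Qf = Th - b Gam <= D, whether or not the cut-off acts. *)
Lemma Z_ge (u : R) : u0 <= u <= 1 -> w0 <= Z u.
Proof.
intros hu; apply Rle_trans with (Z u0).
- unfold w0, Z; rewrite sp_pos, (Rmult_comm u0), <- Rpower_succ by lra.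
  apply Rmult_le_compat_r; [left; apply Rpower_gt0 | apply exp_le_mono, X_u0].
- apply (derive_nonneg_le Z (fun u => Z u * ((qn + 1) / u - mn * Qf u (exp (X u)) / Rmax (Th u (exp (X u))) eps))); try lra.
  + intros t ht; apply Z_derive; lra.
  + intros t ht; eapply is_derive_continuous, Z_derive; lra.
  + intros t ht; apply Rmult_le_pos; [left; apply Rmult_lt_0_compat; [apply exp_pos | apply Rpower_gt0]|].
    pose proof mn_pos; pose proof qn_mn.
    set (V := exp (X t)); set (D := Rmax (Th t V) eps).
    assert (hD : 0 < D) by (unfold D; pose proof (Rmax_r (Th t V) eps); lra).
    assert (h : Qf t V / D <= / t).
    { apply (Rmult_le_reg_r D); trivial; unfold Rdiv; rewrite Rmult_assoc, Rinv_l, Rmult_1_r by lra.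
      apply (Rmult_le_reg_l t); [lra|]; rewrite <- Rmult_assoc, Rinv_r, Rmult_1_l by lra.
      pose proof (Gam_pos t ltac:(rewrite Rabs_pos_eq; lra)).
      apply Rle_trans with (Th t V); [unfold Th; nra | apply Rmax_l]. }
    replace ((qn + 1) / t - mn * Qf t V / D) with (p * / t + mn * (/ t - Qf t V / D)) by
      (rewrite <- qn_mn; field; lra).
    assert (0 < / t) by (apply Rinv_0_lt_compat; lra).
    assert (0 <= mn * (/ t - Qf t V / D)) by (apply Rmult_le_pos; lra); nra.
Qed.

(* Where Th = eps, the derivative of the nondecreasing term V u^(q+1) is of order
   w0 / eps and dominates |J'|, so Th cannot decrease through eps. *)
Lemma barrier (u : R) : 0 <= u <= 1 -> eps < Th u (exp (X u)).
Proof.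
intros hu.
assert (hT0 : forall u, 0 <= u <= u0 -> d0 <= Th u (exp (X u))).
{ intros t ht; apply Rle_trans with (Jf t); [apply hJ; trivial | apply Th_ge_Jf; left; apply exp_pos]. }
destruct (Rle_dec u u0) as [|n]; [specialize (hT0 u ltac:(lra)); lra|].
destruct (Rlt_dec eps (Th u (exp (X u)))) as [|k]; trivial; exfalso.
destruct (first_zero (fun u => Th u (exp (X u)) - eps) u0 u) as [t [h1 [h2 h3]]].
- lra.
- intros s _; apply cont_minus; [|apply cont_const].
  apply (Th_continuous (fun s => exp (X s)) (fun s => s)); [apply cont_id|].
  apply (cont_comp X exp); [apply X_cont | eapply is_derive_continuous, is_derive_exp].
- specialize (hT0 u0 ltac:(lra)); lra.
- lra.
- pose proof (Z_ge t ltac:(lra)) as hz.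
  pose proof (Z_derive t ltac:(lra)) as dz.
  pose proof (is_derive_plus Jf Z t _ _ (is_derive_Jf t ltac:(lra)) dz) as d.
  assert (e : Th t (exp (X t)) = eps) by lra.
  rewrite e, Rmax_left in d by lra.
  pose proof gam_min_pos as hg; pose proof (Gam_ge t ltac:(rewrite Rabs_pos_eq; lra)) as hG; pose proof cJ_pos.
  pose proof (dJ_bound t ltac:(lra)) as hdJ; apply Rabs_le_between in hdJ.
  assert (hq : t * Qf t (exp (X t)) = eps - b * Gam t) by (unfold Th in e; lra).
  (* Th = eps means t Qf = eps - b Gam; the simplification then uses q + 1 - m = p and m b = p. *)
  assert (e2 : (qn + 1) / t - mn * Qf t (exp (X t)) / eps = / t * (p + p * Gam t / eps)).
  { replace ((qn + 1) / t - mn * Qf t (exp (X t)) / eps) with (/ t * ((qn + 1) - mn * (t * Qf t (exp (X t))) / eps)) by (field; lra).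
    rewrite hq; f_equal; rewrite <- qn_mn at 1; rewrite <- mn_b; field; lra. }
  rewrite e2 in d.
  assert (it : 1 <= / t) by (rewrite <- Rinv_1; apply Rinv_le_contravar; lra).
  assert (i3 : p * gam_min / eps <= p + p * Gam t / eps).
  { assert (p * gam_min / eps <= p * Gam t / eps); [|lra].
    apply Rmult_le_compat_r; [left; apply Rinv_0_lt_compat; trivial | apply Rmult_le_compat_l; lra]. }
  assert (w0p : 0 < w0).
  { unfold w0; apply Rmult_lt_0_compat; [apply exp_pos|].
    apply Rmult_lt_0_compat; [lra | apply sp_gt0; lra]. }
  assert (i4 : cJ < w0 * (p * gam_min / eps)).
  { apply (Rmult_lt_reg_r eps); trivial.
    replace (w0 * (p * gam_min / eps) * eps) with (w0 * (p * gam_min)) by (field; lra); lra. }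
  assert (i5 : 0 < p * gam_min / eps) by (apply Rdiv_lt_0_compat; [apply Rmult_lt_0_compat; lra | trivial]).
  assert (i6 : w0 * (p * gam_min / eps) <= Z t * (/ t * (p + p * Gam t / eps))).
  { apply Rmult_le_compat; try lra.
    apply Rle_trans with (1 * (p + p * Gam t / eps)); [lra | apply Rmult_le_compat_r; lra]. }
  destruct (derive_pos_local _ t _ d) as [r [hr [_ h4]]].
  + unfold plus; simpl; lra.
  + pose (s := Rmax ((u0 + t) / 2) (t - r / 2)).
    assert (u0 < s < t /\ t - r < s) by (unfold s, Rmax; destruct Rle_dec; lra).
    specialize (h4 s ltac:(lra)); cbv beta in h4; rewrite <- !Z_Th in h4 by lra.
    specialize (h3 s ltac:(lra)); cbv beta in h3; lra.
Qed.

End Barrier.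

(** [eps] is taken below [d0] and small enough for the growth of Z to beat the bound [cJ] on |J'|.
    The barrier then gives Th > eps, so neither cut-off acts and the solution satisfies the original
    equation. *)
Lemma orbit_exists (x1 : R) : exists X, orbit x1 X.
Proof.
destruct Jf_near_0 as [u0 [hu0 hJ]].
pose (d0 := b * (p - 1) / 2).
assert (hd0 : 0 < d0) by (apply barrier_d0).
pose (w0 := exp (x1 - mn * (cQ + exp (x1 + mn * cQ / d0)) / d0) * (u0 * sp qn u0)).
assert (w0p : 0 < w0).
{ unfold w0; apply Rmult_lt_0_compat; [apply exp_pos|].
  apply Rmult_lt_0_compat; [lra | apply sp_gt0; lra]. }
pose proof gam_min_pos; pose proof cJ_pos.
assert (hW : 0 < w0 * (p * gam_min) / cJ) by (apply Rdiv_lt_0_compat; trivial; apply Rmult_lt_0_compat; [exact w0p | apply Rmult_lt_0_compat; lra]).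
assert (he : exists eps, 0 < eps /\ eps < d0 /\ eps < w0 * (p * gam_min) / cJ).
{ set (W := w0 * (p * gam_min) / cJ) in *; exists (Rmin (d0 / 2) (W / 2)).
  clearbody W d0; unfold Rmin; destruct Rle_dec; lra. }
destruct he as [eps [he1 [he2 he3]]].
destruct (FX_solution x1 eps he1) as [X [h0 [hX ev]]].
assert (hw : eps * cJ < w0 * (p * gam_min)).
{ apply Rlt_le_trans with (w0 * (p * gam_min) / cJ * cJ); [apply Rmult_lt_compat_r; trivial | right; field; lra]. }
assert (bar : forall u, 0 <= u <= 1 -> eps < Th u (exp (X u))) by (apply (barrier x1 eps u0 X); trivial).
assert (bar2 : forall u, Rabs u <= 1 -> eps < Th u (exp (X u))).
{ intros u hu; apply Rabs_le_between in hu; destruct (Rle_dec 0 u); [apply bar; lra|].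
  rewrite <- (Ropp_involutive u), Th_opp, ev; apply bar; lra. }
exists X; split; [trivial|split; [auto|split]].
- intros u hu.
  assert (le : X u <= x1 + mn * cQ / eps).
  { apply Rabs_le_between in hu; destruct (Rle_dec 0 u).
    - apply (X_le_Mx x1 eps X); trivial; lra.
    - rewrite <- (Ropp_involutive u), ev; apply (X_le_Mx x1 eps X); trivial; lra. }
  replace (- mn * Qf u (exp (X u)) / Th u (exp (X u))) with (FX x1 eps u (X u)); [apply hX|].
  unfold FX; rewrite clamp_id, Rmin_left, Rmax_left; trivial.
  + left; apply bar2; trivial.
  + apply Rabs_le_between; trivial.
- intros u hu; specialize (bar2 u hu); lra.
Qed.

Lemma exp_diff (a a' M : R) : a <= M -> a' <= M -> Rabs (exp a - exp a') <= exp M * Rabs (a - a').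
Proof.
intros h h'; pose proof (exp_min_lip M a a') as e; rewrite !Rmin_left in e by trivial; trivial.
Qed.

Lemma orbit_derive (x1 : R) (X : R -> R) (u : R) : orbit x1 X -> Rabs u <= 1 ->
  is_derive X u (- mn * Qf u (exp (X u)) / Th u (exp (X u))).
Proof. intros h; apply h. Qed.

Lemma orbit_continuous (x1 : R) (X : R -> R) (u : R) : orbit x1 X -> Rabs u <= 1 -> continuous X u.
Proof. intros h hu; eapply is_derive_continuous, (orbit_derive x1); trivial. Qed.

Lemma exp_comp_continuous (X : R -> R) (u : R) : continuous X u -> continuous (fun u => exp (X u)) u.
Proof. intros h; apply (cont_comp X exp); trivial; eapply is_derive_continuous, is_derive_exp. Qed.

Lemma orbit_Th_continuous (x1 : R) (X : R -> R) (u : R) : orbit x1 X -> Rabs u <= 1 ->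
  continuous (fun u => Th u (exp (X u))) u.
Proof.
intros h hu; apply (Th_continuous (fun u => exp (X u)) (fun u => u)); [apply cont_id|].
apply exp_comp_continuous, (orbit_continuous x1); trivial.
Qed.

Lemma unit_abs (u : R) : 0 <= u <= 1 -> Rabs u <= 1.
Proof. intros h; rewrite Rabs_pos_eq; lra. Qed.

(* (X2 - X1)' = - m b Gam u^q (V2 - V1) / (Th1 Th2). *)
Lemma orbit_compare (x1 x2 : R) (X1 X2 : R -> R) : x1 < x2 -> orbit x1 X1 -> orbit x2 X2 ->
  forall u, 0 <= u <= 1 -> X1 u < X2 u <= X1 u + (x2 - x1).
Proof.
intros hx o1 o2.
pose (D := fun u => X2 u - X1 u).
pose (cf := fun u => mn * b * Gam u * sp qn u / (Th u (exp (X1 u)) * Th u (exp (X2 u)))).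
assert (tp : forall u, 0 <= u <= 1 -> 0 < Th u (exp (X1 u)) /\ 0 < Th u (exp (X2 u))).
{ intros u hu; split; [apply o1 | apply o2]; apply unit_abs; trivial. }
assert (hD : forall u, 0 <= u <= 1 -> is_derive D u (- cf u * (exp (X2 u) - exp (X1 u)))).
{ intros u hu; destruct (tp u hu) as [t1 t2].
  replace (- cf u * (exp (X2 u) - exp (X1 u))) with
   (- mn * Qf u (exp (X2 u)) / Th u (exp (X2 u)) - - mn * Qf u (exp (X1 u)) / Th u (exp (X1 u))).
  - apply (is_derive_minus X2 X1); [apply (orbit_derive x2) | apply (orbit_derive x1)]; trivial; apply unit_abs; trivial.
  - unfold cf; set (T1 := Th u (exp (X1 u))) in *; set (T2 := Th u (exp (X2 u))) in *.
    apply (Rmult_eq_reg_r (T1 * T2)); [|apply Rmult_integral_contrapositive; lra].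
    transitivity (- mn * (Qf u (exp (X2 u)) * T1 - Qf u (exp (X1 u)) * T2)); [field; lra|].
    transitivity (- (mn * b * Gam u * sp qn u) * (exp (X2 u) - exp (X1 u))); [|field; lra].
    unfold T1, T2, Th, Qf; ring. }
assert (cD : forall u, 0 <= u <= 1 -> continuous D u) by (intros u hu; eapply is_derive_continuous, hD; trivial).
assert (ccf : forall u, 0 <= u <= 1 -> continuous cf u).
{ intros u hu; pose proof (unit_abs u hu); destruct (tp u hu); apply cont_div.
  - apply cont_mult; [|apply sp_continuous, qn_pos]; apply cont_mult; [apply cont_const | apply Gam_continuous].
  - apply cont_mult; [apply (orbit_Th_continuous x1) | apply (orbit_Th_continuous x2)]; trivial.
  - apply Rmult_integral_contrapositive; lra. }
assert (cfp : forall u, 0 <= u <= 1 -> 0 <= cf u).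
{ intros u hu; pose proof (unit_abs u hu) as ha; destruct (tp u hu); pose proof mn_pos.
  apply Rdiv_le_0_compat; [|apply Rmult_lt_0_compat; trivial].
  pose proof (Gam_pos u ha); pose proof (sp_nonneg qn u (proj1 hu)).
  apply Rmult_le_pos; trivial; apply Rmult_le_pos; [apply Rmult_le_pos|]; lra. }
destruct (continuous_bounded cf 0 1) as [B [hB bB]]; [lra|trivial|].
destruct (continuous_bounded (fun u => Rabs (X1 u) + Rabs (X2 u)) 0 1) as [M [hM bM]]; [lra| |].
{ intros u hu; pose proof (unit_abs u hu); apply cont_plus; apply cont_abs; [apply (orbit_continuous x1) | apply (orbit_continuous x2)]; trivial. }
assert (vd : forall u, 0 <= u <= 1 -> Rabs (exp (X2 u) - exp (X1 u)) <= exp M * Rabs (D u)).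
{ intros u hu; specialize (bM u hu); rewrite Rabs_pos_eq in bM by (pose proof (Rabs_pos (X1 u)); pose proof (Rabs_pos (X2 u)); lra).
  pose proof (Rle_abs (X1 u)); pose proof (Rle_abs (X2 u)); pose proof (Rabs_pos (X1 u)); pose proof (Rabs_pos (X2 u)).
  apply exp_diff; lra. }
pose proof (exp_pos M) as heM.
assert (D0 : D 0 = x2 - x1) by (unfold D; destruct o1 as [-> _], o2 as [-> _]; trivial).
(* The second half of Gronwall: a gap that is nonzero at 0 cannot close. *)
assert (nz : forall u, 0 <= u <= 1 -> D u <> 0).
{ intros u hu e.
  destruct (gronwall (fun u => D u ^ 2) (fun u => 2 * D u * (- cf u * (exp (X2 u) - exp (X1 u)))) (2 * (B * exp M)) 0 u (proj1 hu)) as [_ g].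
  - intros t ht; replace (2 * D t * (- cf t * (exp (X2 t) - exp (X1 t)))) with
      (INR 2 * (- cf t * (exp (X2 t) - exp (X1 t))) * D t ^ pred 2) by (simpl; ring).
    apply is_derive_pow, hD; lra.
  - intros t ht; apply continuous_ext with (fun u => D u * D u); [intros; simpl; ring|]; apply cont_mult; apply cD; lra.
  - intros t ht; specialize (vd t ltac:(lra)); specialize (bB t ltac:(lra)).
    rewrite !Rabs_mult, (Rabs_pos_eq 2), Rabs_Ropp, <- (pow2_abs (D t)) by lra.
    pose proof (Rabs_pos (D t)); pose proof (Rabs_pos (cf t)); pose proof (Rabs_pos (exp (X2 t) - exp (X1 t))).
    assert (Rabs (cf t) * Rabs (exp (X2 t) - exp (X1 t)) <= B * (exp M * Rabs (D t))) by (apply Rmult_le_compat; trivial).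
    nra.
  - cbv beta in g; rewrite D0, e in g; assert (0 < (x2 - x1) ^ 2) by (apply pow_lt; lra); lra. }
assert (pos : forall u, 0 <= u <= 1 -> 0 < D u).
{ intros u hu; destruct (Rlt_dec 0 (D u)) as [|n]; trivial; exfalso.
  destruct (Req_dec u 0) as [e|ne]; [rewrite e, D0 in n; lra|].
  destruct (first_zero D 0 u) as [t [h1 [h2 _]]]; try lra.
  - intros; apply cD; lra.
  - apply (nz t); trivial; lra. }
intros u hu; split; [specialize (pos u hu); unfold D in pos; lra|].
assert (- D 0 <= - D u).
{ apply (derive_nonneg_le (fun u => - D u) (fun u => - (- cf u * (exp (X2 u) - exp (X1 u))))); try lra.
  - intros t ht; apply (is_derive_opp D), hD; lra.
  - intros t ht; apply cont_opp, cD; lra.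
  - intros t ht; specialize (pos t ltac:(lra)); specialize (cfp t ltac:(lra)).
    assert (exp (X1 t) <= exp (X2 t)) by (apply exp_le_mono; unfold D in pos; lra); nra. }
rewrite D0 in H; unfold D in H; lra.
Qed.

(** * The half period as a function of the value of the orbit at 0 *)

Definition orb (x1 : R) : R -> R := proj1_sig (constructive_indefinite_description _ (orbit_exists x1)).

Lemma orb_spec (x1 : R) : orbit x1 (orb x1).
Proof. unfold orb; apply proj2_sig. Qed.

Definition Thx (x1 a : R) : R := Th (sin a) (exp (orb x1 (sin a))).
(* dt/da *)
Definition tau (x1 a : R) : R := Gam (sin a) / Thx x1 a.
Definition half_period (x1 : R) : R := RInt (tau x1) 0 PI.

Lemma sin_abs (a : R) : Rabs (sin a) <= 1.
Proof. apply Rabs_le, SIN_bound. Qed.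

Lemma sin_cont (a : R) : continuous sin a.
Proof. apply continuity_pt_filterlim, continuity_sin. Qed.

Lemma sin_unit (a : R) : 0 <= a <= PI -> 0 <= sin a <= 1.
Proof. intros h; split; [apply sin_ge_0; lra | apply SIN_bound]. Qed.

Lemma Thx_pos (x1 a : R) : 0 < Thx x1 a.
Proof. apply (orb_spec x1), sin_abs. Qed.

Lemma Thx_continuous (x1 a : R) : continuous (Thx x1) a.
Proof.
apply (cont_comp sin (fun u => Th u (exp (orb x1 u)))); [apply sin_cont|].
apply (orbit_Th_continuous x1); [apply orb_spec | apply sin_abs].
Qed.

Lemma Gam_sin_continuous (a : R) : continuous (fun a => Gam (sin a)) a.
Proof. apply (cont_comp sin Gam); [apply sin_cont | apply Gam_continuous]. Qed.

Lemma tau_continuous (x1 a : R) : continuous (tau x1) a.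
Proof.
apply cont_div; [apply Gam_sin_continuous | apply Thx_continuous | pose proof (Thx_pos x1 a); lra].
Qed.

Lemma tau_pos (x1 a : R) : 0 < tau x1 a.
Proof. apply Rdiv_lt_0_compat; [apply Gam_pos, sin_abs | apply Thx_pos]. Qed.

Lemma Thx_periodic (x1 a : R) : Thx x1 (a + PI) = Thx x1 a.
Proof.
unfold Thx; rewrite neg_sin, Th_opp.
destruct (orb_spec x1) as [_ [ev _]]; rewrite ev by apply sin_abs; trivial.
Qed.

Lemma tau_periodic (x1 a : R) : tau x1 (a + PI) = tau x1 a.
Proof. unfold tau; rewrite Thx_periodic, neg_sin, Gam_opp; trivial. Qed.

Lemma Thx_increasing (x1 x2 a : R) : x1 < x2 -> 0 < a < PI -> Thx x1 a < Thx x2 a.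
Proof.
intros hx ha; unfold Thx; rewrite !Th_Jf.
pose proof (sin_gt_0 a (proj1 ha) (proj2 ha)) as hs.
pose proof (orbit_compare x1 x2 _ _ hx (orb_spec x1) (orb_spec x2) (sin a) (sin_unit a ltac:(lra))) as [h _].
apply exp_increasing in h.
assert (0 < sin a * sp qn (sin a)) by (apply Rmult_lt_0_compat; [trivial | apply sp_gt0; trivial]); nra.
Qed.

Lemma Thx_nondecreasing (x1 x2 a : R) : x1 <= x2 -> 0 <= a <= PI -> Thx x1 a <= Thx x2 a.
Proof.
intros [hx| ->] ha; [|lra]; unfold Thx; rewrite !Th_Jf.
pose proof (orbit_compare x1 x2 _ _ hx (orb_spec x1) (orb_spec x2) (sin a) (sin_unit a ha)) as [h _].
apply exp_increasing in h; pose proof (mul_sp_nonneg qn (sin a)); nra.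
Qed.

Lemma half_period_decreasing (x1 x2 : R) : x1 < x2 -> half_period x2 < half_period x1.
Proof.
intros hx; apply RInt_lt; try apply PI_RGT_0; try (intros; apply tau_continuous).
intros a ha; unfold tau, Rdiv; apply Rmult_lt_compat_l; [apply Gam_pos, sin_abs|].
apply Rinv_lt_contravar; [apply Rmult_lt_0_compat; apply Thx_pos | apply Thx_increasing; trivial].
Qed.

Lemma tau_ex_RInt (x1 a c : R) : ex_RInt (tau x1) a c.
Proof. apply (ex_RInt_continuous (V := R_CompleteNormedModule)); intros; apply tau_continuous. Qed.

(** By comparison X is 1-Lipschitz in x1. For starting values within 1 of x, the orbits at x - 1 and
    x + 1 bound Thx from below and X from above, so the half period satisfies a Lipschitz estimate
    centred at x. *)
Lemma half_period_continuous (x : R) : continuous half_period x.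
Proof.
pose proof PI_RGT_0 as hpi.
destruct (continuity_ab_min (Thx (x - 1)) 0 PI) as [am [ha _]]; [lra|intros; apply continuity_pt_filterlim, Thx_continuous|].
set (e := Thx (x - 1) am) in *.
assert (he : 0 < e) by apply Thx_pos.
destruct (continuous_bounded (orb (x + 1)) 0 1) as [M [hM bM]]; [lra| |].
{ intros u hu; apply (orbit_continuous (x + 1)); [apply orb_spec | apply unit_abs; trivial]. }
pose (K := gam_max * exp M / (e * e) * PI).
assert (hg : 0 < gam_max) by (unfold gam_max; lra).
assert (hk : 0 < gam_max * exp M / (e * e)).
{ apply Rdiv_lt_0_compat; apply Rmult_lt_0_compat; trivial; apply exp_pos. }
assert (hK : 0 < K) by (apply Rmult_lt_0_compat; trivial).
assert (lip : forall x', Rabs (x' - x) < 1 -> Rabs (half_period x' - half_period x) <= K * Rabs (x' - x)).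
{ intros x' hx'; apply Rabs_lt_between in hx'.
  unfold half_period; rewrite <- (RInt_minus (V := R_CompleteNormedModule) (tau x') (tau x)) by apply tau_ex_RInt.
  replace (K * Rabs (x' - x)) with ((PI - 0) * (gam_max * exp M / (e * e) * Rabs (x' - x))) by (unfold K; ring).
  apply abs_RInt_le_const; [lra| |].
  - apply (ex_RInt_minus (V := R_NormedModule)); apply tau_ex_RInt.
  - intros a hA; unfold minus, plus, opp; simpl.
    pose proof (sin_unit a hA) as hs.
    assert (le : forall y, Rabs (y - x) < 1 -> orb y (sin a) <= M).
    { intros y hy; apply Rabs_lt_between in hy.
      pose proof (orbit_compare y (x + 1) _ _ ltac:(lra) (orb_spec y) (orb_spec (x + 1)) (sin a) hs) as [q1 q2].
      pose proof (bM (sin a) hs) as q3; apply Rabs_le_between in q3; lra. }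
    assert (dd : Rabs (orb x' (sin a) - orb x (sin a)) <= Rabs (x' - x)).
    { destruct (Rtotal_order x' x) as [h|[->|h]].
      - pose proof (orbit_compare x' x _ _ h (orb_spec x') (orb_spec x) (sin a) hs).
        rewrite Rabs_minus_sym, (Rabs_minus_sym x'), !Rabs_pos_eq; lra.
      - rewrite !Rminus_diag; lra.
      - pose proof (orbit_compare x x' _ _ h (orb_spec x) (orb_spec x') (sin a) hs).
        rewrite !Rabs_pos_eq; lra. }
    assert (vd : Rabs (exp (orb x' (sin a)) - exp (orb x (sin a))) <= exp M * Rabs (x' - x)).
    { eapply Rle_trans; [apply exp_diff|].
      - apply le; apply Rabs_lt_between; lra.
      - apply le; rewrite Rminus_diag, Rabs_R0; lra.
      - apply Rmult_le_compat_l; [left; apply exp_pos | trivial]. }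
    assert (td : Rabs (Thx x a - Thx x' a) <= exp M * Rabs (x' - x)).
    { rewrite Rabs_minus_sym; unfold Thx; rewrite !Th_Jf.
      replace (Jf (sin a) + exp (orb x' (sin a)) * (sin a * sp qn (sin a)) - (Jf (sin a) + exp (orb x (sin a)) * (sin a * sp qn (sin a))))
        with ((exp (orb x' (sin a)) - exp (orb x (sin a))) * (sin a * sp qn (sin a))) by ring.
      rewrite Rabs_mult, (Rabs_pos_eq (sin a * _)) by apply mul_sp_nonneg.
      pose proof (sp_le_1 qn (sin a) qn_pos (sin_abs a)) as hq; apply Rabs_le_between in hq.
      pose proof (sp_nonneg qn (sin a) (proj1 hs)).
      pose proof (Rabs_pos (exp (orb x' (sin a)) - exp (orb x (sin a)))).
      assert (sin a * sp qn (sin a) <= 1) by nra; pose proof (mul_sp_nonneg qn (sin a)); nra. }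
    assert (l1 : e <= Thx x a) by (apply Rle_trans with (Thx (x - 1) a); [apply ha; trivial | apply Thx_nondecreasing; trivial; lra]).
    assert (l2 : e <= Thx x' a) by (apply Rle_trans with (Thx (x - 1) a); [apply ha; trivial | apply Thx_nondecreasing; trivial; lra]).
    unfold tau.
    replace (Gam (sin a) / Thx x' a + - (Gam (sin a) / Thx x a)) with
      (Gam (sin a) * (Thx x a - Thx x' a) * / (Thx x' a * Thx x a)) by (field; lra).
    pose proof (Gam_pos (sin a) (sin_abs a)); pose proof (Gam_le (sin a) (sin_abs a)).
    rewrite !Rabs_mult, Rabs_inv, (Rabs_pos_eq (Gam _)), (Rabs_pos_eq (_ * _)) by nra.
    replace (gam_max * exp M / (e * e) * Rabs (x' - x)) with (gam_max * (exp M * Rabs (x' - x)) * / (e * e)) by (field; lra).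
    apply Rmult_le_compat.
    + apply Rmult_le_pos; [lra | apply Rabs_pos].
    + left; apply Rinv_0_lt_compat; nra.
    + apply Rmult_le_compat; trivial; [lra | apply Rabs_pos].
    + apply Rinv_le_contravar; nra. }
apply continuous_abs_bound; intros eps heps.
assert (0 < eps / (2 * K)) by (apply Rdiv_lt_0_compat; lra).
exists (Rmin 1 (eps / (2 * K))); split; [apply Rmin_pos; lra|].
intros t ht; pose proof (Rmin_l 1 (eps / (2 * K))); pose proof (Rmin_r 1 (eps / (2 * K))).
eapply Rle_lt_trans; [apply lip; lra|].
apply Rle_lt_trans with (K * (eps / (2 * K))); [apply Rmult_le_compat_l; lra|].
replace (K * (eps / (2 * K))) with (eps / 2) by (field; lra); lra.
Qed.

Lemma orb_0 (x1 : R) : orb x1 0 = x1.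
Proof. apply orb_spec. Qed.

(** X' <= m cQ / e, because Qf >= - cQ and Th >= Jf >= e. It carries the smallness of V at 0 to all
    of [0, u], which is what limits as x1 -> -oo require. *)
Lemma orb_dec_rate (x1 u e : R) : 0 <= u <= 1 -> 0 < e -> (forall t, 0 <= t <= u -> e <= Jf t) ->
  orb x1 u <= x1 + mn * cQ / e.
Proof.
intros hu he hJ; pose proof mn_pos as hm; pose proof cQ_pos as hq.
assert (k : 0 <= mn * cQ / e) by (apply Rdiv_le_0_compat; nra).
assert (- (orb x1 0 - mn * cQ / e * 0) <= - (orb x1 u - mn * cQ / e * u)).
{ apply (derive_nonneg_le (fun t => - (orb x1 t - mn * cQ / e * t))
   (fun t => - (- mn * Qf t (exp (orb x1 t)) / Th t (exp (orb x1 t)) - mn * cQ / e))); try lra.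
  - intros t ht; apply (is_derive_opp (fun t => orb x1 t - mn * cQ / e * t)).
    apply (is_derive_minus (orb x1) (fun t => mn * cQ / e * t)).
    + apply (orbit_derive x1); [apply orb_spec | apply unit_abs; lra].
    + auto_derive; trivial; ring.
  - intros t ht; apply cont_opp, cont_minus.
    + apply (orbit_continuous x1); [apply orb_spec | apply unit_abs; lra].
    + apply cont_mult; [apply cont_const | apply cont_id].
  - intros t ht.
    assert (- mn * Qf t (exp (orb x1 t)) / Th t (exp (orb x1 t)) <= mn * cQ / e); [|lra].
    apply frac_bound; [lra| |].
    + apply Qf_lower; [lra | left; apply exp_pos].
    + split; trivial; apply Rle_trans with (Jf t); [apply hJ; lra | apply Th_ge_Jf; left; apply exp_pos]. }
rewrite orb_0 in H; nra.
Qed.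

(* (ln V + m ln u)' = m b Gam / (u Th) *)
Lemma orb_plus_log_increasing (x1 u u' : R) : 0 < u -> u <= u' -> u' <= 1 ->
  orb x1 u + mn * ln u <= orb x1 u' + mn * ln u'.
Proof.
intros hu huu hu'; pose proof mn_pos as hm.
apply (derive_nonneg_le (fun t => orb x1 t + mn * ln t)
   (fun t => - mn * Qf t (exp (orb x1 t)) / Th t (exp (orb x1 t)) + mn * / t)); trivial.
- intros t ht; apply (is_derive_plus (orb x1) (fun t => mn * ln t)).
  + apply (orbit_derive x1); [apply orb_spec | apply unit_abs; lra].
  + apply (is_derive_scal ln), is_derive_Reals, derivable_pt_lim_ln; lra.
- intros t ht; apply cont_plus.
  + apply (orbit_continuous x1); [apply orb_spec | apply unit_abs; lra].
  + apply cont_mult; [apply cont_const|].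
    eapply is_derive_continuous, is_derive_Reals, derivable_pt_lim_ln; lra.
- intros t ht; set (V := exp (orb x1 t)).
  assert (hT : 0 < Th t V) by (apply (orb_spec x1), unit_abs; lra).
  pose proof (Gam_pos t ltac:(apply unit_abs; lra)).
  replace (- mn * Qf t V / Th t V + mn * / t) with (mn * (Th t V - t * Qf t V) / (t * Th t V)) by (field; lra).
  replace (Th t V - t * Qf t V) with (b * Gam t) by (unfold Th; ring).
  apply Rdiv_le_0_compat; [|apply Rmult_lt_0_compat; lra].
  apply Rmult_le_pos; [lra | apply Rmult_le_pos; lra].
Qed.

Lemma Rpower_exp (u a : R) : Rpower u a = exp (a * ln u).
Proof. reflexivity. Qed.

(** The scale u1 is the one with exp x1 u1^(q+1) = 1. Up to u1 the product V u^q is at most a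
    constant over u1, so X loses only a bounded amount. Beyond u1, ln V + m ln u does not decrease,
    and q + 1 - m = p turns this into V u^(q+1) >= c (u / u1)^p. *)
Lemma large_orbit : exists u0 c, 0 < u0 <= 1 /\ 0 < c /\ (forall u, 0 <= u <= u0 -> b * (p - 1) / 2 <= Jf u) /\
  forall u1, 0 < u1 <= u0 -> forall u, u1 <= u <= 1 ->
    Jf u + c * Rpower (u / u1) p <= Th u (exp (orb (- (qn + 1) * ln u1) u)).
Proof.
destruct Jf_near_0 as [u0 [hu0 hJ]].
pose proof barrier_d0 as hd0; set (d0 := b * (p - 1) / 2) in *.
pose proof mn_pos as hm; pose proof cQ_pos as hq; pose proof qn_pos as hqn.
pose (c1 := mn * cQ / d0).
pose (c2 := mn * (cQ + exp c1) / d0).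
assert (k1 : 0 <= c1) by (apply Rdiv_le_0_compat; nra).
pose proof (exp_pos c1) as he1.
assert (k2 : 0 <= c2) by (apply Rdiv_le_0_compat; nra).
exists u0, (exp (- c2)); split; trivial; split; [apply exp_pos|]; split; trivial.
intros u1 hu1 u hu; set (x1 := - (qn + 1) * ln u1).
assert (low : x1 - c2 <= orb x1 u1).
{ pose (d := mn * (cQ + exp c1 / u1) / d0).
  assert (hd : d * u1 <= c2).
  { replace (d * u1) with (mn * (cQ * u1 + exp c1) / d0) by (unfold d; field; lra).
    unfold c2; apply Rmult_le_compat_r; [left; apply Rinv_0_lt_compat; lra|].
    apply Rmult_le_compat_l; nra. }
  assert (orb x1 0 + d * 0 <= orb x1 u1 + d * u1).
  { apply (derive_nonneg_le (fun t => orb x1 t + d * t)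
      (fun t => - mn * Qf t (exp (orb x1 t)) / Th t (exp (orb x1 t)) + d)); try lra.
    - intros t ht; apply (is_derive_plus (orb x1) (fun t => d * t)).
      + apply (orbit_derive x1); [apply orb_spec | apply unit_abs; lra].
      + auto_derive; trivial; ring.
    - intros t ht; apply cont_plus.
      + apply (orbit_continuous x1); [apply orb_spec | apply unit_abs; lra].
      + apply cont_mult; [apply cont_const | apply cont_id].
    - intros t ht.
      assert (- (mn * (cQ + exp c1 / u1) / d0) <= - mn * Qf t (exp (orb x1 t)) / Th t (exp (orb x1 t))); [|unfold d; lra].
      apply frac_bound_lower.
      + assert (0 < exp c1 / u1) by (apply Rdiv_lt_0_compat; lra); lra.
      + unfold Qf; pose proof (Q0_bound t ltac:(apply unit_abs; lra)) as h0; apply Rabs_le_between in h0.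
        apply Rplus_le_compat; [lra|].
        rewrite sp_pos by lra.
        assert (o : orb x1 t <= x1 + c1) by (apply orb_dec_rate; trivial; [lra | intros; apply hJ; lra]).
        apply Rle_trans with (exp (x1 + c1) * Rpower u1 qn).
        * apply Rmult_le_compat; try (left; apply exp_pos); [apply exp_le_mono; trivial|].
          apply Rle_Rpower_l; lra.
        * rewrite Rpower_exp, <- exp_plus.
          replace (x1 + c1 + qn * ln u1) with (c1 + - ln u1) by (unfold x1; ring).
          rewrite exp_plus, exp_Ropp, exp_ln by lra; unfold Rdiv; lra.
      + split; trivial; apply Rle_trans with (Jf t); [apply hJ; lra | apply Th_ge_Jf; left; apply exp_pos]. }
  rewrite orb_0 in H; lra. }
rewrite Th_Jf; apply Rplus_le_compat_l.
rewrite sp_pos, (Rmult_comm u), <- Rpower_succ by lra.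
pose proof (orb_plus_log_increasing x1 u1 u ltac:(lra) ltac:(lra) ltac:(lra)) as hl.
rewrite !Rpower_exp, <- !exp_plus; apply exp_le_mono.
unfold Rdiv; rewrite ln_mult, ln_Rinv by (try apply Rinv_0_lt_compat; lra).
assert (x1 - c2 + mn * ln u1 - mn * ln u <= orb x1 u) by lra.
replace (qn + 1) with (p + mn) by (rewrite <- qn_mn; ring).
apply Rle_trans with (x1 - c2 + mn * ln u1 - mn * ln u + (p + mn) * ln u); [|lra].
unfold x1; replace (qn + 1) with (p + mn) by (rewrite <- qn_mn; ring); right; ring.
Qed.

Lemma Jf_lower_global : exists c, 0 < c /\ forall u, 0 <= u <= 1 -> - c <= Jf u.
Proof.
destruct (continuous_bounded Jf 0 1) as [c [hc bc]]; [lra|intros; apply Jf_continuous|].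
exists c; split; trivial; intros u hu; specialize (bc u hu); apply Rabs_le_between in bc; lra.
Qed.

(** Near 0 and PI the integrand is bounded independently of x1, so two short intervals of length
    [dl] contribute little; between them Thx becomes as large as desired by the growth (u /
    u1)^p. *)
Lemma half_period_small (e : R) : 0 < e -> exists x1, half_period x1 < e.
Proof.
intros he; pose proof PI_RGT_0 as hpi; pose proof PI2_1 as hpi2.
destruct large_orbit as [u0 [c [hu0 [hc [hJ hT]]]]].
destruct Jf_lower_global as [cl [hcl bcl]].
pose proof barrier_d0 as hd0; set (d0 := b * (p - 1) / 2) in *.
assert (hg : 0 < gam_max) by (unfold gam_max; lra).
pose (dl := Rmin (u0 / 2) (e * d0 / (8 * gam_max))).
assert (0 < e * d0 / (8 * gam_max)) by (apply Rdiv_lt_0_compat; nra).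
assert (hdl : 0 < dl /\ dl < u0 /\ dl <= e * d0 / (8 * gam_max)) by (unfold dl, Rmin; destruct Rle_dec; lra).
destruct hdl as [hdl1 [hdl2 hdl3]].
set (s := sin dl).
assert (hs : 0 < s <= dl).
{ unfold s; split; [apply sin_gt_0; lra | left; apply sin_lt_x; trivial]. }
pose (Bd := 4 * PI * gam_max / e + cl).
assert (hBd : 0 < Bd) by (unfold Bd; assert (0 < 4 * PI * gam_max / e) by (apply Rdiv_lt_0_compat; nra); lra).
(* Chosen so that c (s / u1)^p = c + Bd; the summand [cl] of [Bd] compensates a possibly negative
   Jf. *)
pose (u1 := s * Rpower (c / (c + Bd)) (/ p)).
assert (hr : 0 < c / (c + Bd) <= 1).
{ split; [apply Rdiv_lt_0_compat; lra|]; apply (Rmult_le_reg_r (c + Bd)); [lra|].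
  unfold Rdiv; rewrite Rmult_assoc, Rinv_l; lra. }
assert (hip : 0 <= / p) by (left; apply Rinv_0_lt_compat; lra).
assert (hu1 : 0 < u1 <= s).
{ unfold u1; pose proof (Rpower_le_1 _ (/ p) hr hip); pose proof (Rpower_gt0 (c / (c + Bd)) (/ p)); nra. }
exists (- (qn + 1) * ln u1); set (x1 := - (qn + 1) * ln u1).
assert (mid : forall a, dl <= a <= PI - dl -> tau x1 a <= e / (4 * PI)).
{ intros a ha.
  assert (hsa : s <= sin a) by (apply sin_ge_sin; lra).
  pose proof (sin_unit a ltac:(lra)) as hsu.
  pose proof (hT u1 ltac:(lra) (sin a) ltac:(lra)) as h; fold x1 in h.
  pose proof (bcl (sin a) hsu).
  assert (hp1 : c + Bd <= c * Rpower (sin a / u1) p).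
  { apply Rle_trans with (c * Rpower (s / u1) p).
    - unfold u1; replace (s / (s * Rpower (c / (c + Bd)) (/ p))) with (Rpower (c / (c + Bd)) (- / p)).
      + rewrite Rpower_mult; replace (- / p * p) with (- (1)) by (field; lra).
        rewrite Rpower_Ropp, Rpower_1 by lra; right; field; lra.
      + rewrite Rpower_Ropp; pose proof (Rpower_gt0 (c / (c + Bd)) (/ p)); field; lra.
    - apply Rmult_le_compat_l; [lra|]; apply Rle_Rpower_l; [lra|]; split.
      + apply Rdiv_lt_0_compat; lra.
      + apply Rmult_le_compat_r; [left; apply Rinv_0_lt_compat; lra | trivial]. }
  fold (Thx x1 a) in h.
  assert (hth : 4 * PI * gam_max / e <= Thx x1 a) by (unfold Bd in hp1; lra).
  unfold tau; pose proof (Gam_le (sin a) (sin_abs a)); pose proof (Gam_pos (sin a) (sin_abs a)).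
  assert (0 < 4 * PI * gam_max / e) by (apply Rdiv_lt_0_compat; nra).
  apply Rle_trans with (gam_max * / (4 * PI * gam_max / e)).
  - apply Rmult_le_compat; try lra; [left; apply Rinv_0_lt_compat, Thx_pos | apply Rinv_le_contravar; trivial].
  - right; field; lra. }
assert (ends : forall a, (0 <= a <= dl \/ PI - dl <= a <= PI) -> tau x1 a <= gam_max / d0).
{ intros a ha.
  assert (hsu : 0 <= sin a <= u0).
  { destruct ha as [ha|ha].
    - split; [apply sin_ge_0; lra|]; destruct (Req_dec a 0) as [->|]; [rewrite sin_0; lra|].
      pose proof (sin_lt_x a ltac:(lra)); lra.
    - split; [apply sin_ge_0; lra|]; rewrite <- sin_PI_x; destruct (Req_dec a PI) as [->|].
      + rewrite Rminus_diag, sin_0; lra.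
      + pose proof (sin_lt_x (PI - a) ltac:(lra)); lra. }
  assert (d0 <= Thx x1 a).
  { apply Rle_trans with (Jf (sin a)); [apply hJ; trivial | apply Th_ge_Jf; left; apply exp_pos]. }
  unfold tau; pose proof (Gam_le (sin a) (sin_abs a)); pose proof (Gam_pos (sin a) (sin_abs a)).
  apply Rmult_le_compat; try lra; [left; apply Rinv_0_lt_compat, Thx_pos | apply Rinv_le_contravar; trivial]. }
assert (piece : forall a c K, a <= c -> (forall t, a <= t <= c -> tau x1 t <= K) -> RInt (tau x1) a c <= (c - a) * K).
{ intros a c' K hac hK.
  apply Rle_trans with (RInt (fun _ => K) a c').
  - apply RInt_le; trivial.
    + apply tau_ex_RInt.
    + apply ex_RInt_const.
    + intros t ht; apply hK; lra.
  - rewrite RInt_const; unfold scal; simpl; unfold mult; simpl; lra. }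
unfold half_period.
rewrite <- (RInt_Chasles (V := R_CompleteNormedModule) (tau x1) 0 dl PI) by apply tau_ex_RInt.
rewrite <- (RInt_Chasles (V := R_CompleteNormedModule) (tau x1) dl (PI - dl) PI) by apply tau_ex_RInt.
unfold plus; simpl.
pose proof (piece 0 dl (gam_max / d0) ltac:(lra) ltac:(intros; apply ends; lra)).
pose proof (piece (PI - dl) PI (gam_max / d0) ltac:(lra) ltac:(intros; apply ends; lra)).
pose proof (piece dl (PI - dl) (e / (4 * PI)) ltac:(lra) ltac:(intros; apply mid; lra)).
assert (i1 : dl * (gam_max / d0) <= e / 8).
{ apply Rle_trans with (e * d0 / (8 * gam_max) * (gam_max / d0)).
  - apply Rmult_le_compat_r; [left; apply Rdiv_lt_0_compat; lra | trivial].
  - right; field; lra. }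
assert (i2 : (PI - dl - dl) * (e / (4 * PI)) <= e / 4).
{ apply Rle_trans with (PI * (e / (4 * PI))).
  - apply Rmult_le_compat_r; [left; apply Rdiv_lt_0_compat; lra | lra].
  - right; field; lra. }
replace (PI - (PI - dl)) with dl in H1 by ring; lra.
Qed.

(** The value of dt/da at V = 0, the limit x1 -> -oo. *)
Definition tau_lim (a : R) : R := Gam (sin a) / Jf (sin a).

Lemma Jf_sin_continuous (a : R) : continuous (fun a => Jf (sin a)) a.
Proof. apply (cont_comp sin Jf); [apply sin_cont | apply Jf_continuous]. Qed.

Lemma half_period_lt_lim (x1 : R) : C < gq p b -> half_period x1 < RInt tau_lim 0 PI.
Proof.
intros hC; destruct (Jf_min hC) as [e [he hJ]]; pose proof PI_RGT_0 as hpi.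
apply RInt_lt; trivial.
- intros a ha; apply cont_div; [apply Gam_sin_continuous | apply Jf_sin_continuous|].
  specialize (hJ (sin a) (sin_unit a ha)); lra.
- intros; apply tau_continuous.
- intros a ha; unfold tau, tau_lim, Rdiv; specialize (hJ (sin a) (sin_unit a ltac:(lra))).
  apply Rmult_lt_compat_l; [apply Gam_pos, sin_abs|].
  assert (Jf (sin a) < Thx x1 a).
  { unfold Thx; rewrite Th_Jf; pose proof (sin_gt_0 a (proj1 ha) (proj2 ha)) as hs.
    assert (0 < sin a * sp qn (sin a)) by (apply Rmult_lt_0_compat; [trivial | apply sp_gt0; trivial]).
    pose proof (exp_pos (orb x1 (sin a))); nra. }
  apply Rinv_lt_contravar; trivial; apply Rmult_lt_0_compat; lra.
Qed.

Lemma half_period_near_lim (h : R) : C < gq p b -> h < RInt tau_lim 0 PI -> exists x1, h < half_period x1.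
Proof.
intros hC hh; destruct (Jf_min hC) as [e [he hJ]]; pose proof PI_RGT_0 as hpi.
assert (hg : 0 < gam_max) by (unfold gam_max; lra).
set (dlt := RInt tau_lim 0 PI - h); assert (hd : 0 < dlt) by (unfold dlt; lra).
(* This keeps V below dlt e^2 / (2 PI gam_max) on [0, 1], so that the two integrands differ by at
   most dlt / (2 PI). *)
pose (x1 := ln (dlt * (e * e) / (2 * PI * gam_max)) - mn * cQ / e).
assert (hpos : 0 < dlt * (e * e) / (2 * PI * gam_max)).
{ apply Rdiv_lt_0_compat; [apply Rmult_lt_0_compat; nra | nra]. }
assert (V : forall u, 0 <= u <= 1 -> exp (orb x1 u) <= dlt * (e * e) / (2 * PI * gam_max)).
{ intros u hu; rewrite <- (exp_ln _ hpos); apply exp_le_mono.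
  apply Rle_trans with (x1 + mn * cQ / e); [|unfold x1; lra].
  apply orb_dec_rate; trivial; intros; apply hJ; lra. }
assert (cl : forall a, 0 <= a <= PI -> continuous tau_lim a).
{ intros a ha; apply cont_div; [apply Gam_sin_continuous | apply Jf_sin_continuous|].
  specialize (hJ (sin a) (sin_unit a ha)); lra. }
assert (exl : ex_RInt tau_lim 0 PI).
{ apply (ex_RInt_continuous (V := R_CompleteNormedModule)); rewrite Rmin_left, Rmax_right by lra; trivial. }
exists x1.
assert (l : RInt tau_lim 0 PI - half_period x1 <= (PI - 0) * (dlt / (2 * PI))).
{ unfold half_period; rewrite <- (RInt_minus (V := R_CompleteNormedModule) tau_lim (tau x1)) by (trivial; apply tau_ex_RInt).
  eapply Rle_trans; [apply Rle_abs|].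
  apply abs_RInt_le_const; [lra| |].
  - apply (ex_RInt_minus (V := R_NormedModule)); [trivial | apply tau_ex_RInt].
  - intros a ha; pose proof (sin_unit a ha) as hs; specialize (hJ (sin a) hs); specialize (V (sin a) hs).
    pose proof (Thx_pos x1 a) as ht; unfold minus, plus, opp, tau_lim, tau; simpl.
    replace (Gam (sin a) / Jf (sin a) + - (Gam (sin a) / Thx x1 a)) with
      (Gam (sin a) * (Thx x1 a - Jf (sin a)) * / (Jf (sin a) * Thx x1 a)) by (field; lra).
    pose proof (Gam_pos (sin a) (sin_abs a)); pose proof (Gam_le (sin a) (sin_abs a)).
    assert (dd : 0 <= Thx x1 a - Jf (sin a) <= dlt * (e * e) / (2 * PI * gam_max)).
    { unfold Thx; rewrite Th_Jf.
      pose proof (mul_sp_nonneg qn (sin a)).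
      pose proof (sp_le_1 qn (sin a) qn_pos (sin_abs a)) as hq; apply Rabs_le_between in hq.
      assert (sin a * sp qn (sin a) <= 1) by nra; pose proof (exp_pos (orb x1 (sin a))); nra. }
    assert (le : e <= Thx x1 a) by lra.
    rewrite Rabs_pos_eq.
    + replace (dlt / (2 * PI)) with (gam_max * (dlt * (e * e) / (2 * PI * gam_max)) * / (e * e)) by (field; lra).
      apply Rmult_le_compat.
      * apply Rmult_le_pos; lra.
      * left; apply Rinv_0_lt_compat, Rmult_lt_0_compat; lra.
      * apply Rmult_le_compat; lra.
      * apply Rinv_le_contravar; nra.
    + apply Rmult_le_pos; [apply Rmult_le_pos; lra | left; apply Rinv_0_lt_compat, Rmult_lt_0_compat; lra]. }
replace ((PI - 0) * (dlt / (2 * PI))) with (dlt / 2) in l by (field; lra); unfold dlt in *; lra.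
Qed.

(* For C >= gq the limit integrand has a non-integrable pole at the first
   zero of Jf o sin. *)
Lemma half_period_unbounded (h : R) : gq p b <= C -> exists x1, h < half_period x1.
Proof.
intros hC; pose proof PI_RGT_0 as hpi.
destruct (first_zero (fun a => Jf (sin a)) 0 (PI / 2)) as [as' [h1 [h2 h3]]]; try lra.
{ intros; apply Jf_sin_continuous. }
{ rewrite sin_0, Jf_0; nra. }
{ rewrite sin_PI2, Jf_1; lra. }
pose proof gam_min_pos as hg; pose proof cJ_pos as hcJ; pose proof mn_pos as hm; pose proof cQ_pos as hq.
assert (lin : forall a, 0 < a < as' -> Jf (sin a) <= cJ * (as' - a)).
{ intros a ha.
  destruct (derive_mvt (fun a => Jf (sin a)) (fun a => cos a * dJ (sin a)) a as') as [t [ht e]]; try lra.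
  - intros t ht; apply (is_derive_comp Jf sin).
    + apply is_derive_Jf, sin_gt_0; lra.
    + apply is_derive_Reals, derivable_pt_lim_sin.
  - intros; apply Jf_sin_continuous.
  - rewrite h2 in e.
    assert (hb1 : Rabs (cos t * dJ (sin t)) <= cJ).
    { rewrite Rabs_mult.
      assert (Rabs (cos t) <= 1) by (apply Rabs_le, COS_bound).
      pose proof (dJ_bound (sin t) ltac:(split; [apply sin_gt_0; lra | apply SIN_bound])).
      pose proof (Rabs_pos (cos t)); pose proof (Rabs_pos (dJ (sin t))); nra. }
    apply Rabs_le_between in hb1; nra. }
(* It will be ln (as' / dl): the integral is bounded below by gam_min / (2 cJ) times this logarithm,
   hence by more than h. The maximum with 0 keeps it positive when h is negative. *)
pose (k := Rmax h 0 * (2 * cJ / gam_min) + 1).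
assert (hk : 0 < k).
{ unfold k; assert (0 <= Rmax h 0 * (2 * cJ / gam_min)); [|lra].
  apply Rmult_le_pos; [apply Rmax_r | left; apply Rdiv_lt_0_compat; lra]. }
pose (dl := as' * exp (- k)).
assert (hdl : 0 < dl < as').
{ unfold dl; assert (exp (- k) < 1) by (rewrite <- exp_0; apply exp_increasing; lra).
  pose proof (exp_pos (- k)); nra. }
pose (ud := sin (as' - dl)).
assert (hud : 0 < ud < sin as').
{ unfold ud; split; [apply sin_gt_0; lra | apply sin_increasing_1; lra]. }
assert (hud1 : ud <= 1) by (apply SIN_bound).
assert (sas : forall u, 0 <= u <= ud -> 0 < Jf u).
{ intros u hu.
  assert (e : sin (asin u) = u) by (apply sin_asin; lra).
  pose proof (asin_bound u) as hb1.
  rewrite <- e; apply h3.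
  assert (a0 : 0 <= asin u).
  { destruct (Rle_dec 0 (asin u)) as [|n]; trivial; exfalso.
    assert (sin (asin u) < sin 0) by (apply sin_increasing_1; lra); rewrite sin_0 in *; lra. }
  split; trivial.
  destruct (Rlt_dec (asin u) as') as [|n]; trivial; exfalso.
  assert (sin as' <= sin (asin u)) by (apply sin_incr_1; lra); lra. }
destruct (continuity_ab_min Jf 0 ud) as [um [hm1 hm2]]; [lra|intros; apply continuity_pt_filterlim, Jf_continuous|].
set (e := Jf um) in *; assert (he : 0 < e) by (apply sas; trivial).
assert (hcd : 0 < cJ * dl) by (apply Rmult_lt_0_compat; lra).
(* With V <= cJ dl up to the angle as' - dl, the linear bound on Jf gives Thx <= 2 cJ (as' - a)
   there. *)
pose (x1 := ln (cJ * dl) - mn * cQ / e).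
assert (V : forall u, 0 <= u <= ud -> exp (orb x1 u) <= cJ * dl).
{ intros u hu; rewrite <- (exp_ln _ hcd); apply exp_le_mono.
  apply Rle_trans with (x1 + mn * cQ / e); [|unfold x1; lra].
  apply orb_dec_rate; trivial; [lra|]; intros; apply hm1; lra. }
exists x1.
pose (g := fun a => gam_min / (2 * cJ) * / (as' - a)).
pose (G := fun a => gam_min / (2 * cJ) * - ln (as' - a)).
assert (dG : forall a, a < as' -> is_derive G a (g a)).
{ intros a ha; unfold G, g; apply (is_derive_scal (fun a => - ln (as' - a))).
  auto_derive; [lra|]; field; lra. }
assert (iG : is_RInt g 0 (as' - dl) (G (as' - dl) - G 0)).
{ apply (is_RInt_derive G g).
  - intros a ha; rewrite Rmin_left, Rmax_right in ha by lra; apply dG; lra.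
  - intros a ha; rewrite Rmin_left, Rmax_right in ha by lra; apply cont_mult; [apply cont_const|].
    apply cont_inv; [apply cont_minus; [apply cont_const | apply cont_id] | lra]. }
assert (vG : G (as' - dl) - G 0 = gam_min / (2 * cJ) * k).
{ unfold G; replace (as' - (as' - dl)) with dl by ring; rewrite Rminus_0_r; unfold dl.
  rewrite ln_mult, ln_exp by (try apply exp_pos; lra); ring. }
assert (h < gam_min / (2 * cJ) * k).
{ unfold k; rewrite Rmult_plus_distr_l.
  replace (gam_min / (2 * cJ) * (Rmax h 0 * (2 * cJ / gam_min))) with (Rmax h 0) by (field; lra).
  pose proof (Rmax_l h 0); assert (0 < gam_min / (2 * cJ)) by (apply Rdiv_lt_0_compat; lra); lra. }
assert (i1 : gam_min / (2 * cJ) * k <= RInt (tau x1) 0 (as' - dl)).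
{ rewrite <- vG, <- (is_RInt_unique _ _ _ _ iG).
  apply RInt_le; [lra | eexists; exact iG | apply tau_ex_RInt|].
  intros a ha.
  assert (hs : 0 <= sin a <= ud).
  { split; [apply sin_ge_0; lra | left; apply sin_increasing_1; lra]. }
  assert (t1 : Thx x1 a <= 2 * cJ * (as' - a)).
  { unfold Thx; rewrite Th_Jf; pose proof (lin a ltac:(lra)); specialize (V (sin a) hs).
    pose proof (mul_sp_nonneg qn (sin a)).
    pose proof (sp_le_1 qn (sin a) qn_pos (sin_abs a)) as hq'; apply Rabs_le_between in hq'.
    assert (sin a * sp qn (sin a) <= 1) by nra; pose proof (exp_pos (orb x1 (sin a))).
    assert (exp (orb x1 (sin a)) * (sin a * sp qn (sin a)) <= cJ * dl) by nra.
    assert (cJ * dl <= cJ * (as' - a)) by (apply Rmult_le_compat_l; lra); lra. }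
  pose proof (Thx_pos x1 a); unfold g, tau.
  replace (gam_min / (2 * cJ) * / (as' - a)) with (gam_min * / (2 * cJ * (as' - a))) by (field; lra).
  apply Rmult_le_compat; [lra| |apply Gam_ge, sin_abs|apply Rinv_le_contravar; trivial].
  left; apply Rinv_0_lt_compat; lra. }
assert (i2 : 0 <= RInt (tau x1) (as' - dl) PI).
{ apply RInt_ge_0; [lra | apply tau_ex_RInt|]; intros; left; apply tau_pos. }
unfold half_period; rewrite <- (RInt_Chasles (V := R_CompleteNormedModule) (tau x1) 0 (as' - dl) PI) by apply tau_ex_RInt.
unfold plus; simpl; lra.
Qed.

Lemma half_period_onto (h : R) : 0 < h -> (C < gq p b -> h < RInt tau_lim 0 PI) ->
  exists x1, half_period x1 = h.
Proof.
intros hh hl.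
destruct (half_period_small h hh) as [xb hxb].
assert (ex : exists xa, h < half_period xa).
{ destruct (Rlt_dec C (gq p b)); [apply half_period_near_lim; auto | apply half_period_unbounded; lra]. }
destruct ex as [xa hxa].
destruct (IVT_gen half_period xa xb h) as [x [_ e]].
- intros x; apply continuity_pt_filterlim, half_period_continuous.
- rewrite Rmin_right, Rmax_left; lra.
- exists x; trivial.
Qed.

(** * The periodic function carried by an orbit *)

Section Bump.

Variable x1 : R.

Definition clock (a : R) : R := RInt (tau x1) 0 a.

Let H := half_period x1.

Lemma half_period_pos : 0 < H.
Proof.
apply RInt_gt_0; [apply PI_RGT_0 | intros; apply tau_pos | intros; apply tau_continuous].
Qed.

Lemma is_derive_clock (a : R) : is_derive clock a (tau x1 a).
Proof. apply (is_derive_RInt0 (tau x1)); intros; apply tau_continuous. Qed.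

Lemma clock_0 : clock 0 = 0.
Proof. apply (RInt_point (V := R_CompleteNormedModule)). Qed.

Lemma clock_plus_pi (a : R) : clock (a + PI) = clock a + H.
Proof.
assert (h : forall a c, a <= c -> clock (a + PI) - clock a = clock (c + PI) - clock c).
{ clear a; intros a c hac.
  apply (derive_zero_eq (fun a => clock (a + PI) - clock a) (fun a => tau x1 (a + PI) - tau x1 a)); trivial.
  - intros t _; apply (is_derive_minus (fun a => clock (a + PI)) clock); [|apply is_derive_clock].
    replace (tau x1 (t + PI)) with (1 * tau x1 (t + PI)) by ring.
    apply (is_derive_comp clock (fun t => t + PI)); [apply is_derive_clock | auto_derive; trivial].
  - intros t _; apply cont_minus; [|eapply is_derive_continuous, is_derive_clock].
    apply (cont_comp (fun t => t + PI) clock); [apply cont_plus; [apply cont_id | apply cont_const]|].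
    eapply is_derive_continuous, is_derive_clock.
  - intros; rewrite tau_periodic; ring. }
assert (e0 : clock (0 + PI) - clock 0 = H) by (rewrite clock_0, Rplus_0_l; unfold clock, H, half_period; ring).
destruct (Rle_dec a 0) as [l|l]; [pose proof (h a 0 l) | pose proof (h 0 a ltac:(lra))]; lra.
Qed.

Lemma tau_lower : exists c, 0 < c /\ forall a, c <= tau x1 a.
Proof.
pose proof PI_RGT_0.
destruct (continuity_ab_min (tau x1) 0 PI) as [am [h _]]; [lra|intros; apply continuity_pt_filterlim, tau_continuous|].
exists (tau x1 am); split; [apply tau_pos|]; intros a.
destruct (shift_into PI a 0) as [k hk]; trivial.
rewrite <- (periodic_IZR (tau x1) PI k a (tau_periodic x1)); apply h; lra.
Qed.

Lemma clock_growth : exists c, 0 < c /\ forall a a', a <= a' -> c * (a' - a) <= clock a' - clock a.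
Proof.
destruct tau_lower as [c [hc h]]; exists c; split; trivial; intros a a' haa.
assert (clock a - c * a <= clock a' - c * a'); [|lra].
apply (derive_nonneg_le (fun a => clock a - c * a) (fun a => tau x1 a - c)); trivial.
- intros t _; apply (is_derive_minus clock (fun a => c * a)); [apply is_derive_clock | auto_derive; trivial; ring].
- intros t _; apply cont_minus; [eapply is_derive_continuous, is_derive_clock | apply cont_mult; [apply cont_const | apply cont_id]].
- intros t _; specialize (h t); lra.
Qed.

Lemma clock_surjective (s : R) : exists a, clock a = s.
Proof.
destruct clock_growth as [c [hc h]].
pose (N := Rabs s / c).
assert (hN : 0 <= N) by (apply Rdiv_le_0_compat; [apply Rabs_pos | trivial]).
pose proof (h 0 N hN) as h1; pose proof (h (- N) 0 ltac:(lra)) as h2; rewrite clock_0 in h1, h2.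
assert (e : c * N = Rabs s) by (unfold N; field; lra).
pose proof (Rle_abs s); pose proof (Rle_abs (- s)); rewrite Rabs_Ropp in *.
destruct (IVT_gen clock (- N) N s) as [a [_ ea]].
- intros a; apply continuity_pt_filterlim; eapply is_derive_continuous, is_derive_clock.
- unfold Rmin, Rmax; repeat destruct Rle_dec; lra.
- exists a; trivial.
Qed.

Definition ang (s : R) : R := proj1_sig (constructive_indefinite_description _ (clock_surjective s)).

Lemma clock_ang (s : R) : clock (ang s) = s.
Proof. unfold ang; apply (proj2_sig (constructive_indefinite_description _ (clock_surjective s))). Qed.

Lemma clock_injective (a a' : R) : clock a = clock a' -> a = a'.
Proof.
intros e; destruct clock_growth as [c [hc h]].
destruct (Rtotal_order a a') as [l|[l|l]]; trivial; exfalso.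
- specialize (h a a' ltac:(lra)); nra.
- specialize (h a' a ltac:(lra)); nra.
Qed.

Lemma ang_clock (a : R) : ang (clock a) = a.
Proof. apply clock_injective, clock_ang. Qed.

Lemma ang_increasing (s s' : R) : s < s' -> ang s < ang s'.
Proof.
intros l; destruct (Rlt_dec (ang s) (ang s')) as [|n]; trivial; exfalso.
destruct clock_growth as [c [hc h]]; specialize (h (ang s') (ang s) ltac:(lra)).
rewrite !clock_ang in h; nra.
Qed.

Lemma ang_0 : ang 0 = 0.
Proof. rewrite <- clock_0 at 1; apply ang_clock. Qed.

Lemma ang_plus (s : R) : ang (s + H) = ang s + PI.
Proof. apply clock_injective; rewrite clock_plus_pi, !clock_ang; trivial. Qed.

Lemma ang_continuous (s : R) : continuous ang s.
Proof.
destruct clock_growth as [c [hc h]].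
apply continuous_abs_bound; intros eps he; exists (c * eps); split; [apply Rmult_lt_0_compat; trivial|].
intros t ht; apply Rabs_lt_between in ht; apply Rabs_lt_between.
destruct (Rle_dec (ang s) (ang t)) as [l|l].
- specialize (h _ _ l); rewrite !clock_ang in h; split; [lra|].
  apply (Rmult_lt_reg_l c); trivial; lra.
- specialize (h (ang t) (ang s) ltac:(lra)); rewrite !clock_ang in h; split; [|lra].
  apply (Rmult_lt_reg_l c); trivial; lra.
Qed.

Lemma is_derive_ang (s : R) : is_derive ang s (Thx x1 (ang s) / Gam (sin (ang s))).
Proof.
pose proof (tau_pos x1 (ang s)); pose proof (Thx_pos x1 (ang s)); pose proof (Gam_pos (sin (ang s)) (sin_abs _)).
replace (Thx x1 (ang s) / Gam (sin (ang s))) with (1 / tau x1 (ang s)) by (unfold tau; field; lra).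
apply (is_derive_of_comp clock); [lra | apply ang_continuous | apply is_derive_clock|].
apply is_derive_ext with (fun s => s); [intros; symmetry; apply clock_ang | apply @is_derive_id].
Qed.

(* Inverts V = b^(1-p) rho^m. *)
Definition rho (a : R) : R := exp ((orb x1 (sin a) - (1 - p) * ln b) / mn).

Lemma rho_pos (a : R) : 0 < rho a.
Proof. apply exp_pos. Qed.

Definition Qx (a : R) : R := Qf (sin a) (exp (orb x1 (sin a))).

Lemma is_derive_rho (a : R) : is_derive rho a (- rho a * (Qx a / Thx x1 a) * cos a).
Proof.
pose proof mn_pos; pose proof (Thx_pos x1 a).
assert (d : is_derive (fun a => (orb x1 (sin a) - (1 - p) * ln b) / mn) a (- (Qx a / Thx x1 a) * cos a)).
{ apply is_derive_ext with (fun a => / mn * (orb x1 (sin a) - (1 - p) * ln b)); [intros; unfold Rdiv; apply Rmult_comm|].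
  replace (- (Qx a / Thx x1 a) * cos a) with (/ mn * (cos a * (- mn * Qx a / Thx x1 a) - 0)) by (field; lra).
  apply (is_derive_scal (fun a => orb x1 (sin a) - (1 - p) * ln b)).
  apply (is_derive_minus (fun a => orb x1 (sin a)) (fun _ => (1 - p) * ln b)); [|apply @is_derive_const].
  apply (is_derive_comp (orb x1) sin).
  - apply (orbit_derive x1); [apply orb_spec | apply sin_abs].
  - apply is_derive_Reals, derivable_pt_lim_sin. }
replace (- rho a * (Qx a / Thx x1 a) * cos a) with (- (Qx a / Thx x1 a) * cos a * rho a) by ring.
apply (is_derive_comp exp (fun a => (orb x1 (sin a) - (1 - p) * ln b) / mn)); [apply is_derive_exp | exact d].
Qed.

Definition bump (s : R) : R := rho (ang s) * sin (ang s).
Definition dbump (s : R) : R := b * rho (ang s) * cos (ang s).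

Lemma Thx_Qx (a : R) : Thx x1 a = b * Gam (sin a) + sin a * Qx a.
Proof. reflexivity. Qed.

Lemma is_derive_rho_ang (s : R) : is_derive (fun s => rho (ang s)) s
  (- rho (ang s) * cos (ang s) * Qx (ang s) / Gam (sin (ang s))).
Proof.
pose proof (Thx_pos x1 (ang s)); pose proof (Gam_pos (sin (ang s)) (sin_abs _)).
replace (- rho (ang s) * cos (ang s) * Qx (ang s) / Gam (sin (ang s))) with
  ((Thx x1 (ang s) / Gam (sin (ang s))) * (- rho (ang s) * (Qx (ang s) / Thx x1 (ang s)) * cos (ang s))) by (field; lra).
apply (is_derive_comp rho ang); [apply is_derive_rho | apply is_derive_ang].
Qed.

Lemma is_derive_bump (s : R) : is_derive bump s (dbump s).
Proof.
pose proof (Gam_pos (sin (ang s)) (sin_abs _)).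
assert (d2 : is_derive (fun s => sin (ang s)) s (Thx x1 (ang s) / Gam (sin (ang s)) * cos (ang s))).
{ apply (is_derive_comp sin ang); [apply is_derive_Reals, derivable_pt_lim_sin | apply is_derive_ang]. }
pose proof (is_derive_mult _ _ s _ _ (is_derive_rho_ang s) d2 Rmult_comm) as d.
match type of d with is_derive _ _ ?v => replace (dbump s) with v end; [exact d|].
unfold plus, mult, dbump; simpl; rewrite Thx_Qx; field; lra.
Qed.

Definition bump_flux (s : R) : R := Rpower (b * rho (ang s)) (p - 1) * cos (ang s).
Definition dbump_flux (s : R) : R :=
  - (Rpower (b * rho (ang s)) (p - 1) * (b * sin (ang s) + Qx (ang s))).

Lemma is_derive_bump_flux (s : R) : is_derive bump_flux s (dbump_flux s).
Proof.
pose proof (Gam_pos (sin (ang s)) (sin_abs _)) as hG; pose proof (rho_pos (ang s)).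
assert (hbr : 0 < b * rho (ang s)) by (apply Rmult_lt_0_compat; trivial).
assert (d1 : is_derive (fun s => Rpower (b * rho (ang s)) (p - 1)) s
  ((p - 1) * Rpower (b * rho (ang s)) (p - 1 - 1) * (b * (- rho (ang s) * cos (ang s) * Qx (ang s) / Gam (sin (ang s)))))).
{ apply (is_derive_Rpower (fun s => b * rho (ang s))); trivial.
  apply (is_derive_scal (fun s => rho (ang s))), is_derive_rho_ang. }
assert (d2 : is_derive (fun s => cos (ang s)) s (Thx x1 (ang s) / Gam (sin (ang s)) * - sin (ang s))).
{ apply (is_derive_comp cos ang); [apply is_derive_Reals, derivable_pt_lim_cos | apply is_derive_ang]. }
pose proof (is_derive_mult _ _ s _ _ d1 d2 Rmult_comm) as d.
match type of d with is_derive _ _ ?v => replace (dbump_flux s) with v end; [exact d|].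
unfold plus, mult, dbump_flux; simpl; rewrite Thx_Qx.
assert (e : Rpower (b * rho (ang s)) (p - 1) = Rpower (b * rho (ang s)) (p - 1 - 1) * (b * rho (ang s))).
{ rewrite <- Rpower_succ by trivial; f_equal; ring. }
rewrite e.
assert (eG : Gam (sin (ang s)) = sin (ang s) ^ 2 + (p - 1) * cos (ang s) ^ 2).
{ unfold Gam; pose proof (sin2_cos2 (ang s)) as e2; unfold Rsqr in e2.
  replace (1 - sin (ang s) ^ 2) with (cos (ang s) ^ 2) by (simpl; lra); trivial. }
(* Gam (sin a) = sin^2 a + (p-1) cos^2 a is exactly the weight with which Q occurs, so Gam
   cancels. *)
transitivity (- (Rpower (b * rho (ang s)) (p - 1 - 1) * (b * rho (ang s))) *
  (b * sin (ang s) * Gam (sin (ang s)) + Qx (ang s) * (sin (ang s) ^ 2 + (p - 1) * cos (ang s) ^ 2)) /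
  Gam (sin (ang s))).
- field; lra.
- rewrite <- eG; field; lra.
Qed.

Lemma ang_comp_continuous (g : R -> R) (s : R) : (forall a, continuous g a) -> continuous (fun s => g (ang s)) s.
Proof. intros h; apply (cont_comp ang g); [apply ang_continuous | apply h]. Qed.

Lemma rho_continuous (a : R) : continuous rho a.
Proof. eapply is_derive_continuous, is_derive_rho. Qed.

Lemma cos_cont (a : R) : continuous cos a.
Proof. apply continuity_pt_filterlim, continuity_cos. Qed.

Lemma Qx_continuous (a : R) : continuous Qx a.
Proof.
apply (cont_comp sin (fun u => Qf u (exp (orb x1 u)))); [apply sin_cont|].
apply (Qf_continuous (fun u => exp (orb x1 u)) (fun u => u)); [apply cont_id|].
apply exp_comp_continuous, (orbit_continuous x1); [apply orb_spec | apply sin_abs].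
Qed.

Lemma bump_continuous (s : R) : continuous bump s.
Proof. eapply is_derive_continuous, is_derive_bump. Qed.

Lemma dbump_continuous (s : R) : continuous dbump s.
Proof.
apply (ang_comp_continuous (fun a => b * rho a * cos a)); intros a.
apply cont_mult; [apply cont_mult; [apply cont_const | apply rho_continuous] | apply cos_cont].
Qed.

Lemma dbump_flux_continuous (s : R) : continuous dbump_flux s.
Proof.
apply (ang_comp_continuous (fun a => - (Rpower (b * rho a) (p - 1) * (b * sin a + Qx a)))); intros a.
pose proof (rho_pos a); apply cont_opp, cont_mult.
- eapply is_derive_continuous, (is_derive_Rpower (fun a => b * rho a)); [apply Rmult_lt_0_compat; trivial|].
  apply (is_derive_scal rho), is_derive_rho.
- apply cont_plus; [apply cont_mult; [apply cont_const | apply sin_cont] | apply Qx_continuous].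
Qed.

Lemma bump_antiperiodic (s : R) : bump (s + H) = - bump s.
Proof.
unfold bump, rho; rewrite ang_plus, neg_sin.
destruct (orb_spec x1) as [_ [ev _]]; rewrite ev by apply sin_abs; ring.
Qed.

Lemma bump_periodic (s : R) : bump (s + 2 * H) = bump s.
Proof. replace (s + 2 * H) with (s + H + H) by ring; rewrite !bump_antiperiodic; ring. Qed.

Lemma bump_0 : bump 0 = 0.
Proof. unfold bump; rewrite ang_0, sin_0; ring. Qed.

Lemma dbump_0 : dbump 0 = b * exp ((x1 - (1 - p) * ln b) / mn).
Proof. unfold dbump, rho; rewrite ang_0, sin_0, cos_0, orb_0; ring. Qed.

Lemma dbump_H : dbump H = - dbump 0.
Proof.
unfold dbump, rho; replace H with (0 + H) by ring; rewrite ang_plus, neg_sin, neg_cos.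
destruct (orb_spec x1) as [_ [ev _]]; rewrite ev by apply sin_abs; ring.
Qed.

Lemma bump_pos (s : R) : 0 < s < H -> 0 < bump s.
Proof.
intros hs; unfold bump; apply Rmult_lt_0_compat; [apply rho_pos|].
pose proof (ang_increasing 0 s (proj1 hs)) as i1; pose proof (ang_increasing s H (proj2 hs)) as i2.
replace H with (0 + H) in i2 by ring; rewrite ang_plus, ang_0 in i2; rewrite ang_0 in i1.
apply sin_gt_0; lra.
Qed.

Lemma bump_neg (s : R) : H < s < 2 * H -> bump s < 0.
Proof.
intros hs; replace s with (s - H + H) by ring; rewrite bump_antiperiodic.
pose proof (bump_pos (s - H) ltac:(lra)); lra.
Qed.

(** Zeros occur at the multiples of H with alternating signs of the derivative. The rising ones fix
    the phase when a solution is matched with [bump], and quantize H when the solution closes up. *)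
Lemma bump_zero_up (s : R) : bump s = 0 -> 0 < dbump s -> exists k : Z, s = IZR k * (2 * H).
Proof.
intros h0 h1; pose proof half_period_pos.
destruct (shift_into (2 * H) s 0) as [k hk]; [lra|].
assert (per : forall s, dbump (s + 2 * H) = dbump s).
{ intros t; unfold dbump, rho; replace (t + 2 * H) with (t + H + H) by ring.
  rewrite !ang_plus, !neg_sin, Ropp_involutive, !neg_cos; ring. }
rewrite <- (periodic_IZR bump (2 * H) k s bump_periodic) in h0.
rewrite <- (periodic_IZR dbump (2 * H) k s per) in h1.
set (t := s + IZR k * (2 * H)) in *.
destruct (Req_dec t 0) as [e|ne].
- exists (- k)%Z; rewrite opp_IZR; unfold t in e; lra.
- destruct (Rtotal_order t H) as [l|[e|l]].
  + pose proof (bump_pos t ltac:(lra)); lra.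
  + rewrite e, dbump_H, dbump_0 in h1.
    pose proof (exp_pos ((x1 - (1 - p) * ln b) / mn)); nra.
  + pose proof (bump_neg t ltac:(lra)); lra.
Qed.

(** A shorter period would be a zero in (0, 2 H), and H is the only one; but H is an antiperiod. *)
Lemma bump_least_period : is_least_period bump (2 * H).
Proof.
pose proof half_period_pos as hH; split; [lra|]; split; [apply bump_periodic|].
intros T hT per.
pose proof (per 0) as e0; rewrite Rplus_0_l, bump_0 in e0.
destruct (Rtotal_order T H) as [l|[e|l]].
- pose proof (bump_pos T ltac:(lra)); lra.
- subst T; pose proof (per (H / 2)) as e1; rewrite bump_antiperiodic in e1.
  pose proof (bump_pos (H / 2) ltac:(lra)); lra.
- pose proof (bump_neg T ltac:(lra)); lra.
Qed.

End Bump.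

End Polar.

(** * Classification of sign changing solutions *)

Lemma lim_right_ge (g : R -> R) (a c v : R) : a < c -> continuous g a ->
  (forall t, a < t < c -> v <= g t) -> v <= g a.
Proof.
intros hac hc h; destruct (Rle_dec v (g a)) as [|n]; trivial; exfalso.
destruct (continuous_eps g a (v - g a) hc ltac:(lra)) as [d [hd h2]].
pose (t := Rmin (a + d / 2) ((a + c) / 2)).
assert (a < t < c /\ t < a + d) by (unfold t, Rmin; destruct Rle_dec; lra).
specialize (h t ltac:(lra)); specialize (h2 t ltac:(apply Rabs_lt_between; lra)).
apply Rabs_lt_between in h2; lra.
Qed.

Lemma lim_left_ge (g : R -> R) (a c v : R) : a < c -> continuous g c ->
  (forall t, a < t < c -> v <= g t) -> v <= g c.
Proof.
intros hac hc h.
assert (c' : continuous (fun t => g (- t)) (- c)).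
{ apply (cont_comp Ropp g); [apply (cont_opp (fun t => t)), cont_id | rewrite Ropp_involutive; trivial]. }
rewrite <- (Ropp_involutive c); apply (lim_right_ge (fun t => g (- t)) (- c) (- a)); trivial; [lra|].
intros t ht; apply h; lra.
Qed.

Lemma lim_right_eq (g : R -> R) (a c v : R) : a < c -> continuous g a ->
  (forall t, a < t < c -> g t = v) -> g a = v.
Proof.
intros hac hc h; apply Rle_antisym.
- apply Ropp_le_cancel, (lim_right_ge (fun t => - g t) a c); trivial; [apply cont_opp; trivial|].
  intros t ht; rewrite h; trivial; lra.
- apply (lim_right_ge g a c); trivial; intros t ht; rewrite h; trivial; lra.
Qed.

Lemma lim_left_eq (g : R -> R) (a c v : R) : a < c -> continuous g c ->
  (forall t, a < t < c -> g t = v) -> g c = v.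
Proof.
intros hac hc h; apply Rle_antisym.
- apply Ropp_le_cancel, (lim_left_ge (fun t => - g t) a c); trivial; [apply cont_opp; trivial|].
  intros t ht; rewrite h; trivial; lra.
- apply (lim_left_ge g a c); trivial; intros t ht; rewrite h; trivial; lra.
Qed.

Section SignChanging.

Variables (p q c : R).
Hypotheses (hp : 1 < p) (hq : p - 1 < q).

Let b := beta_q p q.
Let hb : 0 < b := b_pos p q hp hq.
Let C := Cn p q c.

Lemma mnE : mn p b = q + 1 - p.
Proof. exact (p_div_b p q hp hq). Qed.

Lemma qnE : qn p b = q.
Proof. pose proof mnE; unfold qn, mn in *; lra. Qed.

Lemma ln_kn : ln (kn p q) = (1 - p) * ln b.
Proof. unfold kn, Rpower; apply ln_exp. Qed.

Lemma bump_solution (x1 psi : R) (k : nat) : (1 <= k)%nat ->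
  half_period p b C hp hb x1 = PI / INR k ->
  sign_changing_solution p q c (fun s => bump p b C hp hb x1 (s + psi)).
Proof.
intros hk hH.
assert (hk' : 0 < INR k) by (apply lt_0_INR; lia).
set (B := bump p b C hp hb x1).
assert (shift : forall (g dg : R -> R), (forall s, is_derive g s (dg s)) ->
   forall s, is_derive (fun s => g (s + psi)) s (dg (s + psi))).
{ intros g dg h s; replace (dg (s + psi)) with (1 * dg (s + psi)) by ring.
  apply (is_derive_comp g (fun s => s + psi)); [apply h | auto_derive; trivial]. }
assert (shiftc : forall (g : R -> R), (forall s, continuous g s) -> forall s, continuous (fun s => g (s + psi)) s).
{ intros g h s; apply (cont_comp (fun s => s + psi) g); [apply cont_plus; [apply cont_id | apply cont_const] | apply h]. }
pose proof (shift _ _ (is_derive_bump p b C hp hb x1)) as dB; fold B in dB.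
pose proof (shift _ _ (is_derive_bump_flux p b C hp hb x1)) as dF.
assert (DB : forall s, Derive (fun s => B (s + psi)) s = dbump p b C hp hb x1 (s + psi)).
{ intros s; apply is_derive_unique, dB. }
assert (en : forall s, energy_pow p q (fun s => B (s + psi)) s = Rpower (b * rho p b C hp hb x1 (ang p b C hp hb x1 (s + psi))) (p - 2)).
{ intros s; unfold energy_pow; rewrite DB; fold b; unfold B, bump, dbump.
  pose proof (rho_pos p b C hp hb x1 (ang p b C hp hb x1 (s + psi))) as hr.
  set (r := rho p b C hp hb x1 _) in *; set (a := ang p b C hp hb x1 (s + psi)).
  replace (b ^ 2 * (r * sin a) ^ 2 + (b * r * cos a) ^ 2) with ((b * r) ^ 2 * (Rsqr (sin a) + Rsqr (cos a))) by (unfold Rsqr; ring).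
  rewrite sin2_cos2, Rmult_1_r, Rpower_sq by (apply Rmult_lt_0_compat; trivial); f_equal; field. }
assert (fl : forall s, bump_flux p b C hp hb x1 (s + psi) = flux p q (fun s => B (s + psi)) s).
{ intros s; unfold flux; rewrite DB, en; unfold bump_flux, dbump.
  pose proof (rho_pos p b C hp hb x1 (ang p b C hp hb x1 (s + psi))) as hr.
  replace (p - 1) with (p - 2 + 1) by ring; rewrite Rpower_succ by (apply Rmult_lt_0_compat; trivial); ring. }
assert (dfl : forall s, is_derive (flux p q (fun s => B (s + psi))) s (dbump_flux p b C hp hb x1 (s + psi))).
{ intros s; apply is_derive_ext with (2 := dF s); apply fl. }
split; [split; [|split; [|split]]|].
- intros s; unfold B.
  replace (s + 2 * PI + psi) with (s + psi + IZR (Z.of_nat k) * (2 * half_period p b C hp hb x1)).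
  + apply (periodic_IZR (bump p b C hp hb x1)), bump_periodic.
  + rewrite hH, <- INR_IZR_INZ; field; lra.
- intros s; split; [eexists; apply dB|].
  apply continuous_ext with (fun s => dbump p b C hp hb x1 (s + psi)); [intros; symmetry; apply DB|].
  apply shiftc, dbump_continuous.
- intros s; split; [eexists; apply dfl|].
  apply continuous_ext with (fun s => dbump_flux p b C hp hb x1 (s + psi)).
  + intros; symmetry; apply is_derive_unique, dfl.
  + apply shiftc, dbump_flux_continuous.
- intros s; rewrite (is_derive_unique _ _ _ (dfl s)), en.
  set (t := s + psi); set (a := ang p b C hp hb x1 t).
  pose proof (rho_pos p b C hp hb x1 a) as hr.
  change (Rpower (Rabs (B t)) (q - 1) * B t) with (sp q (B t)).
  replace (Rpower (Rabs (B t)) (p - 2) * B t) with (sp (p - 1) (B t)) by (unfold sp; do 2 f_equal; ring).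
  unfold dbump_flux, B, bump, Qx, Qf, Q0; fold a; rewrite !sp_scale by trivial; rewrite qnE.
  rewrite (lambda_qE p q hq); fold b; fold (gq p b).
  set (S1 := sp (p - 1) (sin a)); set (S2 := sp q (sin a)).
  assert (eV : exp (orb p b C hp hb x1 (sin a)) = Rpower (rho p b C hp hb x1 a) (q + 1 - p) * Rpower b (1 - p)).
  { unfold rho, Rpower; rewrite ln_exp, <- exp_plus; f_equal; rewrite mnE; field; lra. }
  rewrite eV; set (r := rho p b C hp hb x1 a) in *.
  rewrite <- !Rpower_mult_distr by trivial.
  replace (Rpower r q) with (Rpower r (p - 1) * Rpower r (q + 1 - p)) by (rewrite <- Rpower_plus; f_equal; ring).
  unfold C, Cn; fold b.
  replace (p - 1) with (p - 2 + 1) by ring; rewrite !(Rpower_succ _ (p - 2)) by trivial.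
  assert (e : Rpower b (1 - p) * (Rpower b (p - 2) * b) = 1).
  { rewrite <- (Rpower_succ b) by trivial; rewrite <- Rpower_plus.
    replace (1 - p + (p - 2 + 1)) with 0 by ring; apply Rpower_O; trivial. }
  unfold gq; set (B1 := Rpower b (1 - p)) in *; set (B2 := Rpower b (p - 2)) in *.
  set (F := Rpower r (p - 2)); set (G := Rpower r (q + 1 - p)).
  transitivity ((B1 * (B2 * b)) * (F * r * c * S1) - (B1 * (B2 * b)) * (F * r * G * S2) + F * r * G * S2 - c * (F * r * S1)).
  + ring.
  + rewrite e; ring.
- pose proof (half_period_pos p b C hp hb x1) as hHp; set (H := half_period p b C hp hb x1) in *.
  split.
  + exists (H / 2 - psi); replace (H / 2 - psi + psi) with (H / 2) by ring; apply bump_pos; fold H; lra.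
  + exists (3 * H / 2 - psi); replace (3 * H / 2 - psi + psi) with (3 * H / 2) by ring; apply bump_neg; fold H; lra.
Qed.

Lemma solution_opp (f : R -> R) : is_solution p q c f -> is_solution p q c (fun s => - f s).
Proof.
intros [per [c1 [c2 eq]]].
assert (D1 : forall s, Derive (fun s => - f s) s = - Derive f s) by (intros s; apply Derive_opp).
assert (en : forall s, energy_pow p q (fun s => - f s) s = energy_pow p q f s).
{ intros s; unfold energy_pow; rewrite D1; f_equal; ring. }
assert (fl : forall s, - flux p q f s = flux p q (fun s => - f s) s).
{ intros s; unfold flux; rewrite en, D1; ring. }
assert (dfl : forall s, is_derive (flux p q (fun s => - f s)) s (- Derive (flux p q f) s)).
{ intros s; apply is_derive_ext with (fun s => - flux p q f s); [exact fl|].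
  apply (is_derive_opp (flux p q f)), Derive_correct, c2. }
split; [|split; [|split]].
- intros s; rewrite per; trivial.
- intros s; split; [apply (ex_derive_opp f), c1|].
  apply continuous_ext with (fun s => - Derive f s); [intros; symmetry; apply D1|].
  apply cont_opp, c1.
- intros s; split; [eexists; apply dfl|].
  apply continuous_ext with (fun s => - Derive (flux p q f) s).
  + intros; symmetry; apply is_derive_unique, dfl.
  + apply cont_opp, c2.
- intros s; rewrite (is_derive_unique _ _ _ (dfl s)), en, Rabs_Ropp; specialize (eq s); lra.
Qed.

(** * Polar coordinates of a given solution *)

Section PolarCoordinates.

Variable (f : R -> R).
Hypothesis hf : is_solution p q c f.

Definition rsq (s : R) : R := f s ^ 2 + (Derive f s / b) ^ 2.
(* ln V and u = sin a for the polar coordinates of f *)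
Definition logV (s : R) : R := ln (kn p q) + mn p b / 2 * ln (rsq s).
Definition usin (s : R) : R := f s / sqrt (rsq s).
Definition ThF (s : R) : R := Th p b C (usin s) (exp (logV s)).

Lemma rsq_continuous (s : R) : continuous rsq s.
Proof.
apply cont_plus.
- apply (cont_comp f (fun y => y ^ 2)); [apply (sol_continuous p q c); trivial | apply cont_sq].
- apply (cont_comp (fun s => Derive f s / b) (fun y => y ^ 2)); [|apply cont_sq].
  apply cont_div; [apply (sol_derive_continuous p q c); trivial | apply cont_const | lra].
Qed.

Lemma logV_continuous (s : R) : 0 < rsq s -> continuous logV s.
Proof.
intros h; apply cont_plus; [apply cont_const|]; apply cont_mult; [apply cont_const|].
apply (cont_comp rsq ln); [apply rsq_continuous|].
eapply is_derive_continuous, is_derive_Reals, derivable_pt_lim_ln; trivial.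
Qed.

Lemma usin_continuous (s : R) : 0 < rsq s -> continuous usin s.
Proof.
intros h; apply cont_div; [apply (sol_continuous p q c); trivial| |].
- apply (cont_comp rsq sqrt); [apply rsq_continuous|].
  apply continuity_pt_filterlim, continuity_pt_sqrt; lra.
- pose proof (sqrt_lt_R0 _ h); lra.
Qed.

Section AtPositive.

Variable (s : R).
Hypothesis hs : 0 < f s.
Let y := slope p q f s.

Lemma rsq_slope (t : R) : 0 < f t -> rsq t = f t ^ 2 * (1 + slope p q f t ^ 2).
Proof. intros h; unfold rsq, slope; fold b; field; lra. Qed.

Lemma rsq_pos : 0 < rsq s.
Proof. rewrite rsq_slope by trivial; apply Rmult_lt_0_compat; [apply pow_lt; trivial | apply one_sq_pos]. Qed.

Lemma usin_slope (t : R) : 0 < f t -> usin t = pw (- (1 / 2)) (slope p q f t).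
Proof.
intros h; unfold usin; rewrite rsq_slope by trivial.
pose proof (one_sq_pos (slope p q f t)) as h1; pose proof (sqrt_lt_R0 _ h1).
rewrite sqrt_mult, sqrt_pow2 by (try apply pow2_ge_0; lra).
unfold pw; rewrite Rpower_Ropp; replace (1 / 2) with (/ 2) by field; rewrite Rpower_sqrt by trivial.
field; lra.
Qed.

Lemma usin_unit : 0 < usin s <= 1.
Proof.
rewrite usin_slope by trivial; split; [apply pw_pos|].
apply Rpower_le_1_neg; [pose proof (pow2_ge_0 (slope p q f s)); lra | lra].
Qed.

Lemma usin_sq : usin s ^ 2 * (1 + y ^ 2) = 1.
Proof.
rewrite usin_slope by trivial; fold y; rewrite <- (Rpower_1 (1 + y ^ 2)) by apply one_sq_pos.
change (Rpower (1 + y ^ 2) 1) with (pw 1 y).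
replace (pw (- (1 / 2)) y ^ 2 * pw 1 y) with (pw (- (1 / 2)) y * pw (- (1 / 2)) y * pw 1 y) by ring.
rewrite <- !pw_plus; replace (- (1 / 2) + - (1 / 2) + 1) with 0 by field.
unfold pw; apply Rpower_O, one_sq_pos.
Qed.

Lemma slope_usin : Rabs (y * usin s) <= 1.
Proof. pose proof usin_sq; apply Rabs_le_between; split; nra. Qed.

Lemma Gam_usin : Gam p (usin s) * (1 + y ^ 2) = 1 + (p - 1) * y ^ 2.
Proof.
pose proof usin_sq as e; unfold Gam.
replace ((usin s ^ 2 + (p - 1) * (1 - usin s ^ 2)) * (1 + y ^ 2)) with
  ((2 - p) * (usin s ^ 2 * (1 + y ^ 2)) + (p - 1) * (1 + y ^ 2)) by ring.
rewrite e; ring.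
Qed.

Lemma sp_usin (a : R) : sp a (usin s) = pw (- (a / 2)) y.
Proof.
rewrite sp_pos by apply usin_unit; rewrite usin_slope by trivial; fold y.
unfold pw; rewrite Rpower_mult; f_equal; field.
Qed.

Lemma exp_logV : exp (logV s) = kn p q * Rpower (f s) (q + 1 - p) * pw (mn p b / 2) y.
Proof.
pose proof (one_sq_pos y) as h1.
unfold logV; rewrite exp_plus, exp_ln by apply kn_pos; rewrite Rmult_assoc; f_equal.
rewrite rsq_slope by trivial; fold y; rewrite ln_mult by (trivial; apply pow_lt; trivial).
unfold pw, Rpower; rewrite <- exp_plus; f_equal.
replace (ln (f s ^ 2)) with (2 * ln (f s)); [rewrite mnE; field|].
rewrite <- (Rpower_pow 2) by trivial; unfold Rpower; rewrite ln_exp; simpl; ring.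
Qed.

(** The link between the two descriptions: the right-hand side is the numerator in the equation of
    the slope y = cot a. As u = (1 + y^2)^(-1/2), every term becomes a power of 1 + y^2, and the
    exponents add up because q + 1 - m = p. *)
Lemma ThF_slope : ThF s * pw (p / 2) y = bet p b y - C + kn p q * Rpower (f s) (q + 1 - p).
Proof.
unfold ThF, Th, Qf, Q0; rewrite exp_logV, !sp_usin.
set (z := kn p q * Rpower (f s) (q + 1 - p)).
assert (e1 : usin s * pw (- ((p - 1) / 2)) y * pw (p / 2) y = 1).
{ rewrite usin_slope by trivial; fold y; rewrite <- !pw_plus.
  replace (- (1 / 2) + - ((p - 1) / 2) + p / 2) with 0 by field; unfold pw; apply Rpower_O, one_sq_pos. }
assert (e2 : usin s * pw (mn p b / 2) y * pw (- (qn p b / 2)) y * pw (p / 2) y = 1).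
{ rewrite usin_slope by trivial; fold y; rewrite <- !pw_plus.
  replace (- (1 / 2) + mn p b / 2 + - (qn p b / 2) + p / 2) with 0; [unfold pw; apply Rpower_O, one_sq_pos|].
  pose proof (qn_mn p b); lra. }
pose proof usin_sq as e3; pose proof Gam_usin as e4.
unfold bet; rewrite (pw_half p).
rewrite (pw_half p) in e1, e2.
set (S := pw ((p - 2) / 2) y) in *.
transitivity (b * (Gam p (usin s) * (1 + y ^ 2)) * S + (gq p b - b) * (usin s ^ 2 * (1 + y ^ 2)) * S
  - C * (usin s * pw (- ((p - 1) / 2)) y * (S * (1 + y ^ 2)))
  + z * (usin s * pw (mn p b / 2) y * pw (- (qn p b / 2)) y * (S * (1 + y ^ 2)))).
- ring.
- rewrite e1, e2, e3, e4; unfold gq; ring.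
Qed.

Lemma Gam_usin_pos : 0 < Gam p (usin s).
Proof. apply Gam_pos; trivial; pose proof usin_unit; apply unit_abs; lra. Qed.

Lemma slope_derive_polar : is_derive (slope p q f) s (- (1 + y ^ 2) * ThF s / Gam p (usin s)).
Proof.
pose proof (slope_derive p q c hp hq f hf s hs) as d; fold b y C in d.
rewrite <- ThF_slope in d.
pose proof Gam_usin_pos; pose proof (one_sq_pos y); pose proof (pw_pos ((p - 2) / 2) y).
assert (e : dphi p y = pw ((p - 2) / 2) y * Gam p (usin s)).
{ unfold dphi; rewrite (pw_half2 p), <- Gam_usin; ring. }
rewrite e, (pw_half p) in d.
replace (- (1 + y ^ 2) * ThF s / Gam p (usin s)) with
  (- (ThF s * (pw ((p - 2) / 2) y * (1 + y ^ 2))) / (pw ((p - 2) / 2) y * Gam p (usin s))); [exact d|].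
field; lra.
Qed.

Lemma logV_derive : is_derive logV s (p * y - mn p b * y * ThF s / Gam p (usin s)).
Proof.
pose proof Gam_usin_pos; pose proof (one_sq_pos y).
apply is_derive_ext_loc with (fun t => ln (kn p q) + mn p b / 2 * (2 * ln (f t) + ln (1 + slope p q f t ^ 2))).
- destruct (continuous_pos_near f s (sol_continuous p q c f hf s) hs) as [d hd].
  exists d; intros t ht; specialize (hd t ht).
  unfold logV; rewrite rsq_slope by trivial; rewrite ln_mult by (try apply pow_lt; trivial; apply one_sq_pos).
  rewrite <- (Rpower_pow 2 (f t)) by trivial; unfold Rpower; rewrite ln_exp; simpl; do 3 f_equal; ring.
- assert (d1 : is_derive (fun t => ln (f t)) s (b * y)).
  { replace (b * y) with (Derive f s * / f s) by (unfold y, slope; fold b; field; lra).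
    apply (is_derive_comp ln f); [apply is_derive_Reals, derivable_pt_lim_ln; trivial | apply (sol_is_derive p q c); trivial]. }
  assert (d2 : is_derive (fun t => ln (1 + slope p q f t ^ 2)) s ((- (1 + y ^ 2) * ThF s / Gam p (usin s)) * (2 * y * / (1 + y ^ 2)))).
  { apply (is_derive_comp (fun v => ln (1 + v ^ 2)) (slope p q f)); [|apply slope_derive_polar].
    fold y; apply (is_derive_comp ln (fun v => 1 + v ^ 2)).
    - apply is_derive_Reals, derivable_pt_lim_ln, one_sq_pos.
    - auto_derive; trivial; ring. }
  replace (p * y - mn p b * y * ThF s / Gam p (usin s)) with
    (0 + mn p b / 2 * (2 * (b * y) + (- (1 + y ^ 2) * ThF s / Gam p (usin s)) * (2 * y * / (1 + y ^ 2)))).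
  + apply (is_derive_plus (fun _ : R => ln (kn p q)) (fun t => mn p b / 2 * (2 * ln (f t) + ln (1 + slope p q f t ^ 2)))); [apply @is_derive_const|].
    apply (is_derive_scal (fun t => 2 * ln (f t) + ln (1 + slope p q f t ^ 2))).
    apply (is_derive_plus (fun t => 2 * ln (f t)) (fun t => ln (1 + slope p q f t ^ 2))); trivial.
    apply (is_derive_scal (fun t => ln (f t))); trivial.
  + replace (p * y) with (mn p b * b * y) by (rewrite (mn_b p b hb); ring); field; lra.
Qed.

Lemma usin_derive : is_derive usin s (y * usin s * ThF s / Gam p (usin s)).
Proof.
pose proof Gam_usin_pos; pose proof (one_sq_pos y).
apply is_derive_ext_loc with (fun t => pw (- (1 / 2)) (slope p q f t)).
- destruct (continuous_pos_near f s (sol_continuous p q c f hf s) hs) as [d hd].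
  exists d; intros t ht; symmetry; apply usin_slope, hd; trivial.
- replace (y * usin s * ThF s / Gam p (usin s)) with
   ((- (1 + y ^ 2) * ThF s / Gam p (usin s)) * (2 * - (1 / 2) * y * pw (- (1 / 2) - 1) y)).
  + apply (is_derive_comp (pw (- (1 / 2))) (slope p q f)); [apply is_derive_pw | apply slope_derive_polar].
  + rewrite usin_slope by trivial; fold y.
    replace (pw (- (1 / 2)) y) with (pw (- (1 / 2) - 1) y * (1 + y ^ 2)) by (rewrite <- pw_succ; f_equal; ring).
    rewrite usin_slope in H by trivial; fold y in H.
    replace (pw (- (1 / 2)) y) with (pw (- (1 / 2) - 1) y * (1 + y ^ 2)) in H by (rewrite <- pw_succ; f_equal; ring).
    field; lra.
Qed.

End AtPositive.

(* logV is Lipschitz where f > 0, hence bounded below. *)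
Lemma nondegenerate_zero (a s0 : R) : a < s0 -> f a = 0 -> (forall t, a < t <= s0 -> 0 < f t) -> 0 < Derive f a.
Proof.
intros has ha hpos.
assert (dpos : 0 <= Derive f a).
{ destruct (Rle_dec 0 (Derive f a)) as [|n]; trivial; exfalso.
  destruct (derive_pos_local (fun t => - f t) a (- Derive f a)) as [e [he [h1 _]]]; [|lra|].
  - apply (is_derive_opp f), (sol_is_derive p q c); trivial.
  - pose (t := Rmin s0 (a + e / 2)).
    assert (a < t <= s0 /\ t < a + e) by (unfold t, Rmin; destruct Rle_dec; lra).
    specialize (h1 t ltac:(lra)); specialize (hpos t ltac:(lra)); lra. }
destruct dpos as [|e0]; trivial; exfalso.
assert (r0 : rsq a = 0) by (unfold rsq; rewrite ha, <- e0; field; lra).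
destruct (continuous_bounded rsq a s0) as [Br [hBr bBr]]; [lra|intros; apply rsq_continuous|].
pose proof (mn_pos p b hp hb) as hm.
pose proof (kn_pos p q) as hk.
pose (VB := kn p q * Rpower Br (mn p b / 2)).
assert (hV : forall t, a < t <= s0 -> exp (logV t) <= VB).
{ intros t ht; specialize (hpos t ht); pose proof (rsq_pos t hpos) as hr.
  specialize (bBr t ltac:(lra)); rewrite Rabs_pos_eq in bBr by lra.
  unfold logV, VB; rewrite exp_plus, exp_ln by trivial.
  apply Rmult_le_compat_l; [lra|]; apply exp_le_mono, Rmult_le_compat_l; [lra | apply ln_le; trivial]. }
pose proof (gam_min_pos p hp) as hg.
pose proof (cQ_pos p b C) as hcQ.
assert (hVB : 0 < VB) by (apply Rmult_lt_0_compat; trivial; apply Rpower_gt0).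
pose (K := mn p b * (cQ p b C + VB) / gam_min p).
assert (low : forall t, a < t < s0 -> logV s0 - K * (s0 - a) <= logV t).
{ intros t ht.
  assert (0 < K) by (apply Rdiv_lt_0_compat; trivial; apply Rmult_lt_0_compat; lra).
  assert (logV s0 - K * s0 <= logV t - K * t); [|nra].
  apply Ropp_le_cancel.
  apply (derive_nonneg_le (fun t => - (logV t - K * t)) (fun t => - ((p * slope p q f t - mn p b * slope p q f t * ThF t / Gam p (usin t)) - K))); [lra| | |].
  - intros r hr; apply (is_derive_opp (fun t => logV t - K * t)), (is_derive_minus logV (fun t => K * t)).
    + apply logV_derive, hpos; lra.
    + auto_derive; trivial; ring.
  - intros r hr; apply cont_opp, cont_minus.
    + apply logV_continuous, rsq_pos, hpos; lra.
    + apply cont_mult; [apply cont_const | apply cont_id].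
  - intros r hr.
    assert (hfr : 0 < f r) by (apply hpos; lra).
    pose proof (usin_unit r hfr) as hu; pose proof (slope_usin r hfr) as hyu.
    pose proof (Gam_usin_pos r hfr) as hG.
    assert (hG2 : gam_min p <= Gam p (usin r)) by (apply Gam_ge; trivial; apply unit_abs; lra).
    set (u := usin r) in *; set (yy := slope p q f r) in *.
    (* Since p = m b, the part b Gam of Th cancels. What remains contains the slope only through y u
       = cos a, bounded although y itself is unbounded near the zero. *)
    assert (e : p * yy - mn p b * yy * ThF r / Gam p u = - (mn p b * (yy * u * (Qf p b C u (exp (logV r)) / Gam p u)))).
    { replace (p * yy) with (mn p b * b * yy) by (rewrite (mn_b p b hb); ring).
      unfold ThF; fold u; unfold Th; field; lra. }
    rewrite e.
    assert (hQ : Rabs (Qf p b C u (exp (logV r))) <= cQ p b C + VB).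
    { unfold Qf; eapply Rle_trans; [apply Rabs_triang|]; apply Rplus_le_compat.
      - apply Q0_bound; trivial; apply unit_abs; lra.
      - rewrite Rabs_mult, (Rabs_pos_eq (exp _)) by (left; apply exp_pos).
        pose proof (sp_le_1 (qn p b) u (qn_pos p b hp hb) ltac:(apply unit_abs; lra)).
        specialize (hV r ltac:(lra)); pose proof (exp_pos (logV r)); pose proof (Rabs_pos (sp (qn p b) u)); nra. }
    assert (hR : Rabs (mn p b * (yy * u * (Qf p b C u (exp (logV r)) / Gam p u))) <= K).
    { unfold K, Rdiv; rewrite !Rabs_mult, Rabs_inv, (Rabs_pos_eq (mn p b)), (Rabs_pos_eq (Gam p u)) by lra.
      rewrite (Rmult_assoc (mn p b) (cQ p b C + VB)); apply Rmult_le_compat_l; [lra|].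
      rewrite <- Rabs_mult.
      assert (i : Rabs (Qf p b C u (exp (logV r))) * / Gam p u <= (cQ p b C + VB) * / gam_min p).
      { apply Rmult_le_compat; trivial; [apply Rabs_pos | left; apply Rinv_0_lt_compat; trivial | apply Rinv_le_contravar; trivial]. }
      assert (0 <= Rabs (Qf p b C u (exp (logV r))) * / Gam p u).
      { apply Rmult_le_pos; [apply Rabs_pos | left; apply Rinv_0_lt_compat; trivial]. }
      pose proof (Rabs_pos (yy * u)); nra. }
    apply Rabs_le_between in hR; lra. }
(* The lower bound on logV becomes rsq a >= v > 0 in the limit, whereas a degenerate zero has rsq a
   = 0. *)
pose (v := exp ((logV s0 - K * (s0 - a) - ln (kn p q)) * (2 / mn p b))).
assert (hv : v <= rsq a).
{ apply (lim_right_ge rsq a s0); trivial; [apply rsq_continuous|].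
  intros t ht; specialize (low t ht); pose proof (rsq_pos t (hpos t ltac:(lra))) as hr.
  rewrite <- (exp_ln (rsq t)) by trivial; apply exp_le_mono.
  unfold logV at 2 in low.
  replace (ln (rsq t)) with ((mn p b / 2 * ln (rsq t)) * (2 / mn p b)) by (field; lra).
  apply Rmult_le_compat_r; [left; apply Rdiv_lt_0_compat; lra | lra]. }
pose proof (exp_pos ((logV s0 - K * (s0 - a) - ln (kn p q)) * (2 / mn p b))); unfold v in hv; lra.
Qed.

Lemma logV_initial (a x1 : R) : f a = 0 -> Derive f a = dbump p b C hp hb x1 0 -> rsq a = exp ((x1 - ln (kn p q)) / mn p b) ^ 2 /\ logV a = x1.
Proof.
intros h0 h1; rewrite dbump_0 in h1; pose proof (mn_pos p b hp hb) as hm.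
assert (e : rsq a = exp ((x1 - ln (kn p q)) / mn p b) ^ 2).
{ unfold rsq; rewrite h0, h1, ln_kn; field; lra. }
split; trivial; unfold logV; rewrite e.
replace (exp ((x1 - ln (kn p q)) / mn p b) ^ 2) with (exp (2 * ((x1 - ln (kn p q)) / mn p b))).
- rewrite ln_exp; field; lra.
- replace (2 * ((x1 - ln (kn p q)) / mn p b)) with ((x1 - ln (kn p q)) / mn p b + (x1 - ln (kn p q)) / mn p b) by ring.
  rewrite exp_plus; ring.
Qed.

(* E = logV - orb usin vanishes at a and E' = p y u sp_q(u) (exp orb - exp logV) / Th. *)
Lemma logV_orbit (a t0 x1 : R) : a < t0 -> f a = 0 -> Derive f a = dbump p b C hp hb x1 0 ->
  (forall t, a < t <= t0 -> 0 < f t) -> logV t0 = orb p b C hp hb x1 (usin t0).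
Proof.
intros hat h0 h1 hpos; pose proof (mn_pos p b hp hb) as hm.
destruct (logV_initial a x1 h0 h1) as [ra la].
assert (rp : forall t, a <= t <= t0 -> 0 < rsq t).
{ intros t ht; destruct (Req_dec t a) as [->|n].
  - rewrite ra; apply pow_lt, exp_pos.
  - apply rsq_pos, hpos; lra. }
assert (ua : usin a = 0) by (unfold usin; rewrite h0; unfold Rdiv; ring).
assert (uu : forall t, a <= t <= t0 -> 0 <= usin t <= 1).
{ intros t ht; destruct (Req_dec t a) as [->|n]; [lra|].
  pose proof (usin_unit t (hpos t ltac:(lra))); lra. }
set (O := orb p b C hp hb x1).
assert (oO : orbit p b C x1 O) by apply orb_spec.
assert (cO : forall u, 0 <= u <= 1 -> continuous O u).
{ intros u hu; apply (orbit_continuous p b C x1); trivial; apply unit_abs; trivial. }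
pose (E := fun t => logV t - O (usin t)).
pose (ThO := fun u => Th p b C u (exp (O u))).
assert (hThO : forall u, 0 <= u <= 1 -> 0 < ThO u) by (intros u hu; apply oO, unit_abs; trivial).
pose (dE := fun t => p * slope p q f t * usin t * sp (qn p b) (usin t) * (exp (O (usin t)) - exp (logV t)) / ThO (usin t)).
assert (hE : forall t, a < t < t0 -> is_derive E t (dE t)).
{ intros t ht; assert (hft : 0 < f t) by (apply hpos; lra).
  pose proof (usin_unit t hft) as hu; pose proof (Gam_usin_pos t hft) as hG.
  pose proof (hThO (usin t) ltac:(lra)) as hT.
  assert (d2 : is_derive (fun t => O (usin t)) t
    ((slope p q f t * usin t * ThF t / Gam p (usin t)) * (- mn p b * Qf p b C (usin t) (exp (O (usin t))) / ThO (usin t)))).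
  { apply (is_derive_comp O usin); [|apply usin_derive; trivial].
    apply (orbit_derive p b C x1); trivial; apply unit_abs; lra. }
  pose proof (is_derive_minus _ _ t _ _ (logV_derive t hft) d2) as d.
  match type of d with is_derive _ _ ?v => replace (dE t) with v end; [exact d|].
  unfold minus, plus, opp, dE; simpl.
  assert (e1 : ThF t = ThO (usin t) - (exp (O (usin t)) - exp (logV t)) * (usin t * sp (qn p b) (usin t))).
  { unfold ThF, ThO; rewrite !Th_Jf; ring. }
  assert (e2 : usin t * Qf p b C (usin t) (exp (O (usin t))) = ThO (usin t) - b * Gam p (usin t)) by (unfold ThO, Th; ring).
  set (y := slope p q f t) in *; set (u := usin t) in *; set (T := ThO u) in *; set (G := Gam p u) in *.
  set (Qv := Qf p b C u (exp (O u))) in *.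
  transitivity (p * y - mn p b * y * ThF t / G + mn p b * y * ThF t / G * (u * Qv) / T); [field; lra|].
  rewrite e2; replace (p * y) with (mn p b * b * y) by (rewrite (mn_b p b hb); ring).
  transitivity (mn p b * b * y * (T - ThF t) / T); [field; lra|].
  rewrite e1, (mn_b p b hb); field; lra. }
assert (cE : forall t, a <= t <= t0 -> continuous E t).
{ intros t ht; apply cont_minus; [apply logV_continuous; auto|].
  apply (cont_comp usin O); [apply usin_continuous; auto | apply cO; auto]. }
destruct (continuous_bounded logV a t0) as [M1 [hM1 b1]]; [lra|intros; apply logV_continuous; auto|].
destruct (continuous_bounded O 0 1) as [M2 [hM2 b2]]; [lra|trivial|].
destruct (continuity_ab_min ThO 0 1) as [um [hum hum2]]; [lra| |].
{ intros u hu; apply continuity_pt_filterlim, (orbit_Th_continuous p b C hp hb x1); trivial; apply unit_abs; trivial. }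
set (e0 := ThO um) in *; assert (he0 : 0 < e0) by (apply hThO; trivial).
pose proof (exp_pos (M1 + M2)) as hexp.
pose (K := p * exp (M1 + M2) / e0).
assert (hK : 0 < K) by (apply Rdiv_lt_0_compat; trivial; apply Rmult_lt_0_compat; lra).
assert (bE : forall t, a < t < t0 -> Rabs (dE t) <= K * Rabs (E t)).
{ intros t ht; assert (hft : 0 < f t) by (apply hpos; lra).
  pose proof (uu t ltac:(lra)) as hu; pose proof (slope_usin t hft) as hyu.
  pose proof (hThO (usin t) hu) as hT; pose proof (hum (usin t) hu) as hT2; fold e0 in hT2.
  assert (vd : Rabs (exp (O (usin t)) - exp (logV t)) <= exp (M1 + M2) * Rabs (E t)).
  { unfold E; rewrite (Rabs_minus_sym (logV t)); apply exp_diff.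
    - pose proof (b2 (usin t) hu) as i; apply Rabs_le_between in i; lra.
    - pose proof (b1 t ltac:(lra)) as i; apply Rabs_le_between in i; lra. }
  unfold dE, Rdiv; rewrite !Rabs_mult, Rabs_inv, (Rabs_pos_eq p), (Rabs_pos_eq (ThO _)) by lra.
  pose proof (sp_le_1 (qn p b) (usin t) (qn_pos p b hp hb) ltac:(apply unit_abs; trivial)) as hsp.
  rewrite Rabs_mult in hyu.
  set (A1 := Rabs (slope p q f t)) in *; set (A2 := Rabs (usin t)) in *; set (A3 := Rabs (sp _ _)) in *.
  set (A4 := Rabs (exp _ - exp _)) in *.
  assert (0 <= A1) by apply Rabs_pos; assert (0 <= A2) by apply Rabs_pos.
  assert (0 <= A3) by apply Rabs_pos; assert (0 <= A4) by apply Rabs_pos.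
  assert (s1 : A1 * A2 * A3 <= 1) by (assert (0 <= A1 * A2) by (apply Rmult_le_pos; trivial); nra).
  assert (s2 : A1 * A2 * A3 * A4 <= exp (M1 + M2) * Rabs (E t)).
  { assert (0 <= A1 * A2 * A3) by (apply Rmult_le_pos; trivial; apply Rmult_le_pos; trivial); nra. }
  replace (K * Rabs (E t)) with (p * (exp (M1 + M2) * Rabs (E t)) * / e0) by (unfold K; field; lra).
  replace (p * A1 * A2 * A3 * A4) with (p * (A1 * A2 * A3 * A4)) by ring.
  apply Rmult_le_compat.
  - apply Rmult_le_pos; [lra|]; repeat apply Rmult_le_pos; trivial.
  - left; apply Rinv_0_lt_compat; trivial.
  - apply Rmult_le_compat_l; lra.
  - apply Rinv_le_contravar; trivial. }
destruct (gronwall (fun t => E t ^ 2) (fun t => 2 * E t * dE t) (2 * K) a t0) as [g _]; [lra| | | |].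
- intros t ht; replace (2 * E t * dE t) with (INR 2 * dE t * E t ^ pred 2) by (simpl; ring).
  apply is_derive_pow, hE; trivial.
- intros t ht; apply continuous_ext with (fun t => E t * E t); [intros; simpl; ring|]; apply cont_mult; auto.
- intros t ht; specialize (bE t ht); rewrite !Rabs_mult, (Rabs_pos_eq 2), <- (pow2_abs (E t)) by lra.
  pose proof (Rabs_pos (E t)); nra.
- assert (Ea : E a = 0).
  { unfold E; rewrite la, ua; destruct oO as [-> _]; ring. }
  cbv beta in g; rewrite Ea in g; replace (0 ^ 2 * exp (2 * K * (t0 - a))) with 0 in g by ring.
  assert (E t0 = 0) by (apply Rsqr_0_uniq; unfold Rsqr; pose proof (pow2_ge_0 (E t0)); nra).
  unfold E in H; lra.
Qed.

(** The polar angle in (0, PI), the inverse cotangent of the slope. *)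
Definition alpha (t : R) : R := PI / 2 - atan (slope p q f t).

Lemma sin_alpha (t : R) : 0 < f t -> sin (alpha t) = usin t.
Proof.
intros h; unfold alpha; rewrite sin_shift, cos_atan, usin_slope by trivial.
unfold pw; rewrite Rpower_Ropp; replace (1 / 2) with (/ 2) by field.
rewrite Rpower_sqrt by apply one_sq_pos; unfold Rsqr, Rdiv; rewrite Rmult_1_l; do 2 f_equal; ring.
Qed.

Lemma alpha_derive (t : R) : 0 < f t -> is_derive alpha t (ThF t / Gam p (usin t)).
Proof.
intros h; pose proof (one_sq_pos (slope p q f t)); pose proof (Gam_usin_pos t h).
set (y := slope p q f t) in *.
replace (ThF t / Gam p (usin t)) with (0 - (- (1 + y ^ 2) * ThF t / Gam p (usin t)) * / (1 + y ^ 2)) by (field; lra).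
apply (is_derive_minus (fun _ => PI / 2) (fun t => atan (slope p q f t))); [apply @is_derive_const|].
apply (is_derive_comp atan (slope p q f)); [|apply slope_derive_polar; trivial].
apply is_derive_Reals, derivable_pt_lim_atan.
Qed.

(** The angle advances at the rate 1 / tau of the orbit, so clock (alpha t) - t is constant on the
    arc and f is a translate of [bump] there. Letting t tend to a, the translation places a rising
    zero of [bump] at a, so it agrees with t - a up to a period. *)
Lemma bump_match (a c' x1 : R) : a < c' -> f a = 0 -> Derive f a = dbump p b C hp hb x1 0 ->
  (forall t, a < t < c' -> 0 < f t) -> forall t, a < t < c' -> f t = bump p b C hp hb x1 (t - a).
Proof.
intros hac h0 h1 hpos; pose proof (mn_pos p b hp hb) as hm.
set (B := bump p b C hp hb x1); set (dB := dbump p b C hp hb x1) in *.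
pose (cl := clock p b C hp hb x1).
assert (lo : forall t, a < t < c' -> logV t = orb p b C hp hb x1 (usin t)).
{ intros t ht; apply (logV_orbit a); trivial; [lra|]; intros; apply hpos; lra. }
assert (d0 : forall t, a < t < c' -> is_derive (fun t => cl (alpha t) - t) t 0).
{ intros t ht; pose proof (hpos t ht) as hft; pose proof (Gam_usin_pos t hft).
  replace 0 with ((ThF t / Gam p (usin t)) * tau p b C hp hb x1 (alpha t) - 1).
  - apply (is_derive_minus (fun t => cl (alpha t)) (fun t => t)); [|apply @is_derive_id].
    apply (is_derive_comp cl alpha); [apply is_derive_clock | apply alpha_derive; trivial].
  - unfold tau, Thx; rewrite sin_alpha, <- lo by trivial; fold (ThF t).
    assert (0 < ThF t).
    { unfold ThF; rewrite lo by trivial; apply (orb_spec p b C hp hb x1), unit_abs.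
      pose proof (usin_unit t hft); lra. }
    field; lra. }
pose (t1 := (a + c') / 2); pose (k := cl (alpha t1) - t1).
assert (ck : forall t, a < t < c' -> cl (alpha t) = t + k).
{ assert (main : forall r s, a < r -> r <= s -> s < c' -> cl (alpha r) - r = cl (alpha s) - s).
  { intros r s hr hrs hs; apply (derive_zero_eq (fun t => cl (alpha t) - t) (fun _ => 0)); trivial.
    - intros t ht; apply d0; lra.
    - intros t ht; eapply is_derive_continuous, d0; lra. }
  intros t ht; unfold k; destruct (Rle_dec t t1).
  - pose proof (main t t1 ltac:(lra) ltac:(lra) ltac:(unfold t1; lra)); lra.
  - pose proof (main t1 t ltac:(unfold t1; lra) ltac:(lra) ltac:(lra)); lra. }
assert (fB : forall t, a < t < c' -> f t = B (t + k)).
{ intros t ht; pose proof (hpos t ht) as hft; pose proof (rsq_pos t hft) as hr.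
  unfold B, bump; rewrite <- ck by trivial; unfold cl; rewrite ang_clock, sin_alpha by trivial.
  unfold rho; rewrite sin_alpha, <- lo, <- ln_kn by trivial.
  replace ((logV t - ln (kn p q)) / mn p b) with (/ 2 * ln (rsq t)) by (unfold logV; field; lra).
  change (exp (/ 2 * ln (rsq t))) with (Rpower (rsq t) (/ 2)); rewrite Rpower_sqrt by trivial.
  unfold usin; pose proof (sqrt_lt_R0 _ hr); field; lra. }
assert (dBk : forall t, is_derive (fun t => B (t + k)) t (dB (t + k))).
{ intros t; replace (dB (t + k)) with (1 * dB (t + k)) by ring.
  apply (is_derive_comp B (fun t => t + k)); [apply is_derive_bump | auto_derive; trivial]. }
assert (dfB : forall t, a < t < c' -> Derive f t = dB (t + k)).
{ intros t ht; apply is_derive_unique, is_derive_ext_loc with (fun t => B (t + k)); [|apply dBk].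
  assert (hd : 0 < Rmin (t - a) (c' - t)) by (apply Rmin_pos; lra).
  exists (mkposreal _ hd); intros u hu; symmetry; apply fB.
  change (Rabs (u - t) < Rmin (t - a) (c' - t)) in hu.
  pose proof (Rmin_l (t - a) (c' - t)); pose proof (Rmin_r (t - a) (c' - t)).
  apply Rabs_lt_between in hu; lra. }
assert (Ba : f a - B (a + k) = 0).
{ apply (lim_right_eq (fun t => f t - B (t + k)) a c'); trivial.
  - apply cont_minus; [apply (sol_continuous p q c); trivial | eapply is_derive_continuous, dBk].
  - intros t ht; rewrite fB by trivial; ring. }
assert (dBa : Derive f a - dB (a + k) = 0).
{ apply (lim_right_eq (fun t => Derive f t - dB (t + k)) a c'); trivial.
  - apply cont_minus; [apply (sol_derive_continuous p q c); trivial|].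
    apply (cont_comp (fun t => t + k) dB); [apply cont_plus; [apply cont_id | apply cont_const] | apply dbump_continuous].
  - intros t ht; rewrite dfB by trivial; ring. }
assert (dB0 : 0 < dB 0).
{ unfold dB; rewrite dbump_0; apply Rmult_lt_0_compat; [trivial | apply exp_pos]. }
destruct (bump_zero_up p b C hp hb x1 (a + k)) as [j hj].
- fold B; lra.
- fold dB; lra.
- intros t ht; rewrite fB by trivial.
  replace (t + k) with (t - a + IZR j * (2 * half_period p b C hp hb x1)) by lra.
  apply (periodic_IZR B), bump_periodic.
Qed.

(** A later negative value forces a next zero c'. It cannot precede a + H, where [bump] is positive,
    nor follow it, because [bump] vanishes at H. *)
Lemma bump_step (a x1 : R) : f a = 0 -> Derive f a = dbump p b C hp hb x1 0 ->
  (exists t, a < t /\ f t < 0) ->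
  let H := half_period p b C hp hb x1 in
  (forall t, a <= t <= a + H -> f t = bump p b C hp hb x1 (t - a)) /\
  Derive f (a + H) = - dbump p b C hp hb x1 0.
Proof.
intros h0 h1 [tn [htn hfn]] H.
pose proof (half_period_pos p b C hp hb x1) as hH; fold H in hH.
set (B := bump p b C hp hb x1); set (dB := dbump p b C hp hb x1) in *.
assert (dB0 : 0 < dB 0).
{ unfold dB; rewrite dbump_0; apply Rmult_lt_0_compat; [trivial | apply exp_pos]. }
pose proof (sol_is_derive p q c f hf a) as da; rewrite h1 in da.
destruct (derive_pos_local f a _ da dB0) as [e [he [h2 _]]]; rewrite h0 in h2.
pose (a' := Rmin (a + e / 2) ((a + tn) / 2)).
assert (ha' : a < a' < tn /\ a' < a + e) by (unfold a', Rmin; destruct Rle_dec; lra).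
destruct (first_zero f a' tn) as [c' [hc1 [hc2 hc3]]]; try lra.
{ intros; apply (sol_continuous p q c); trivial. }
{ apply h2; lra. }
assert (hpos : forall t, a < t < c' -> 0 < f t).
{ intros t ht; destruct (Rlt_dec t a'); [apply h2; lra | apply hc3; lra]. }
pose proof (bump_match a c' x1 ltac:(lra) h0 h1 hpos) as m; fold B in m.
assert (cBa : forall t, continuous (fun t => B (t - a)) t).
{ intros t; apply (cont_comp (fun t => t - a) B); [apply cont_minus; [apply cont_id | apply cont_const] | apply bump_continuous]. }
assert (Bc : f c' - B (c' - a) = 0).
{ apply (lim_left_eq (fun t => f t - B (t - a)) a c'); [lra| |].
  - apply cont_minus; [apply (sol_continuous p q c); trivial | apply cBa].
  - intros t ht; rewrite m by trivial; ring. }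
assert (ec : c' = a + H).
{ destruct (Rtotal_order (c' - a) H) as [l|[l|l]]; [|lra|]; exfalso.
  - pose proof (bump_pos p b C hp hb x1 (c' - a) ltac:(fold H; lra)) as i; fold B in i; lra.
  - specialize (hpos (a + H) ltac:(lra)); rewrite m in hpos by lra.
    replace (a + H - a) with (0 + H) in hpos by ring.
    unfold B, H in hpos; rewrite bump_antiperiodic, bump_0 in hpos; lra. }
split.
- intros t ht; destruct (Req_dec t a) as [->|n1].
  + rewrite Rminus_diag; unfold B; rewrite bump_0; trivial.
  + destruct (Req_dec t c') as [->|n2]; [lra | apply m; lra].
- rewrite <- ec; unfold dB; rewrite <- dbump_H; fold H; replace H with (c' - a) by lra.
  apply Rminus_diag_uniq.
  apply (lim_left_eq (fun t => Derive f t - dB (t - a)) a c'); [lra| |].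
  + apply cont_minus; [apply (sol_derive_continuous p q c); trivial|].
    apply (cont_comp (fun t => t - a) dB); [apply cont_minus; [apply cont_id | apply cont_const] | apply dbump_continuous].
  + intros t ht; apply Rminus_diag_eq, is_derive_unique.
    apply is_derive_ext_loc with (fun t => B (t - a)).
    * assert (hd : 0 < Rmin (t - a) (c' - t)) by (apply Rmin_pos; lra).
      exists (mkposreal _ hd); intros u hu; symmetry; apply m.
      change (Rabs (u - t) < Rmin (t - a) (c' - t)) in hu.
      pose proof (Rmin_l (t - a) (c' - t)); pose proof (Rmin_r (t - a) (c' - t)).
      apply Rabs_lt_between in hu; lra.
    * replace (dB (t - a)) with (1 * dB (t - a)) by ring.
      apply (is_derive_comp B (fun t => t - a)); [apply is_derive_bump | auto_derive; trivial; ring].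
Qed.

End PolarCoordinates.

(** * Gluing of arcs and the closing condition *)

Lemma periodic_value_after (f : R -> R) (t a : R) : (forall s, f (s + 2 * PI) = f s) ->
  exists u, a < u /\ f u = f t.
Proof.
intros per; pose proof PI_RGT_0.
destruct (shift_into (2 * PI) t (a + 1)) as [k hk]; [lra|].
exists (t + IZR k * (2 * PI)); split; [lra | apply periodic_IZR; trivial].
Qed.

(** At a + H the function - f starts again with the same slope. The hypothesis of changing sign
    passes to - f, and periodicity supplies a later negative value at each step. *)
Lemma bump_chain (x1 : R) (n : nat) : forall (f : R -> R) (a : R), sign_changing_solution p q c f ->
  f a = 0 -> Derive f a = dbump p b C hp hb x1 0 ->
  forall t, a <= t <= a + INR n * half_period p b C hp hb x1 -> f t = bump p b C hp hb x1 (t - a).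
Proof.
set (H := half_period p b C hp hb x1).
induction n as [|n IH]; intros f a hf h0 h1 t ht.
- simpl in ht; replace t with a by lra; rewrite Rminus_diag, bump_0; trivial.
- rewrite S_INR in ht.
  destruct hf as [hs [[tp htp] [tn htn]]].
  assert (per : forall s, f (s + 2 * PI) = f s) by apply hs.
  destruct (bump_step f hs a x1 h0 h1) as [s1 s2].
  { destruct (periodic_value_after f tn a per) as [u [hu e]]; exists u; split; trivial; lra. }
  fold H in s1, s2.
  pose proof (half_period_pos p b C hp hb x1) as hH; fold H in hH.
  destruct (Rle_dec t (a + H)) as [l|l]; [apply s1; lra|].
  assert (e : - f t = bump p b C hp hb x1 (t - (a + H))).
  { apply (IH (fun s => - f s) (a + H)).
    - split; [apply solution_opp; trivial|]; split; [exists tn | exists tp]; lra.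
    - rewrite s1 by lra; replace (a + H - a) with (0 + H) by ring; unfold H; rewrite bump_antiperiodic, bump_0; ring.
    - rewrite Derive_opp, s2; ring.
    - lra. }
  replace (t - a) with (t - (a + H) + H) by ring; unfold H at 2; rewrite bump_antiperiodic; lra.
Qed.

Lemma INR_archimed (x : R) : exists n : nat, x <= INR n.
Proof.
exists (Z.to_nat (Z.max 0 (up x))); destruct (archimed x) as [h _].
rewrite INR_IZR_INZ, Z2Nat.id by apply Z.le_max_l.
pose proof (IZR_le _ _ (Z.le_max_r 0 (up x))); lra.
Qed.

(** From a rising zero a on, f is a translated [bump]. Periodicity makes 2 PI a rising zero of
    [bump], that is 2 PI = 2 j H; the identity then extends to all s by periodicity of both
    sides. *)
Lemma sign_changing_classification (f : R -> R) : sign_changing_solution p q c f ->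
  exists (x1 a : R) (k : nat), (1 <= k)%nat /\ half_period p b C hp hb x1 = PI / INR k /\
    forall s, f s = bump p b C hp hb x1 (s - a).
Proof.
intros hf; pose proof PI_RGT_0 as hpi.
assert (hf' := hf); destruct hf' as [hs [[s0 hs0] [tn htn]]].
assert (per : forall s, f (s + 2 * PI) = f s) by apply hs.
assert (left : exists t, t < s0 /\ f t < 0).
{ destruct (shift_into (2 * PI) tn (s0 - 2 * PI)) as [k hk]; [lra|].
  exists (tn + IZR k * (2 * PI)); split; [lra|]; rewrite (periodic_IZR f); trivial. }
destruct left as [t0 [ht0 hft0]].
(* Time is reversed in order to reach the last zero before [s0]. *)
destruct (first_zero (fun r => f (s0 - r)) 0 (s0 - t0)) as [r [hr1 [hr2 hr3]]]; [lra| | | |].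
{ intros r _; apply (cont_comp (fun r => s0 - r) f); [apply cont_minus; [apply cont_const | apply cont_id]|].
  apply (sol_continuous p q c); trivial. }
{ rewrite Rminus_0_r; trivial. }
{ replace (s0 - (s0 - t0)) with t0 by ring; lra. }
set (a := s0 - r) in *.
assert (hpos : forall t, a < t <= s0 -> 0 < f t).
{ intros t ht; specialize (hr3 (s0 - t) ltac:(unfold a in ht; lra)).
  replace (s0 - (s0 - t)) with t in hr3 by ring; trivial. }
assert (hD : 0 < Derive f a) by (apply (nondegenerate_zero f hs a s0); trivial; unfold a; lra).
(* Solves b exp ((x1 - (1-p) ln b) / m) = f' a, the left side being the slope of [bump] at 0. *)
pose (x1 := mn p b * ln (Derive f a / b) + (1 - p) * ln b).
pose proof (mn_pos p b hp hb) as hm.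
assert (hx1 : Derive f a = dbump p b C hp hb x1 0).
{ rewrite dbump_0; unfold x1.
  replace ((mn p b * ln (Derive f a / b) + (1 - p) * ln b - (1 - p) * ln b) / mn p b) with (ln (Derive f a / b)) by (field; lra).
  rewrite exp_ln by (apply Rdiv_lt_0_compat; lra); field; lra. }
set (H := half_period p b C hp hb x1); pose proof (half_period_pos p b C hp hb x1) as hH; fold H in hH.
assert (fw : forall t, a <= t -> f t = bump p b C hp hb x1 (t - a)).
{ intros t ht; destruct (INR_archimed ((t - a) / H)) as [n hn].
  apply (bump_chain x1 n); trivial; fold H; split; trivial.
  apply (Rmult_le_compat_r H) in hn; [|lra].
  replace ((t - a) / H * H) with (t - a) in hn by (field; lra); lra. }
assert (b2 : bump p b C hp hb x1 (2 * PI) = 0).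
{ replace (2 * PI) with (a + 2 * PI - a) by ring; rewrite <- fw by lra; rewrite per; trivial. }
assert (db2 : dbump p b C hp hb x1 (2 * PI) = dbump p b C hp hb x1 0).
{ rewrite <- hx1; symmetry; apply is_derive_unique.
  apply is_derive_ext with (fun s => f (s + 2 * PI)); [intros; apply per|].
  replace (dbump p b C hp hb x1 (2 * PI)) with (1 * dbump p b C hp hb x1 (2 * PI)) by ring.
  apply (is_derive_comp f (fun s => s + 2 * PI)); [|auto_derive; trivial].
  apply is_derive_ext_loc with (fun t => bump p b C hp hb x1 (t - a)).
  - exists (mkposreal PI hpi); intros u hu; symmetry; apply fw.
    change (Rabs (u - (a + 2 * PI)) < PI) in hu; apply Rabs_lt_between in hu; lra.
  - replace (dbump p b C hp hb x1 (2 * PI)) with (1 * dbump p b C hp hb x1 (a + 2 * PI - a)) by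
      (replace (a + 2 * PI - a) with (2 * PI) by ring; ring).
    apply (is_derive_comp (bump p b C hp hb x1) (fun t => t - a)); [apply is_derive_bump | auto_derive; trivial; ring]. }
destruct (bump_zero_up p b C hp hb x1 (2 * PI) b2) as [j hj]; [rewrite db2, <- hx1; trivial|].
fold H in hj.
assert (jp : (0 < j)%Z) by (apply lt_IZR; nra).
assert (jn : INR (Z.to_nat j) = IZR j) by (rewrite INR_IZR_INZ, Z2Nat.id by lia; trivial).
assert (jr : 0 < IZR j) by (apply IZR_lt; trivial).
exists x1, a, (Z.to_nat j); split; [lia|]; split.
- fold H; rewrite jn; apply (Rmult_eq_reg_l (IZR j)); [|lra]; field_simplify; lra.
- intros s; destruct (shift_into (2 * PI) s a) as [k hk]; [lra|].
  rewrite <- (periodic_IZR f (2 * PI) k s per), fw by lra.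
  replace (s + IZR k * (2 * PI) - a) with (s - a + IZR (k * j) * (2 * H)).
  + apply (periodic_IZR (bump p b C hp hb x1)), bump_periodic.
  + rewrite mult_IZR, hj; ring.
Qed.

End SignChanging.

Lemma nat_least (P : nat -> Prop) : (exists n, P n) -> exists n, P n /\ forall m, P m -> (n <= m)%nat.
Proof.
intros [n hn]; revert hn; induction n as [n IH] using (well_founded_induction Wf_nat.lt_wf); intros hn.
destruct (classic (exists m, P m /\ (m < n)%nat)) as [[m [hm hmn]]|no]; [apply (IH m); trivial|].
exists n; split; trivial; intros m hm; destruct (Nat.le_gt_cases n m); trivial.
exfalso; apply no; exists m; split; trivial.
Qed.

(** * The limit period, [M_q], and the two families of solutions *)

Section LimitPeriod.

Variables (p q c : R).
Hypotheses (hp : 1 < p) (hq : p - 1 < q).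

Let b := beta_q p q.
Let hb : 0 < b := b_pos p q hp hq.
Let C := Cn p q c.

Lemma C_lt_gq : c < c_q p q <-> C < gq p b.
Proof.
pose proof (Cn_gq p q c hp hq) as e; pose proof (kn_pos p q) as hk; fold b in e; fold C in e.
split; intros h; [|apply Rnot_le_lt; intros l]; nra.
Qed.

Lemma tau_lim_continuous (a : R) : C < gq p b -> continuous (tau_lim p b C) a.
Proof.
intros hC; destruct (Jf_min p b C hp hb hC) as [e [he hJ]].
apply cont_div; [apply Gam_sin_continuous | apply Jf_sin_continuous; trivial|].
pose proof (SIN_bound a); destruct (Rle_dec 0 (sin a)).
- specialize (hJ (sin a) ltac:(lra)); lra.
- specialize (hJ (- sin a) ltac:(lra)); unfold Jf in *; rewrite Th_opp in hJ; lra.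
Qed.

Lemma tau_lim_integral : C < gq p b -> RInt (tau_lim p b C) 0 PI = 2 * RInt (tau_lim p b C) 0 (PI / 2).
Proof.
intros hC; set (g := tau_lim p b C).
assert (ex : forall u v, ex_RInt g u v).
{ intros u v; apply (ex_RInt_continuous (V := R_CompleteNormedModule)); intros; apply tau_lim_continuous; trivial. }
assert (refl : RInt g (PI / 2) PI = RInt g 0 (PI / 2)).
{ apply is_RInt_unique.
  pose proof (RInt_correct (V := R_CompleteNormedModule) g (PI / 2) 0 (ex _ _)) as h.
  rewrite <- opp_RInt_swap in h by apply ex.
  assert (h2 : is_RInt g (-1 * (PI / 2) + PI) (-1 * PI + PI) (opp (RInt g 0 (PI / 2)))).
  { replace (-1 * (PI / 2) + PI) with (PI / 2) by field; replace (-1 * PI + PI) with 0 by ring; exact h. }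
  apply (is_RInt_comp_lin (V := R_NormedModule)) in h2.
  apply (is_RInt_opp (V := R_NormedModule)) in h2; rewrite opp_opp in h2.
  apply is_RInt_ext with (2 := h2); intros a _.
  unfold opp, scal; simpl; unfold mult; simpl.
  replace (-1 * a + PI) with (PI - a) by ring.
  unfold g, tau_lim; rewrite sin_PI_x; ring. }
rewrite <- (RInt_Chasles (V := R_CompleteNormedModule) g 0 (PI / 2) PI) by apply ex.
rewrite refl; unfold plus; simpl; ring.
Qed.

(** In [M_q] the variable theta is the complement PI/2 - a of the polar angle. One has Gam (cos
    theta) = cos^2 theta (1 + (p-1) tan^2 theta), and Jf (cos theta) is kn cos^2 theta times the
    denominator in [M_q]; so the integrands differ by the factor kn. Symmetry about PI/2 gives the
    factor 2. *)
Lemma M_q_limit : c < c_q p q -> M_q p q c = PI / RInt (tau_lim p b C) 0 PI.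
Proof.
intros hc; assert (hC := proj1 C_lt_gq hc); pose proof PI_RGT_0 as hpi.
rewrite tau_lim_integral by trivial; set (g := tau_lim p b C).
pose proof (kn_pos p q) as hk.
assert (ex : forall u v, ex_RInt g u v).
{ intros u v; apply (ex_RInt_continuous (V := R_CompleteNormedModule)); intros; apply tau_lim_continuous; trivial. }
assert (gp : 0 < RInt g 0 PI).
{ apply Rlt_trans with (half_period p b C hp hb 0); [apply half_period_pos | apply half_period_lt_lim; trivial]. }
unfold g in gp; rewrite tau_lim_integral in gp by trivial; fold g in gp.
unfold M_q; fold b.
assert (e : RInt (fun theta => (1 + (p - 1) * (tan theta) ^ 2) /
   (Rpower b p * (p - 1) * (tan theta) ^ 2 + c_q p q - c * Rpower (cos theta) (p - 2))) 0 (PI / 2) =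
   kn p q * RInt g 0 (PI / 2)).
{ apply is_RInt_unique.
  pose proof (RInt_correct (V := R_CompleteNormedModule) g (PI / 2) 0 (ex _ _)) as h.
  rewrite <- opp_RInt_swap in h by apply ex.
  assert (h2 : is_RInt g (-1 * 0 + PI / 2) (-1 * (PI / 2) + PI / 2) (opp (RInt g 0 (PI / 2)))).
  { replace (-1 * 0 + PI / 2) with (PI / 2) by field; replace (-1 * (PI / 2) + PI / 2) with 0 by field; exact h. }
  apply (is_RInt_comp_lin (V := R_NormedModule)) in h2.
  apply (is_RInt_scal (V := R_NormedModule) _ _ _ (- kn p q)) in h2.
  replace (kn p q * RInt g 0 (PI / 2)) with (scal (- kn p q) (opp (RInt g 0 (PI / 2)))) by
    (unfold scal, opp; simpl; unfold mult; simpl; ring).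
  apply is_RInt_ext with (2 := h2); intros a ha.
  (* The integrands need only agree on the open interval, where cos a > 0; the value of tan at PI /
     2 does not intervene. *)
  rewrite Rmin_left, Rmax_right in ha by lra.
  unfold scal; simpl; unfold mult; simpl.
  replace (-1 * a + PI / 2) with (PI / 2 - a) by ring.
  pose proof (cos_gt_0 a ltac:(lra) ltac:(lra)) as hcos.
  pose proof (COS_bound a) as hcb.
  unfold g, tau_lim; rewrite sin_shift.
  destruct (Jf_min p b C hp hb hC) as [e [he hJ]]; specialize (hJ (cos a) ltac:(lra)).
  assert (eJ : Jf p b C (cos a) = kn p q * (cos a ^ 2 * (Rpower b p * (p - 1) * (tan a * (tan a * 1)) + c_q p q - c * Rpower (cos a) (p - 2)))).
  { unfold Jf, Th, Gam, Qf, Q0; rewrite sp_pos by trivial.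
    replace (gq p b) with (kn p q * c_q p q) by apply (kn_cq p q hp hq).
    assert (e1 : kn p q * Rpower b p = b).
    { unfold kn; fold b; rewrite <- Rpower_plus; replace (1 - p + p) with 1 by ring; apply Rpower_1; trivial. }
    assert (e2 : Rpower (cos a) (p - 1) = Rpower (cos a) (p - 2) * cos a) by (rewrite <- Rpower_succ by trivial; f_equal; ring).
    pose proof (sin2_cos2 a) as e3; unfold Rsqr in e3.
    assert (e4 : 1 - cos a ^ 2 = sin a ^ 2) by (simpl; lra).
    transitivity (b * (p - 1) * sin a ^ 2 + kn p q * c_q p q * cos a ^ 2 - kn p q * c * (Rpower (cos a) (p - 2) * cos a) * cos a).
    - rewrite e4, e2; unfold C, Cn; fold b; fold (kn p q); unfold kn; fold b; ring.
    - rewrite <- e1 at 1; unfold tan; field; lra. }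
  rewrite eJ.
  set (D := Rpower b p * (p - 1) * (tan a * (tan a * 1)) + c_q p q - c * Rpower (cos a) (p - 2)) in *.
  assert (D <> 0).
  { intros e0; rewrite e0 in eJ; replace (kn p q * (cos a ^ 2 * 0)) with 0 in eJ by ring; lra. }
  assert (eG : Gam p (cos a) = cos a ^ 2 * (1 + (p - 1) * (tan a * (tan a * 1)))).
  { unfold Gam; pose proof (sin2_cos2 a) as e3; unfold Rsqr in e3.
    assert (e4 : 1 - cos a ^ 2 = sin a ^ 2) by (simpl; lra).
    rewrite e4; unfold tan; field; lra. }
  rewrite eG; field; repeat split; lra. }
rewrite e; unfold kn; fold b; pose proof (Rpower_gt0 b (1 - p)); field; split; lra.
Qed.

(** For c < c_q the half period stays strictly below PI / M_q and takes every value in between, so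
    PI / k is attained exactly when k > M_q; hence the strict inequality in the definition of
    k_q. *)
Lemma sign_changing_solutions :
  exists (kq : nat) (w : nat -> R -> R),
     is_k_q p q c kq /\
     (forall k : nat, (kq <= k)%nat -> is_least_period (w k) (2 * PI / INR k)) /\
     (forall f : R -> R,
        sign_changing_solution p q c f <->
        exists (k : nat) (psi : R), (kq <= k)%nat /\ forall s, f s = w k (s + psi)).
Proof.
pose proof PI_RGT_0 as hpi.
assert (hkq : exists kq, is_k_q p q c kq).
{ destruct (Rlt_dec c (c_q p q)) as [l|l].
  - destruct (nat_least (fun k => (1 <= k)%nat /\ M_q p q c < INR k)) as [k [[h1 h2] h3]].
    + destruct (INR_archimed (M_q p q c)) as [n hn]; exists (S n); split; [lia|]; rewrite S_INR; lra.
    + exists k; split; [lra|]; intros _; repeat split; trivial; intros j h4 h5; apply h3; split; trivial.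
  - exists 1%nat; split; [trivial | lra]. }
destruct hkq as [kq hkq].
assert (kq1 : (1 <= kq)%nat).
{ destruct hkq as [h1 h2]; destruct (Rlt_dec c (c_q p q)) as [l|l]; [apply h2; trivial | rewrite h1; [lia | lra]]. }
assert (inr : forall k, (1 <= k)%nat -> 0 < INR k) by (intros k hk; apply lt_0_INR; lia).
assert (sel : forall k, exists x1, (kq <= k)%nat -> half_period p b C hp hb x1 = PI / INR k).
{ intros k; destruct (Nat.le_gt_cases kq k) as [hk|hk]; [|exists 0; lia].
  pose proof (inr k ltac:(lia)) as hik.
  destruct (half_period_onto p b C hp hb (PI / INR k)) as [x1 hx1].
  - apply Rdiv_lt_0_compat; trivial.
  - intros hC; pose proof (proj2 C_lt_gq hC) as hc.
    destruct (proj2 hkq hc) as [_ [h2 _]]; rewrite M_q_limit in h2 by trivial.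
    set (I0 := RInt (tau_lim p b C) 0 PI) in *.
    assert (0 < I0).
    { apply Rlt_trans with (half_period p b C hp hb 0); [apply half_period_pos | apply half_period_lt_lim; trivial]. }
    assert (h4 : PI / I0 < INR k) by (apply Rlt_le_trans with (INR kq); [trivial | apply le_INR; trivial]).
    apply (Rmult_lt_reg_r (INR k)); trivial.
    apply (Rmult_lt_compat_r I0) in h4; trivial.
    replace (PI / I0 * I0) with PI in h4 by (field; lra).
    replace (PI / INR k * INR k) with PI by (field; lra); lra.
  - exists x1; trivial. }
pose (x1 := fun k => proj1_sig (constructive_indefinite_description _ (sel k))).
assert (hx1 : forall k, (kq <= k)%nat -> half_period p b C hp hb (x1 k) = PI / INR k).
{ intros k; unfold x1; apply (proj2_sig (constructive_indefinite_description _ (sel k))). }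
exists kq, (fun k => bump p b C hp hb (x1 k)); split; [trivial|]; split.
- intros k hk; replace (2 * PI / INR k) with (2 * half_period p b C hp hb (x1 k)).
  + apply bump_least_period.
  + rewrite hx1 by trivial; pose proof (inr k ltac:(lia)); field; lra.
- intros f; split.
  + intros hf; destruct (sign_changing_classification p q c hp hq f hf) as [x [a [k [hk [hH e]]]]].
    fold b hb C in hH, e.
    assert (hkk : (kq <= k)%nat).
    { destruct (Rlt_dec c (c_q p q)) as [l|l].
      - apply (proj2 hkq l); trivial; rewrite M_q_limit by trivial.
        pose proof (proj1 C_lt_gq l) as hC; pose proof (half_period_lt_lim p b C hp hb x hC) as h; rewrite hH in h.
        pose proof (inr k hk) as hik.
        set (I0 := RInt (tau_lim p b C) 0 PI) in *.
        assert (0 < I0) by (apply Rlt_trans with (PI / INR k); [apply Rdiv_lt_0_compat; trivial | trivial]).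
        apply (Rmult_lt_reg_r I0); trivial.
        apply (Rmult_lt_compat_r (INR k)) in h; trivial.
        replace (PI / INR k * INR k) with PI in h by (field; lra).
        replace (PI / I0 * I0) with PI by (field; lra); lra.
      - rewrite (proj1 hkq) by lra; trivial. }
    exists k, (- a); split; trivial; intros s; rewrite e.
    (* Strict monotonicity of the half period: the value PI / k determines the orbit, so each k
       contributes the translates of one function only. *)
    replace (x1 k) with x; [trivial|].
    pose proof (hx1 k hkk) as hk2.
    destruct (Rtotal_order x (x1 k)) as [l|[l|l]]; trivial; exfalso;
      pose proof (half_period_decreasing p b C hp hb _ _ l); lra.
  + intros [k [psi [hk e]]].
    assert (ef : f = fun s => bump p b C hp hb (x1 k) (s + psi)) by (apply functional_extensionality; trivial).
    rewrite ef; apply (bump_solution p q c hp hq (x1 k) psi k); [lia | apply hx1; trivial].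
Qed.

(** The orbit of half period PI / k. Since x' = p y, a period of w is a period of y; as y is
    positive on the first half of the period and negative on the second, no shorter one exists. *)
Lemma positive_wave (k : nat) : (1 <= k)%nat -> INR k ^ 2 < p * (C - gq p b) ->
  exists w : R -> R, nonconstant w /\ is_positive w /\ is_least_period w (2 * PI / INR k) /\
    forall psi, positive_solution p q c (fun s => w (s + psi)).
Proof.
intros hk hfreq; pose proof PI_RGT_0 as hpi.
assert (hik : 0 < INR k) by (apply lt_0_INR; lia).
destruct (positive_orbit p b C (INR k) hp hb hik hfreq) as [x [y [dx [dy [px [py [y0 [ypos yneg]]]]]]]].
set (l := PI / INR k) in *.
assert (hl : 0 < l) by (apply Rdiv_lt_0_compat; trivial).
assert (e2l : 2 * PI / INR k = 2 * l) by (unfold l; field; lra).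
pose (w := fun t => exp ((x t - ln (kn p q)) / (q + 1 - p))).
assert (winj : forall s t, w s = w t -> x s = x t).
{ intros s t h; unfold w in h; apply exp_inv in h.
  apply (Rmult_eq_compat_r (q + 1 - p)) in h.
  replace ((x s - ln (kn p q)) / (q + 1 - p) * (q + 1 - p)) with (x s - ln (kn p q)) in h by (field; lra).
  replace ((x t - ln (kn p q)) / (q + 1 - p) * (q + 1 - p)) with (x t - ln (kn p q)) in h by (field; lra).
  lra. }
exists w; split; [|split; [|split]].
- exists 0, l; intros h; apply winj in h.
  assert (x 0 < x l); [|lra].
  apply (derive_pos_lt x (fun t => p * y t)); trivial; intros t ht.
  + eapply is_derive_continuous, dx.
  + specialize (ypos t ht); nra.
- intros s; apply exp_pos.
- rewrite e2l; split; [lra|]; split.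
  + intros s; unfold w; rewrite px; trivial.
  + intros T hT per.
    assert (yper : forall s, y (s + T) = y s).
    { intros s.
      assert (d1 : is_derive x s (p * y (s + T))).
      { apply is_derive_ext with (fun s => x (s + T)); [intros; apply winj, per|].
        replace (p * y (s + T)) with (1 * (p * y (s + T))) by ring.
        apply (is_derive_comp x (fun s => s + T)); [apply dx | auto_derive; trivial]. }
      pose proof (is_derive_unique _ _ _ d1) as u; rewrite (is_derive_unique _ _ _ (dx s)) in u; nra. }
    pose proof (yper 0) as e0; rewrite Rplus_0_l, y0 in e0.
    destruct (Rtotal_order T l) as [h|[h|h]].
    * pose proof (ypos T ltac:(lra)); lra.
    * pose proof (yper (l / 2)) as e1; pose proof (ypos (l / 2) ltac:(lra)); pose proof (yneg (l / 2 + T) ltac:(lra)); lra.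
    * pose proof (yneg T ltac:(lra)); lra.
- intros psi.
  assert (shift : forall (g : R -> R) d s, is_derive g (s + psi) d -> is_derive (fun s => g (s + psi)) s d).
  { intros g d s h; replace d with (1 * d) by ring.
    apply (is_derive_comp g (fun s => s + psi)); [exact h | auto_derive; trivial]. }
  apply (positive_solution_of_system p q c hp hq (fun s => y (s + psi)) (fun s => x (s + psi))).
  + intros t; apply shift, dx.
  + intros t; apply shift, dy.
  + intros t; replace (t + 2 * PI + psi) with (t + psi + IZR (Z.of_nat k) * (2 * l)).
    * apply (periodic_IZR x); trivial.
    * rewrite <- INR_IZR_INZ; unfold l; field; lra.
Qed.

Lemma positive_nonconstant_solutions : Rpower (beta_q p q) (p - 1) / p < c - c_q p q ->
     exists (kp : nat) (w : nat -> R -> R),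
       is_k_q_plus p q c kp /\
       (forall k : nat, (1 <= k <= kp)%nat ->
          nonconstant (w k) /\ is_positive (w k) /\
          is_least_period (w k) (2 * PI / INR k)) /\
       (forall (f : R -> R) (k : nat) (psi : R), (1 <= k <= kp)%nat ->
          (forall s, f s = w k (s + psi)) -> positive_solution p q c f).
Proof.
intros hc.
assert (h1 : 1 < p * (C - gq p b)).
{ apply Rnot_le_lt; intros h; apply (threshold_kn p q c hp hq) in h; lra. }
assert (ex : p * Rpower (beta_q p q) (1 - p) * (c - c_q p q) = p * (C - gq p b)).
{ unfold b, C; rewrite (Cn_gq p q c hp hq); unfold kn; ring. }
set (r := sqrt (p * Rpower (beta_q p q) (1 - p) * (c - c_q p q))).
assert (hr : r ^ 2 = p * (C - gq p b)) by (unfold r; rewrite pow2_sqrt, ex; lra).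
assert (r0 : 0 <= r) by apply sqrt_pos.
(* The least n with r <= n is a successor because r > 1; its predecessor is the largest integer
   strictly below r, also when r is an integer. *)
destruct (nat_least (fun n => r <= INR n)) as [n [hn1 hn2]]; [apply INR_archimed|].
assert (r1 : 1 < r) by nra.
destruct n as [|kp]; [simpl in hn1; lra|].
assert (hkp : INR kp < r).
{ apply Rnot_le_lt; intros h; specialize (hn2 kp h); lia. }
assert (sel : forall k, exists w : R -> R, (1 <= k <= kp)%nat ->
   nonconstant w /\ is_positive w /\ is_least_period w (2 * PI / INR k) /\
   forall psi, positive_solution p q c (fun s => w (s + psi))).
{ intros k; destruct (classic (1 <= k <= kp)%nat) as [hk|hk]; [|exists (fun _ => 0); tauto].
  assert (hik : 0 < INR k) by (apply lt_0_INR; lia).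
  assert (INR k <= INR kp) by (apply le_INR; lia).
  destruct (positive_wave k) as [w hw]; [lia | nra | exists w; trivial]. }
pose (w := fun k => proj1_sig (constructive_indefinite_description _ (sel k))).
assert (hw : forall k, (1 <= k <= kp)%nat -> nonconstant (w k) /\ is_positive (w k) /\ is_least_period (w k) (2 * PI / INR k) /\
   forall psi, positive_solution p q c (fun s => w k (s + psi))).
{ intros k; unfold w; apply (proj2_sig (constructive_indefinite_description _ (sel k))). }
exists kp, w; split; [|split].
- split; [exact hkp|]; intros j hj; fold r in hj.
  assert (INR j < INR (S kp)) by lra; apply INR_lt in H; lia.
- intros k hk; destruct (hw k hk) as [a1 [a2 [a3 _]]]; repeat split; trivial; apply a3.
- intros f k psi hk e.
  assert (ef : f = fun s => w k (s + psi)) by (apply functional_extensionality; trivial).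
  rewrite ef; apply hw; trivial.
Qed.

End LimitPeriod.

Theorem theorem2 (p q c : R) (hp : 1 < p) (hq : p - 1 < q) :
  (exists (kq : nat) (w : nat -> R -> R),
     is_k_q p q c kq /\
     (forall k : nat, (kq <= k)%nat -> is_least_period (w k) (2 * PI / INR k)) /\
     (forall f : R -> R,
        sign_changing_solution p q c f <->
        exists (k : nat) (psi : R),
          (kq <= k)%nat /\ forall s, f s = w k (s + psi)))
  /\
  (c <= c_q p q -> forall f : R -> R, ~ positive_solution p q c f)
  /\
  (0 < c - c_q p q <= Rpower (beta_q p q) (p - 1) / p ->
     forall f : R -> R,
       positive_solution p q c f <-> forall s, f s = constant_value p q c)
  /\
  (Rpower (beta_q p q) (p - 1) / p < c - c_q p q ->
     positive_solution p q c (fun _ => constant_value p q c) /\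
     exists (kp : nat) (w : nat -> R -> R),
       is_k_q_plus p q c kp /\
       (forall k : nat, (1 <= k <= kp)%nat ->
          nonconstant (w k) /\ is_positive (w k) /\
          is_least_period (w k) (2 * PI / INR k)) /\
       (forall (f : R -> R) (k : nat) (psi : R), (1 <= k <= kp)%nat ->
          (forall s, f s = w k (s + psi)) -> positive_solution p q c f)).
Proof.
split; [|split; [|split]].
- apply sign_changing_solutions; trivial.
- intros hc f hf; exact (no_positive p q c hp hq f hf hc).
- intros [h1 h2] f; split.
  + intros hf; apply (rigidity_value p q c hp hq f hf), threshold_kn; trivial.
  + intros e.
    assert (ef : f = fun _ => constant_value p q c) by (apply functional_extensionality; trivial).
    rewrite ef; apply constant_solution; trivial.
- intros h; split; [|apply positive_nonconstant_solutions; trivial].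
  apply constant_solution; trivial.
  apply Rlt_trans with (2 := h); apply Rdiv_lt_0_compat; [apply Rpower_gt0 | lra].
Qed.
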